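(* Let $\mathfrak g=\mathfrak{pe}(n)$, let $\lambda\in\mathfrak h^*$ be an integral weight, let $\overline\lambda\in W\cdot\lambda$ be the unique dominant element, and regard $\Delta(\lambda)$ as a submodule of $\Delta(\overline\lambda)$. Suppose that $\mu\in\mathfrak h^*$ is not anti-dominant. Then $$\dim\mathrm{Ext}^1_{\mathcal O}(L(\mu),\Delta(\lambda))=\big[\mathrm{soc}\big(\Delta(\overline\lambda)/\Delta(\lambda)\big):L(\mu)\big].$$
   Context: Everything is over $\mathbb C$; modules are supermodules and parities are not tracked. The periplectic Lie superalgebra $\mathfrak{pe}(n)\subset\mathfrak{gl}(n|n)$ consists of the block matrices $\begin{pmatrix}A&B\\ C&-A^t\end{pmatrix}$ with $A,B,C\in\mathbb C^{n\times n}$, $B^t=B$, $C^t=-C$, with the super commutator; $\mathfrak g_{\bar 0}\cong\mathfrak{gl}(n)$ is the subalgebra $B=C=0$ and $\mathfrak g_1$ is given by $A=C=0$. $\mathfrak h$ is the subalgebra of diagonal matrices. $\mathfrak b_{\bar0}=\mathfrak h\oplus\mathfrak n_{\bar 0}$ is the Borel subalgebra of $\mathfrak g_{\bar 0}$ given by upper triangular $A$; $\mathfrak b=\mathfrak b_{\bar 0}\oplus\mathfrak g_1$ and $\mathfrak n=\mathfrak n_{\bar 0}\oplus\mathfrak g_1$. $\mathcal O$ is the category of finitely generated $\mathfrak g$-modules that are $\mathfrak h$-semisimple and locally $U(\mathfrak n)$-finite. $\Delta(\lambda)=U(\mathfrak g)\otimes_{U(\mathfrak b)}\mathbb C_\lambda$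 is the Verma module, with simple quotient $L(\lambda)$. For integral $\lambda$, $\Delta(\lambda)$ embeds into $\Delta(\overline\lambda)$, uniquely up to scalar. $[M:L]$ denotes the multiplicity of the simple module $L$ in $M$. $W=\mathfrak S_n$ is the Weyl group of $\mathfrak g_{\bar 0}$, $w\cdot\lambda=w(\lambda+\rho_{\bar 0})-\rho_{\bar 0}$ with $\rho_{\bar 0}$ the half-sum of positive even roots. A weight is integral if $\langle\lambda,\alpha^\vee\rangle\in\mathbb Z$ for all even roots $\alpha$. A weight $\lambda$ is dominant (resp. anti-dominant) if $\langle\lambda+\rho_{\bar 0},\alpha^\vee\rangle\notin\mathbb Z_{<0}$ (resp. $\notin\mathbb Z_{>0}$) for all positive even roots $\alpha$. *)

(* Defs.v *)
From HB Require Import structures.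
From mathcomp Require Import all_boot all_order all_algebra perm.
From mathcomp Require Import finmap monalg boolp reals complex.

Set Implicit Arguments.
Unset Strict Implicit.
Unset Printing Implicit Defensive.

Import GRing.Theory Num.Theory.
Local Open Scope ring_scope.
Local Open Scope quotient_scope.

Section Subspace.
Context (C : fieldType) (V : lmodType C).

Definition mk_subspace (P : V -> Prop)
    (h : submod_closed (fun v => `[< P v >])) : submodClosed V :=
  HB.pack_for (submodClosed V) (fun v => `[< P v >])
    (GRing.isSubmodClosed.Build C V (fun v => `[< P v >]) h).

Lemma mk_subspaceP P h v : (v \in @mk_subspace P h) <-> P v.
Proof. by split=> /asboolP. Qed.

Lemma submod_closedP (P : V -> Prop) :
  P 0 -> (forall c u v, P u -> P v -> P (c *: u + v)) ->
  submod_closed (fun v => `[< P v >]).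
Proof.
move=> P0 Pl; split; first exact/asboolP.
by move=> c u v /asboolP Pu /asboolP Pv; apply/asboolP/Pl.
Qed.

Context (U : submodClosed V).

Lemma subspaceN : oppr_closed U.
Proof. by move=> v vU; rewrite -scaleN1r rpredZ. Qed.

Definition subspace_zmod : zmodClosed V :=
  HB.pack_for (zmodClosed V) (GRing.SubmodClosed.sort U)
    (GRing.isOppClosed.Build V (GRing.SubmodClosed.sort U) subspaceN).

Definition quotient := Quotient.quot subspace_zmod.
HB.instance Definition _ := GRing.Zmodule.on quotient.

Definition proj (v : V) : quotient := \pi_quotient v.

Lemma projP u v : proj u = proj v <-> u - v \in U.
Proof. by split=> [/eqP|h]; [|apply/eqP]; rewrite /proj piE Quotient.equivE. Qed.
Lemma projW (P : quotient -> Prop) : (forall v, P (proj v)) -> forall x, P x.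
Proof. by move=> h x; rewrite -[x]reprK; exact: h. Qed.
Lemma projK x : proj (repr x) = x. Proof. exact: reprK. Qed.
Lemma proj0 : proj 0 = 0. Proof. by rewrite /proj piE. Qed.
Lemma projD u v : proj (u + v) = proj u + proj v.
Proof. by rewrite /proj piE. Qed.

Definition quot_scale (c : C) (x : quotient) : quotient := proj (c *: repr x).

Lemma projZ c v : proj (c *: v) = quot_scale c (proj v).
Proof.
by apply/projP; rewrite -scalerBr rpredZ //; apply/projP; rewrite projK.
Qed.

Lemma quot_scaleA a b x : quot_scale a (quot_scale b x) = quot_scale (a * b) x.
Proof. by elim/projW: x => x; rewrite -!projZ scalerA. Qed.
Lemma quot_scale1 : left_id 1 quot_scale.
Proof. by elim/projW=> x; rewrite -projZ scale1r. Qed.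
Lemma quot_scaleDr : right_distributive quot_scale +%R.
Proof.
move=> a; elim/projW=> x; elim/projW=> y.
by rewrite -projD -!projZ -projD scalerDr.
Qed.
Lemma quot_scaleDl v : {morph quot_scale^~ v : a b / a + b}.
Proof. by move=> a b; elim/projW: v => x; rewrite -!projZ -projD scalerDl. Qed.

HB.instance Definition _ := GRing.Zmodule_isLmodule.Build C quotient
  quot_scaleA quot_scale1 quot_scaleDr quot_scaleDl.

Lemma proj_is_linear c u v : proj (c *: u + v) = c *: proj u + proj v.
Proof. by rewrite projD projZ. Qed.

Record subspace_of := SubspaceOf {
  subspace_val :> V;
  _ : subspace_val \in U }.

HB.instance Definition _ := [isSub for subspace_val].
HB.instance Definition _ := [Choice of subspace_of by <:].
HB.instance Definition _ := [SubChoice_isSubLmodule of subspace_of by <:].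

End Subspace.

Section Periplectic.
Context (C : numClosedFieldType) (n : nat).
Local Notation gl := 'M[C]_(n + n).

(* Homogeneous component of degree [a] in gl(n|n); [true] is the odd degree. *)
Definition gl_comp (a : bool) (x : gl) : gl :=
  if a then block_mx 0 (ursubmx x) (dlsubmx x) 0
  else block_mx (ulsubmx x) 0 0 (drsubmx x).

Arguments gl_comp : simpl never.

Definition gl_bracket (x y : gl) : gl :=
  \sum_(a : bool) \sum_(b : bool)
    (gl_comp a x *m gl_comp b y
     - (-1) ^+ (a && b) *: (gl_comp b y *m gl_comp a x)).

Definition is_pe (x : gl) : bool :=
  [&& (ursubmx x)^T == ursubmx x, (dlsubmx x)^T == - dlsubmx x
    & drsubmx x == - (ulsubmx x)^T].

Lemma is_peP x :
  reflect (exists A B D : 'M[C]_n,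
             [/\ B^T = B, D^T = - D & x = block_mx A B D (- A^T)])
          (is_pe x).
Proof.
apply: (iffP and3P) => [[/eqP hB /eqP hD /eqP hA]|[A [B [D [hB hD ->]]]]].
  exists (ulsubmx x), (ursubmx x), (dlsubmx x); split=> //.
  by rewrite -hA submxK.
by rewrite block_mxKul block_mxKur block_mxKdl block_mxKdr hB hD !eqxx.
Qed.

Lemma is_pe_submod : submod_closed is_pe.
Proof.
split.
  by apply/is_peP; exists 0, 0, 0; rewrite !trmx0 !oppr0 block_mx0.
move=> c _ _ /is_peP[A [B [D [hB hD ->]]]] /is_peP[A' [B' [D' [hB' hD' ->]]]].
apply/is_peP; exists (c *: A + A'), (c *: B + B'), (c *: D + D').
by rewrite !linearP /= hB hD hB' hD' scale_block_mx add_block_mx !scalerN ?opprD.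
Qed.
HB.instance Definition _ := GRing.isSubmodClosed.Build C gl is_pe is_pe_submod.

Record pe := Pe { pe_mx :> gl; _ : pe_mx \in is_pe }.
HB.instance Definition _ := [isSub for pe_mx].
HB.instance Definition _ := [Choice of pe by <:].
HB.instance Definition _ := [SubChoice_isSubLmodule of pe by <:].

Lemma peP (x : pe) : exists A B D : 'M[C]_n,
  [/\ B^T = B, D^T = - D & x = block_mx A B D (- A^T) :> gl].
Proof. by case: x => x /= xP; apply/is_peP. Qed.

Lemma pe_compP a (x : pe) : gl_comp a x \in is_pe.
Proof.
have [A [B [D [hB hD ->]]]] := peP x; apply/is_peP.
rewrite /gl_comp block_mxKul block_mxKur block_mxKdl block_mxKdr.
case: a; last by exists A, 0, 0; rewrite !trmx0 ?oppr0.
by exists 0, B, D; rewrite !trmx0 ?oppr0.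
Qed.
Definition pe_comp a (x : pe) : pe := Pe (pe_compP a x).

Lemma pe_bracketP (x y : pe) : gl_bracket x y \in is_pe.
Proof.
have [A [B [D [hB hD ->]]]] := peP x.
have [A' [B' [D' [hB' hD' ->]]]] := peP y; apply/is_peP.
rewrite /gl_bracket !big_bool /gl_comp.
rewrite !(block_mxKul, block_mxKur, block_mxKdl, block_mxKdr) /=.
rewrite expr1 expr0 !scaleN1r !scale1r !opprK !mulmx_block.
rewrite !(mul0mx, mulmx0, addr0, add0r, oppr0, opp_block_mx, add_block_mx).
exists (B *m D' + B' *m D + (A *m A' - A' *m A)),
  (B *m - A'^T - A' *m B + (A *m B' - B' *m - A^T)),
  (D *m A' - - A'^T *m D + (- A^T *m D' - D' *m A)).
have trD (M N : 'M[C]_n) : (M + N)^T = M^T + N^T by exact: linearD.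
have trN (M : 'M[C]_n) : (- M)^T = - M^T by exact: linearN.
rewrite !(trD, trN, trmx_mul, trmxK) hB hB' hD hD' !(mulNmx, mulmxN, opprK, opprD).
have E1 (a b c d : 'M[C]_n) : a + b + (c + d) = b + a + (d + c).
  by rewrite (addrC a) (addrC c).
split; [exact: E1|exact: E1|congr block_mx].
by rewrite E1.
Qed.
Definition pe_bracket (x y : pe) : pe := Pe (pe_bracketP x y).

Definition homog (a : bool) (x : pe) : Prop := gl_comp a x = x :> gl.

(* The grading automorphism: identity on even, -1 on odd elements. *)
Definition gl_theta (x : gl) : gl := gl_comp false x - gl_comp true x.

Lemma gl_thetaE A B D E : gl_theta (block_mx A B D E) = block_mx A (- B) (- D) E.
Proof.
rewrite /gl_theta /gl_comp block_mxKul block_mxKur block_mxKdl block_mxKdr.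
by rewrite opp_block_mx add_block_mx !oppr0 !addr0 !add0r.
Qed.

Lemma gl_theta_linear c x y :
  gl_theta (c *: x + y) = c *: gl_theta x + gl_theta y.
Proof.
rewrite -[x]submxK -[y]submxK scale_block_mx add_block_mx !gl_thetaE.
by rewrite scale_block_mx add_block_mx !scalerN !opprD.
Qed.

Lemma gl_thetaZ c x : gl_theta (c *: x) = c *: gl_theta x.
Proof.
by rewrite -[x]submxK scale_block_mx !gl_thetaE scale_block_mx !scalerN.
Qed.

Lemma gl_thetaD x y : gl_theta (x + y) = gl_theta x + gl_theta y.
Proof. by have := gl_theta_linear 1 x y; rewrite !scale1r. Qed.

Lemma gl_thetaM x y : gl_theta (x *m y) = gl_theta x *m gl_theta y.
Proof.
rewrite -[x]submxK -[y]submxK mulmx_block !gl_thetaE mulmx_block.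
by rewrite !(mulmxN, mulNmx, opprK, opprD).
Qed.

Lemma gl_thetaK : involutive gl_theta.
Proof. by move=> x; rewrite -[x]submxK !gl_thetaE !opprK. Qed.

Lemma gl_comp_theta a x : gl_comp a (gl_theta x) = gl_theta (gl_comp a x).
Proof.
rewrite -[x]submxK gl_thetaE /gl_comp.
rewrite !(block_mxKul, block_mxKur, block_mxKdl, block_mxKdr).
by case: a; rewrite gl_thetaE ?oppr0.
Qed.

Lemma gl_comp_theta_sign a x : gl_theta (gl_comp a x) = (-1) ^+ a *: gl_comp a x.
Proof.
rewrite /gl_comp; case: a; rewrite gl_thetaE ?oppr0 ?expr0 ?scale1r //.
by rewrite expr1 scaleN1r opp_block_mx oppr0.
Qed.

Lemma gl_compZ a c x : gl_comp a (c *: x) = c *: gl_comp a x.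
Proof.
rewrite -[x]submxK scale_block_mx /gl_comp.
rewrite !(block_mxKul, block_mxKur, block_mxKdl, block_mxKdr).
by case: a; rewrite scale_block_mx !scaler0.
Qed.

Lemma gl_theta_bracket x y :
  gl_theta (gl_bracket x y) = gl_bracket (gl_theta x) (gl_theta y).
Proof.
rewrite /gl_bracket !big_bool /= !gl_comp_theta.
have thN z : gl_theta (- z) = - gl_theta z by rewrite -!scaleN1r gl_thetaZ.
by rewrite !gl_thetaD !thN !gl_thetaZ !gl_thetaM.
Qed.

Definition pe_theta (x : pe) : pe := pe_comp false x - pe_comp true x.

Lemma val_pe_theta x : pe_theta x = gl_theta x :> gl.
Proof. by []. Qed.
Lemma pe_theta_linear c x y : pe_theta (c *: x + y) = c *: pe_theta x + pe_theta y.
Proof. by apply/val_inj; rewrite /= -!/(gl_theta _) gl_theta_linear. Qed.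
Lemma pe_thetaK : involutive pe_theta.
Proof. by move=> x; apply/val_inj; rewrite /= -!/(gl_theta _) gl_thetaK. Qed.
Lemma homog_theta a x : homog a x -> pe_theta x = (-1) ^+ a *: x.
Proof.
move=> hx; apply/val_inj; rewrite /= -!/(gl_theta _) -hx.
by rewrite gl_comp_theta_sign hx.
Qed.
Lemma homogZ a c x : homog a x -> homog a (c *: x).
Proof. by move=> hx; rewrite /homog /= gl_compZ hx. Qed.
Lemma pe_theta_bracket x y :
  pe_theta (pe_bracket x y) = pe_bracket (pe_theta x) (pe_theta y).
Proof. by apply/val_inj; rewrite /= -!/(gl_theta _) gl_theta_bracket. Qed.

Definition cartan (x : pe) : Prop := is_diag_mx (x : gl).
Definition borel (x : pe) : Prop :=
  dlsubmx x = 0 /\ forall i j : 'I_n, (j < i)%N -> ulsubmx x i j = 0.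
Definition nilradical (x : pe) : Prop :=
  dlsubmx x = 0 /\ forall i j : 'I_n, (j <= i)%N -> ulsubmx x i j = 0.

(* A weight is given by its coordinates in the basis epsilon_i of h^*, where
   epsilon_i maps diag(a, -a) to a_i. On [borel] this is the character of
   b / n = h. *)
Definition weight_val (lam : 'rV[C]_n) (x : pe) : C :=
  \sum_(i < n) lam 0 i * ulsubmx x i i.

(* A supermodule M = M_0 + M_1 is encoded by its parity involution [par], equal
   to 1 on M_0 and to -1 on M_1; [par_act] says that pe(n)_a M_b is contained in
   M_(a+b). *)
Record smod := Smod {
  smod_car :> lmodType C;
  act : pe -> smod_car -> smod_car;
  par : smod_car -> smod_car;
  act_linl : forall c x y v, act (c *: x + y) v = c *: act x v + act y v;
  act_linr : forall x c u v, act x (c *: u + v) = c *: act x u + act x v;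
  act_bracket : forall a b x y v, homog a x -> homog b y ->
    act (pe_bracket x y) v
    = act x (act y v) - (-1) ^+ (a && b) *: act y (act x v);
  par_lin : forall c u v, par (c *: u + v) = c *: par u + par v;
  par_invol : involutive par;
  par_act : forall a x v, homog a x -> par (act x v) = (-1) ^+ a *: act x (par v)
}.

(* All U(g)-linear maps, homogeneous or not: parities are not tracked, so that
   for instance a module and its parity shift are isomorphic. An odd morphism f,
   with f (x v) = - x f(v) for odd x, corresponds to the [shom] f \o par. *)
Record shom (M N : smod) := Shom {
  shom_fun :> {linear M -> N};
  shom_act : forall x v, shom_fun (act x v) = act x (shom_fun v) }.

Definition mk_shom (M N : smod) (f : M -> N)
    (fl : forall c u v, f (c *: u + v) = c *: f u + f v)
    (fa : forall x v, f (act x v) = act x (f v)) : shom M N :=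
  @Shom M N (HB.pack_for {linear M -> N} f (GRing.isLinear.Build C M N *:%R f fl))
    fa.

Definition isomorphic (M N : smod) : Prop := exists f : shom M N, bijective f.

(* Graded submodules: a subspace is graded iff it is stable under [par]. *)
Record submod (M : smod) := Submod {
  submod_space :> submodClosed M;
  submod_act : forall x v, v \in submod_space -> act x v \in submod_space;
  submod_par : forall v, v \in submod_space -> par v \in submod_space }.

Section SubQuotient.
Context (M : smod) (S : submod M).

Definition sub_act (x : pe) (v : subspace_of S) : subspace_of S :=
  SubspaceOf (submod_act x (valP v)).
Definition sub_par (v : subspace_of S) : subspace_of S :=
  SubspaceOf (submod_par (valP v)).

Definition sub_smod : smod.
Proof.
refine (@Smod (subspace_of S) sub_act sub_par _ _ _ _ _ _).
- by move=> c x y v; apply/val_inj; rewrite /= act_linl.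
- by move=> x c u v; apply/val_inj; rewrite /= act_linr.
- by move=> a b x y v hx hy; apply/val_inj; rewrite /= (act_bracket _ hx hy).
- by move=> c u v; apply/val_inj; rewrite /= par_lin.
- by move=> v; apply/val_inj; rewrite /= par_invol.
- by move=> a x v hx; apply/val_inj; rewrite /= (par_act _ hx).
Defined.

Definition quot_act (x : pe) (v : quotient S) : quotient S :=
  proj S (act x (repr v)).
Definition quot_par (v : quotient S) : quotient S := proj S (par (repr v)).

Lemma act_proj x v : quot_act x (proj S v) = proj S (act x v).
Proof.
apply/projP; rewrite addrC -scaleN1r -act_linr submod_act //.
by rewrite scaleN1r addrC; apply/projP; rewrite projK.
Qed.
Lemma par_proj v : quot_par (proj S v) = proj S (par v).
Proof.
apply/projP; rewrite addrC -scaleN1r -par_lin submod_par //.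
by rewrite scaleN1r addrC; apply/projP; rewrite projK.
Qed.

Definition quot_smod : smod.
Proof.
refine (@Smod (quotient S) quot_act quot_par _ _ _ _ _ _).
- move=> c x y; elim/projW=> v.
  by rewrite !act_proj act_linl proj_is_linear.
- move=> x c; elim/projW=> u; elim/projW=> v.
  by rewrite -proj_is_linear !act_proj act_linr proj_is_linear.
- move=> a b x y + hx hy; elim/projW=> v.
  rewrite !act_proj (act_bracket _ hx hy) -scaleNr addrC proj_is_linear.
  by rewrite scaleNr addrC.
- move=> c; elim/projW=> u; elim/projW=> v.
  by rewrite -proj_is_linear !par_proj par_lin proj_is_linear.
- by elim/projW=> v; rewrite !par_proj par_invol.
- move=> a x + hx; elim/projW=> v.
  by rewrite act_proj !par_proj act_proj (par_act _ hx) projZ.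
Defined.

End SubQuotient.

Definition prop_submod (M : smod) (P : M -> Prop) (P0 : P 0)
    (Pl : forall c u v, P u -> P v -> P (c *: u + v))
    (Pa : forall x v, P v -> P (act x v)) (Pp : forall v, P v -> P (par v)) :
  submod M.
Proof.
refine (@Submod M (mk_subspace (submod_closedP P0 Pl)) _ _).
- by move=> x v /mk_subspaceP h; apply/mk_subspaceP/Pa.
- by move=> v /mk_subspaceP h; apply/mk_subspaceP/Pp.
Defined.

Lemma prop_submodP M P P0 Pl Pa Pp v :
  (v \in @prop_submod M P P0 Pl Pa Pp) <-> P v.
Proof. exact: mk_subspaceP. Qed.

Section Sum.
Context (M : smod) (F : submod M -> Prop).

(* The least graded submodule containing all the members of [F]. *)
Definition sum_pred (v : M) : Prop :=
  forall T : submod M, (forall S, F S -> {subset S <= T}) -> v \in T.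

Definition sum_submod : submod M.
Proof.
refine (@prop_submod M sum_pred _ _ _ _).
- by move=> T _; rewrite rpred0.
- by move=> c u v hu hv T hT; rewrite rpredD ?rpredZ ?hu ?hv.
- by move=> x v hv T hT; apply/submod_act/hv.
- by move=> v hv T hT; apply/submod_par/hv.
Defined.
End Sum.

Definition simple (M : smod) : Prop :=
  (exists v : M, v != 0) /\
  forall S : submod M, (forall v, v \in S -> v = 0) \/ (forall v, v \in S).

Definition socle (M : smod) : submod M :=
  sum_submod (fun S => simple (sub_smod S)).
(* For Verma modules, the unique maximal submodule. *)
Definition radical (M : smod) : submod M :=
  sum_submod (fun S => exists v, v \notin S).

(* [S] intersected with [T], as a submodule of [T] *)
Definition restr_submod (M : smod) (S T : submod M) : submod (sub_smod T).
Proof.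
refine (@prop_submod (sub_smod T)
          (fun v : subspace_of T => subspace_val v \in S) _ _ _ _).
- exact: rpred0.
- by move=> c u v hu hv; rewrite /= rpredD ?rpredZ.
- by move=> x v; apply: submod_act.
- by move=> v; apply: submod_par.
Defined.

Definition subquotient (M : smod) (S T : submod M) : smod :=
  quot_smod (restr_submod S T).

(* [M : L] = m for M of finite length, by means of a composition series. *)
Definition multiplicity (M L : smod) (m : nat) : Prop :=
  exists (k : nat) (F : nat -> submod M),
    [/\ forall v, v \in F 0%N -> v = 0,
        forall v, v \in F k,
        forall i, (i < k)%N ->
          {subset F i <= F i.+1} /\ simple (subquotient (F i) (F i.+1))
      & m = (\sum_(i < k) `[< isomorphic (subquotient (F i) (F i.+1)) L >])%N].

(* U(X)G, for a subalgebra X of pe(n) and a subset G of M. *)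
Definition generated (M : smod) (X : pe -> Prop) (G : M -> Prop) (v : M) : Prop :=
  forall U : submodClosed M,
    (forall x u, X x -> u \in U -> act x u \in U) ->
    (forall u, G u -> u \in U) -> v \in U.

Definition weight_vector (M : smod) (lam : 'rV[C]_n) (v : M) : Prop :=
  forall h, cartan h -> act h v = weight_val lam h *: v.

Definition finitely_generated (M : smod) : Prop :=
  exists s : seq M, forall v, generated (fun _ => True) (fun u => u \in s) v.

Definition cartan_semisimple (M : smod) : Prop :=
  forall v : M, exists (k : nat) (u : 'I_k -> M) (lam : 'I_k -> 'rV[C]_n),
    v = \sum_i u i /\ forall i, weight_vector (lam i) (u i).

Definition locally_nilradical_finite (M : smod) : Prop :=
  forall v : M, exists s : seq M, forall u,
    generated nilradical (fun w => w = v) u ->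
    exists c : 'I_(size s) -> C, u = \sum_i c i *: s`_i.

Definition in_O (M : smod) : Prop :=
  [/\ finitely_generated M, cartan_semisimple M & locally_nilradical_finite M].

Section Ext.
Context (A B : smod).

Record extension := Extension {
  ext_mod :> smod;
  ext_inO : in_O ext_mod;
  ext_i : shom B ext_mod;
  ext_p : shom ext_mod A;
  ext_inj : injective ext_i;
  ext_surj : forall a, exists e, ext_p e = a;
  ext_exact : forall e, ext_p e = 0 <-> exists b, e = ext_i b }.

Definition ext_equiv (E E' : extension) : Prop :=
  exists f : shom E E',
    (forall b, f (ext_i E b) = ext_i E' b) /\
    (forall e, ext_p E' (f e) = ext_p E e).

(* [E'] is the pushout of [E] along [c] times the identity of [B]. *)
Definition ext_scale (c : C) (E E' : extension) : Prop :=
  exists f : shom E E',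
    (forall b, f (ext_i E b) = ext_i E' (c *: b)) /\
    (forall e, ext_p E' (f e) = ext_p E e).

(* The Yoneda classes of extensions of A by B form a vector space under Baer sum
   and pushout along scalars. Both operations are characterised, up to
   equivalence, by the existence of a morphism of extensions. *)
Definition in_fiber (E1 E2 : extension) (z : E1 * E2) : Prop :=
  ext_p E1 z.1 = ext_p E2 z.2.

(* [E] is the pushout along [B * B -> B, (b1, b2) |-> b1 + b2] of the pullback
   of [E1 * E2] along the diagonal of [A]. *)
Definition ext_baer (E1 E2 E : extension) : Prop :=
  exists f : E1 * E2 -> E,
    [/\ forall c z w, in_fiber z -> in_fiber w ->
          f (c *: z + w) = c *: f z + f w,
        forall x z, in_fiber z -> f (act x z.1, act x z.2) = act x (f z),
        forall b1 b2, f (ext_i E1 b1, ext_i E2 b2) = ext_i E (b1 + b2)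
      & forall z, in_fiber z -> ext_p E (f z) = ext_p E1 z.1].

(* dim Ext^1_O(A, B) = d : [eps] induces a linear isomorphism from C^d onto the
   space of classes. *)
Definition ext1_dim (d : nat) : Prop :=
  exists eps : 'rV[C]_d -> extension,
    [/\ forall u v, ext_baer (eps u) (eps v) (eps (u + v)),
        forall c u, ext_scale c (eps u) (eps (c *: u)),
        forall u v, ext_equiv (eps u) (eps v) -> u = v
      & forall E, exists u, ext_equiv (eps u) E].

End Ext.


Section Verma.
Local Open Scope monom_scope.
Local Open Scope ring_scope.
Local Notation T := {malg C[{fmonom pe}]}.

(* T is the free algebra on the set pe(n), and U(g) is its quotient by the
   two-sided ideal generated by [env_rel]. *)
Definition gen (x : pe) : T := << fmu x >>.

Inductive env_rel : T -> Prop :=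
| env_linear c x y : env_rel (gen (c *: x + y) - (c *: gen x + gen y))
| env_bracket a b x y of homog a x & homog b y :
    env_rel (gen (pe_bracket x y)
             - (gen x * gen y - (-1) ^+ (a && b) *: (gen y * gen x))).

(* U(g) (x)_U(b) C_lam = U(g) / U(g){x - lam(x), x in b}, the highest weight
   vector 1 (x) 1 being even. *)
Inductive verma_rel (lam : 'rV[C]_n) : T -> Prop :=
| verma_rel0 : verma_rel lam 0
| verma_rel_linear c u v of verma_rel lam u & verma_rel lam v :
    verma_rel lam (c *: u + v)
| verma_rel_env u r w of env_rel r : verma_rel lam (u * r * w)
| verma_rel_borel u x of borel x :
    verma_rel lam (u * (gen x - (weight_val lam x)%:A)).

Lemma genM (s t : seq pe) :
  << FMonom s >> * << FMonom t >> = << FMonom (s ++ t) >> :> T.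
Proof.
rewrite malgM_def fgmulUU mulr1; congr mkmalgU.
by apply/eqP; rewrite fmP fmM.
Qed.

Lemma genE x : gen x = << FMonom [:: x] >>.
Proof. by rewrite /gen fmuE. Qed.

Lemma T1E : 1 = << FMonom [::] >> :> T.
Proof. by rewrite -[LHS]/(fgone _ _) /fgone /mone /= fmoneE. Qed.

Lemma T_ind (P : T -> Prop) : P 0 ->
  (forall c u v, P u -> P v -> P (c *: u + v)) ->
  (forall s, P << FMonom s >>) -> forall f, P f.
Proof.
move=> P0 Pl Ps f; rewrite [f]monalgE; elim: {1}(enum_fset _) => [|k r IH].
  by rewrite big_nil.
rewrite big_cons -[X in << X *g _ >>]mulr1.
have -> : << f@_k * 1 *g k >> = f@_k *: << k >> :> T.
  by apply/malgP => k'; rewrite mcoeffZ 2!mcoeffU mulrnAr.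
by apply: Pl => //; case: k.
Qed.

Definition word_theta (w : fmonom pe) : T := << FMonom (map pe_theta w) >>.

Lemma word_theta_mmorphism : mmorphism word_theta.
Proof.
split; last by rewrite /word_theta fm1 T1E.
by move=> u v; rewrite /word_theta fmM map_cat genM.
Qed.
HB.instance Definition _ :=
  isMultiplicative.Build _ _ word_theta word_theta_mmorphism.

Fact T_par_key : unit. Proof. by []. Qed.
Definition T_par : T -> T :=
  locked_with T_par_key (mmap (@malgC _ C) word_theta).
Lemma T_parE f : T_par f = mmap (@malgC _ C) word_theta f.
Proof. by rewrite /T_par unlock. Qed.

Lemma T_par_linear c u v : T_par (c *: u + v) = c *: T_par u + T_par v.
Proof. by rewrite !T_parE mmapD mmapZ mul_malgC. Qed.

Lemma mulrTC (c : C) (u : T) : u * malgC c = c *: u.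
Proof.
elim/T_ind: u => [|a u v IHu IHv|w]; first by rewrite mul0r scaler0.
  by rewrite mulrDl -scalerAl IHu IHv scalerDr !scalerA mulrC.
apply/malgP=> k; rewrite mcoeffZ malgM_def fgmulUU mulm1.
rewrite [in LHS]mcoeffU [in RHS]mcoeffU.
by rewrite mul1r mulrnAr mulr1.
Qed.

Lemma mulrTZ c (u v : T) : u * (c *: v) = c *: (u * v).
Proof. by rewrite -mulrTC mulrA mulrTC. Qed.

Lemma T_parM u v : T_par (u * v) = T_par u * T_par v.
Proof.
rewrite !T_parE; apply: (commr_mmap_is_multiplicative _).1 => g m m'.
by rewrite /GRing.comm mul_malgC mulrTC.
Qed.

Lemma T_par_word s : T_par << FMonom s >> = << FMonom (map pe_theta s) >>.
Proof. by rewrite T_parE mmapU /= mul_malgC scale1r. Qed.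

Lemma T_par1 : T_par 1 = 1. Proof. by rewrite T1E T_par_word. Qed.

Lemma T_par_gen x : T_par (gen x) = gen (pe_theta x).
Proof. by rewrite !genE T_par_word. Qed.

Lemma T_par0 : T_par 0 = 0. Proof. by rewrite T_parE mmap0. Qed.


Lemma T_parZ c u : T_par (c *: u) = c *: T_par u.
Proof. by rewrite -[c *: u]addr0 T_par_linear T_par0 addr0. Qed.
Lemma T_parD u v : T_par (u + v) = T_par u + T_par v.
Proof. by have := T_par_linear 1 u v; rewrite !scale1r. Qed.
Lemma T_parN u : T_par (- u) = - T_par u.
Proof. by rewrite -!scaleN1r T_parZ. Qed.

Lemma T_parK : involutive T_par.
Proof.
elim/T_ind => [|c u v IHu IHv|s].
- by rewrite T_par0 T_par0.
- by rewrite (T_par_linear c u v) (T_par_linear c (T_par u)) IHu IHv.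
by rewrite !T_par_word mapK //; exact: pe_thetaK.
Qed.

Lemma homogM_theta a x : homog a x -> homog a (pe_theta x).
Proof. by move=> hx; rewrite (homog_theta hx); exact: homogZ. Qed.

Lemma env_rel_par r : env_rel r -> env_rel (T_par r).
Proof.
case=> [c x y|a b x y hx hy].
  rewrite !(T_parD, T_parN, T_parZ) !T_par_gen pe_theta_linear.
  exact: env_linear.
rewrite !(T_parD, T_parN, T_parZ, T_parM, T_par_gen) pe_theta_bracket.
by apply: env_bracket; apply: homogM_theta.
Qed.

Lemma borel_theta lam x : borel x ->
  borel (pe_theta x) /\ weight_val lam (pe_theta x) = weight_val lam x.
Proof.
rewrite /borel /weight_val; have -> : ulsubmx (pe_theta x) = ulsubmx x.
  by rewrite val_pe_theta -{1}[x : gl]submxK gl_thetaE block_mxKul.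
have -> : dlsubmx (pe_theta x) = - dlsubmx x.
  by rewrite val_pe_theta -{1}[x : gl]submxK gl_thetaE block_mxKdl.
by case=> -> h; rewrite oppr0.
Qed.

Lemma verma_rel_par lam f : verma_rel lam f -> verma_rel lam (T_par f).
Proof.
elim=> [|c u v _ IHu _ IHv|u r w hr|u x hx].
- by rewrite T_par0; exact: verma_rel0.
- by rewrite T_par_linear; exact: verma_rel_linear.
- by rewrite !T_parM; apply/verma_rel_env/env_rel_par.
have [hx' <-] := borel_theta lam hx.
rewrite T_parM T_parD T_parN T_par_gen T_parZ T_par1.
exact: verma_rel_borel.
Qed.

Lemma verma_rel_mull lam g f : verma_rel lam f -> verma_rel lam (g * f).
Proof.
elim=> [|c u v _ IHu _ IHv|u r w hr|u x hx].
- by rewrite mulr0; exact: verma_rel0.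
- have -> : g * (c *: u + v) = c *: (g * u) + g * v.
    by rewrite (mulrDr g (c *: u)) (mulrTZ c g u).
  exact: verma_rel_linear.
- by rewrite !mulrA; exact: verma_rel_env.
- by rewrite mulrA; exact: verma_rel_borel.
Qed.

Context (lam : 'rV[C]_n).

Definition verma_space : submodClosed T :=
  mk_subspace (submod_closedP (verma_rel0 lam) (@verma_rel_linear lam)).

Local Notation V := (quotient verma_space).

Definition verma_act (x : pe) (v : V) : V := proj verma_space (gen x * repr v).
Definition verma_par (v : V) : V := proj verma_space (T_par (repr v)).

Lemma verma_projP f g :
  proj verma_space f = proj verma_space g <-> verma_rel lam (f - g).
Proof.
split=> [/projP/mk_subspaceP //|h].
by apply/projP; apply/mk_subspaceP.
Qed.

Lemma verma_actE x f : verma_act x (proj _ f) = proj verma_space (gen x * f).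
Proof.
apply/verma_projP; rewrite -mulrBr; apply/verma_rel_mull/verma_projP.
by rewrite projK.
Qed.

Lemma verma_parE f : verma_par (proj _ f) = proj verma_space (T_par f).
Proof.
apply/verma_projP; rewrite -T_parN -T_parD; apply/verma_rel_par/verma_projP.
by rewrite projK.
Qed.

Lemma verma_env r f g : env_rel (r - g) ->
  proj verma_space (r * f) = proj verma_space (g * f).
Proof.
move=> h; apply/verma_projP; rewrite -mulrBl -[r - g]mul1r.
exact: verma_rel_env.
Qed.

Lemma verma_act_linl c x y v :
  verma_act (c *: x + y) v = c *: verma_act x v + verma_act y v.
Proof.
elim/projW: v => f; rewrite !verma_actE -proj_is_linear scalerAl -mulrDl.
exact/verma_env/env_linear.
Qed.

Lemma verma_act_linr x c u v :
  verma_act x (c *: u + v) = c *: verma_act x u + verma_act x v.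
Proof.
elim/projW: u => f; elim/projW: v => g.
transitivity (verma_act x (proj verma_space (c *: f + g))).
  by congr verma_act; exact/esym/proj_is_linear.
rewrite 3!verma_actE.
by rewrite (mulrDr (gen x) (c *: f)) (mulrTZ c (gen x) f) proj_is_linear.
Qed.

Lemma verma_par_lin c u v :
  verma_par (c *: u + v) = c *: verma_par u + verma_par v.
Proof.
elim/projW: u => f; elim/projW: v => g.
transitivity (verma_par (proj verma_space (c *: f + g))).
  by congr verma_par; exact/esym/proj_is_linear.
rewrite 3!verma_parE.
by rewrite (T_par_linear c f) proj_is_linear.
Qed.

Definition verma : smod.
Proof.
refine (@Smod V verma_act verma_par verma_act_linl verma_act_linr
          _ verma_par_lin _ _).
- move=> a b x y + hx hy; elim/projW=> f.
  rewrite !verma_actE -scaleNr addrC -proj_is_linear !mulrA scalerAl -mulrDl.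
  by apply: verma_env; rewrite scaleNr [X in _ - X]addrC; apply: env_bracket.
- by elim/projW=> f; rewrite !verma_parE T_parK.
move=> a x + hx; elim/projW=> f.
rewrite verma_actE !verma_parE T_parM T_par_gen (homog_theta hx) -verma_actE.
have := verma_act_linl ((-1) ^+ a) x 0 (proj _ (T_par f)).
rewrite addr0 => ->; rewrite -[X in _ + X = _](_ : 0 = _) ?addr0 //.
have := verma_act_linl (-1) 0 0 (proj _ (T_par f)).
by rewrite scaler0 addr0 scaleN1r addNr.
Defined.

Definition verma_gen : verma := proj verma_space 1.

Section Universal.
Context (N : smod) (w0 : N)
  (w0P : forall x, borel x -> act x w0 = weight_val lam x *: w0).

Local Notation word_act := (foldr (@act N)).

Definition T_act (f : T) (v : N) : N :=
  \sum_(k <- msupp f) f@_k *: word_act v k.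

Lemma T_actEw (d : {fset fmonom pe}) f v : {subset msupp f <= d} ->
  T_act f v = \sum_(k <- d) f@_k *: word_act v k.
Proof.
move=> le; rewrite [LHS](big_fset_incl _ (B := d)) //; first exact/fsubsetP.
by move=> x xd /mcoeff_outdom ->; rewrite scale0r.
Qed.

Lemma T_act_linl c f g v : T_act (c *: f + g) v = c *: T_act f v + T_act g v.
Proof.
pose d := (msupp (c *: f + g) `|` (msupp f `|` msupp g))%fset.
rewrite 3?(@T_actEw d) => [|x|x|x]; rewrite ?in_fsetU; try by move=> ->; rewrite ?orbT.
rewrite scaler_sumr -big_split; apply: eq_bigr => k _ /=.
by rewrite mcoeffD mcoeffZ scalerDl scalerA.
Qed.

Lemma act0 x : act x (0 : N) = 0.
Proof.
have := act_linr x (-1) (0 : N) 0.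
by rewrite scaler0 addr0 scaleN1r addNr.
Qed.

Lemma word_act_lin s c u v :
  word_act (c *: u + v) s = c *: word_act u s + word_act v s.
Proof. by elim: s => //= x s ->; rewrite act_linr. Qed.

Lemma T_act_word s v : T_act << FMonom s >> v = word_act v s.
Proof.
rewrite (@T_actEw [fset FMonom s]%fset) => [|x].
  by rewrite big_seq_fset1 mcoeffUU scale1r.
by rewrite msuppU oner_eq0.
Qed.

Lemma T_act0 v : T_act 0 v = 0.
Proof. by have := T_act_linl (-1) 0 0 v; rewrite scaler0 addr0 scaleN1r addNr. Qed.

Lemma T_act_linr f c u v : T_act f (c *: u + v) = c *: T_act f u + T_act f v.
Proof.
elim/T_ind: f => [|a f g IHf IHg|s].
- by rewrite !T_act0 scaler0 addr0.
- rewrite !(T_act_linl a f g) IHf IHg !scalerDr !scalerA mulrC.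
  by rewrite !addrA; congr (_ + _); rewrite addrAC.
- by rewrite !T_act_word word_act_lin.
Qed.

Lemma T_actr0 f : T_act f 0 = 0.
Proof. by have := T_act_linr f (-1) 0 0; rewrite scaler0 addr0 scaleN1r addNr. Qed.

Lemma T_actM f g v : T_act (f * g) v = T_act f (T_act g v).
Proof.
elim/T_ind: f => [|a f f' IHf IHf'|s].
- by rewrite mul0r !T_act0.
- rewrite (mulrDl (a *: f)) -(scalerAl a f g) (T_act_linl a (f * g)).
  by rewrite (T_act_linl a f f'); congr (_ *: _ + _).
elim/T_ind: g => [|a g g' IHg IHg'|t].
- by rewrite mulr0 !T_act0 T_actr0.
- set u := (X in X * _) in IHg IHg' *.
  rewrite (mulrDr u (a *: g)) (mulrTZ a u g) (T_act_linl a (u * g)).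
  rewrite (T_act_linl a g g') T_act_linr.
  by congr (_ *: _ + _).
- by rewrite genM !T_act_word foldr_cat.
Qed.

Lemma T_act_gen x v : T_act (gen x) v = act x v.
Proof. by rewrite genE T_act_word. Qed.

Lemma T_actB f g v : T_act (f - g) v = T_act f v - T_act g v.
Proof.
transitivity (T_act (-1 *: g + f) v); first by rewrite scaleN1r addrC.
by rewrite T_act_linl scaleN1r addrC.
Qed.

Lemma T_actZ c f v : T_act (c *: f) v = c *: T_act f v.
Proof. by rewrite -[c *: f]addr0 T_act_linl T_act0 addr0. Qed.

Lemma T_act_super c f f1 f2 v :
  T_act (f - (f1 * f2 - c *: (f2 * f1))) v
  = T_act f v - (T_act f1 (T_act f2 v) - c *: T_act f2 (T_act f1 v)).
Proof.
rewrite (T_actB f) (T_actB (f1 * f2)) (T_actZ c (f2 * f1)).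
by rewrite (T_actM f1 f2) (T_actM f2 f1).
Qed.

Lemma T_act1 v : T_act 1 v = v.
Proof. by rewrite T1E T_act_word. Qed.

Lemma T_act_rel f : verma_rel lam f -> T_act f w0 = 0.
Proof.
elim=> [|c u v _ IHu _ IHv|u r w hr|u x hx].
- exact: T_act0.
- by rewrite T_act_linl IHu IHv scaler0 addr0.
- rewrite T_actM; set v := T_act w w0; rewrite T_actM.
  suff -> : T_act r v = 0 by exact: T_actr0.
  case: hr => [c x y|a b x y hx hy].
    by rewrite T_actB T_act_linl !T_act_gen act_linl subrr.
  by rewrite T_act_super 5!T_act_gen (act_bracket _ hx hy) subrr.
- rewrite T_actM T_actB T_actZ T_act_gen T_act1 w0P // subrr.
  exact: T_actr0.
Qed.

Lemma T_act_proj f : T_act (repr (proj verma_space f)) w0 = T_act f w0.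
Proof.
apply/eqP; rewrite -subr_eq0 -T_actB; apply/eqP/T_act_rel/verma_projP.
by rewrite projK.
Qed.

(* Frobenius reciprocity Hom_g(Delta(lam), N) = Hom_b(C_lam, N), which
   characterises the induced module. *)
Lemma verma_universal :
  exists2 f : shom verma N, f verma_gen = w0 &
    forall g : shom verma N, g verma_gen = w0 -> g =1 f.
Proof.
pose F (v : verma) : N := T_act (repr (v : V)) w0.
have Fl c (u v : verma) : F (c *: u + v) = c *: F u + F v.
  elim/projW: u => f; elim/projW: v => g.
  transitivity (F (proj verma_space (c *: f + g))).
    by congr F; exact/esym/proj_is_linear.
  by rewrite /F !T_act_proj T_act_linl.
have Fa x (v : verma) : F (act x v) = act x (F v).
  elim/projW: v => f; rewrite /F T_act_proj /= verma_actE T_act_proj.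
  by rewrite T_actM T_act_gen.
exists (mk_shom Fl Fa); first by rewrite /= /F T_act_proj T_act1.
move=> g gw; elim/projW=> f; rewrite /= /F T_act_proj.
elim/T_ind: f => [|c f f' IH IH'|s].
- by rewrite T_act0 (_ : proj _ 0 = 0) ?linear0 //; exact: proj0.
- rewrite T_act_linl -IH -IH' -linearP; congr (g _).
  exact: proj_is_linear.
rewrite T_act_word; elim: s => [|x s IH] /=; first by rewrite -gw -T1E.
rewrite -IH -(shom_act g); congr (g _).
by rewrite /= verma_actE genE genM.
Qed.
End Universal.

End Verma.

Definition simple_top (lam : 'rV[C]_n) : smod :=
  quot_smod (radical (verma lam)).

(* The pairing with the coroot of epsilon_i - epsilon_j. *)
Definition coroot_pairing (lam : 'rV[C]_n) (i j : 'I_n) : C := lam 0 i - lam 0 j.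

Definition rho0 : 'rV[C]_n :=
  2^-1 *: \sum_(i < n) \sum_(j < n | (i < j)%N) (delta_mx 0 i - delta_mx 0 j).

(* w epsilon_i = epsilon_(w i), hence the inverse. *)
Definition dot (w : 'S_n) (lam : 'rV[C]_n) : 'rV[C]_n :=
  col_perm w^-1 (lam + rho0) - rho0.

Definition integral (lam : 'rV[C]_n) : Prop :=
  forall i j : 'I_n, i != j -> exists z : int, coroot_pairing lam i j = z%:~R.

Definition dominant (lam : 'rV[C]_n) : Prop :=
  forall i j : 'I_n, (i < j)%N ->
    ~ exists z : int, z < 0 /\ coroot_pairing (lam + rho0) i j = z%:~R.

Definition antidominant (lam : 'rV[C]_n) : Prop :=
  forall i j : 'I_n, (i < j)%N ->
    ~ exists z : int, 0 < z /\ coroot_pairing (lam + rho0) i j = z%:~R.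

End Periplectic.

(* Main.v *)
(** Write L = L(mu), X = Delta(lamb), B = Delta(lam) and Q = X / B. As mu is not
    anti-dominant, there is a simple even root a such that <mu + rho_0, a^vee>
    is a positive integer m or is not an integer. Let e, f be root vectors for a
    and -a. In the first case f^m kills the highest weight vector of L, while f
    is injective on Verma modules; in the second case the a^vee-eigenvalues of L
    and of X lie in different cosets of the integers. Hence Hom(L, X) = 0.
    Moreover, for every extension E of L by B, the embedding B -> X extends to E.
    In the second case this is a splitting by generalised eigenspaces. In the
    first one, lift the highest weight vector of L to a weight vector e0 of E;
    then b = f^m e0 lies in B and f e b is in f^(m+1) B, and one needs that b is
    in f^m X. This follows by sl_2-theory from the dominance of lamb: X is free
    over the enveloping algebra of the negative part, so that there is a
    derivation delta dual to f, and X is the sum of the f^j (ker delta).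

    Consequently E is the pullback of X -> Q along a unique map L -> Q, so that
    Ext^1(L, B) = Hom(L, Q) = Hom(L, soc Q). The Verma module X is Noetherian by
    Hilbert's basis argument, hence soc Q has finite length, and Schur's lemma
    with End(L) = C identifies the dimension with the multiplicity. *)

(* The obstacle is the divisibility of b by f^m in X. As f is injective on X, no nonzero vector of X
   lies in a finite-dimensional sl_2-module, so the usual sl_2-theory does not apply to X itself. It
   applies to ker delta. Identify X with the enveloping algebra of the negative part and let R be
   right multiplication by f. Then f - R is ad(f), which is locally nilpotent, and on ker delta the
   operators e, f - R and h - a form an sl_2-triple, where a is the value of lamb on h. Expanding b
   as the sum of f^j u_j over ker delta, the condition on f e b gives e^m u_0 = 0, while u_0 has
   weight -(m + p) under h - a, where p = a + 1. Dominance says p >= 0, so e^m is injective on this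
   weight space and u_0 = 0; then u_1, ..., u_(m-1) vanish in turn. A second difficulty is parity:
   submodules are graded, but morphisms need not respect the grading, so that kernels and images are
   not submodules at once. Morphisms from L to a quotient of X are nevertheless homogeneous, because
   each weight vector of a Verma module has a definite parity. *)
From HB Require Import structures.
Require Import Defs.
From mathcomp Require Import all_boot all_order all_algebra perm.
From mathcomp Require Import finmap monalg classical_sets boolp reals complex.
From mathcomp Require Import ring zify.

Set Implicit Arguments.
Unset Strict Implicit.
Unset Printing Implicit Defensive.

Import GRing.Theory Num.Theory.
Local Open Scope ring_scope.

(** * The bracket of pe(n) *)

Section Algebra.
Context (C : numClosedFieldType) (n : nat).
Local Notation pe := (pe C n).
Local Notation gl := 'M[C]_(n + n).

Arguments gl_comp : simpl never.

Fact th_key : unit. Proof. by []. Qed.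
(** The power of the grading automorphism that implements the sign rule: moving a homogeneous y of
    degree a to the left past x turns x into [th a x], whether or not x is homogeneous. Locked, so
    that the conditional is not unfolded. *)
Definition th : bool -> pe -> pe :=
  locked_with th_key (fun a x => if a then pe_theta x else x).
Lemma thE a x : th a x = if a then pe_theta x else x.
Proof. by rewrite /th unlock. Qed.
Definition glth (a : bool) (x : gl) : gl := if a then gl_theta x else x.

Lemma val_th a x : th a x = glth a x :> gl.
Proof. by rewrite thE; case: a. Qed.

Lemma gl_compE (x : gl) : gl_comp true x + gl_comp false x = x.
Proof. by rewrite /gl_comp add_block_mx !add0r !addr0 submxK. Qed.

Lemma gl_compN a (y : gl) : gl_comp a y = y -> gl_comp (~~ a) y = 0.
Proof.
move=> <-; rewrite /gl_comp; case: a => /=;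
by rewrite !(block_mxKul, block_mxKur, block_mxKdl, block_mxKdr) block_mx0.
Qed.

Lemma gl_comp_linear a c (x y : gl) :
  gl_comp a (c *: x + y) = c *: gl_comp a x + gl_comp a y.
Proof.
rewrite -[x]submxK -[y]submxK scale_block_mx add_block_mx /gl_comp; case: a;
rewrite !(block_mxKul, block_mxKur, block_mxKdl, block_mxKdr);
by rewrite scale_block_mx add_block_mx !scaler0 !addr0.
Qed.

Lemma glth_linear a c (x y : gl) : glth a (c *: x + y) = c *: glth a x + glth a y.
Proof. by case: a => //=; rewrite gl_theta_linear. Qed.

Lemma gl_bracket_suml (x y : gl) :
  gl_bracket x y = \sum_(b : bool) (x *m gl_comp b y - gl_comp b y *m glth b x).
Proof.
rewrite /gl_bracket exchange_big; apply: eq_bigr => b _.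
rewrite sumrB !big_bool /= -mulmxDl gl_compE; congr (_ - _).
case: b => /=; rewrite ?expr1 ?expr0 !scale1r; last by rewrite -mulmxDr gl_compE.
by rewrite scaleN1r /gl_theta mulmxBr addrC.
Qed.

Lemma gl_bracket_sumr (x y : gl) :
  gl_bracket x y = \sum_(a : bool) (gl_comp a x *m y - glth a y *m gl_comp a x).
Proof.
rewrite /gl_bracket; apply: eq_bigr => a _.
rewrite sumrB !big_bool /= -mulmxDr gl_compE; congr (_ - _).
case: a => /=; rewrite ?expr1 ?expr0 !scale1r; last by rewrite -mulmxDl gl_compE.
by rewrite scaleN1r /gl_theta mulmxBl addrC.
Qed.

Lemma gl_bracketE a (x y : gl) : gl_comp a y = y ->
  gl_bracket x y = x *m y - y *m glth a x.
Proof.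
move=> hy; have := gl_compN hy; rewrite gl_bracket_suml big_bool.
by case: a hy => /= -> ->; rewrite mulmx0 mul0mx subrr ?add0r ?addr0.
Qed.

Lemma gl_bracketEl a (x y : gl) : gl_comp a x = x ->
  gl_bracket x y = x *m y - glth a y *m x.
Proof.
move=> hx; have := gl_compN hx; rewrite gl_bracket_sumr big_bool.
by case: a hx => /= -> ->; rewrite mulmx0 mul0mx subrr ?add0r ?addr0.
Qed.

Lemma gl_comp_bracket a b (x y : gl) : gl_comp a x = x -> gl_comp b y = y ->
  gl_comp (a (+) b) (gl_bracket x y) = gl_bracket x y.
Proof.
move=> hx hy; rewrite (gl_bracketE _ hy).
have -> : glth b x = (-1) ^+ (a && b) *: x.
  rewrite -hx; case: b hy => _ /=; rewrite ?andbF ?andbT ?expr0 ?scale1r //.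
  by rewrite gl_comp_theta_sign.
move: ((-1) ^+ _) => s; rewrite -hx -hy -scalemxAr.
case: a {hx} => /=; case: b {hy} => /=; rewrite /gl_comp !mulmx_block.
all: rewrite scale_block_mx opp_block_mx add_block_mx.
all: rewrite !(block_mxKul, block_mxKur, block_mxKdl, block_mxKdr).
all: by rewrite !(mulmx0, mul0mx, scaler0, oppr0, addr0, add0r).
Qed.

Lemma homog_bracket a b (x y : pe) : homog a x -> homog b y ->
  homog (a (+) b) (pe_bracket x y).
Proof. exact: gl_comp_bracket. Qed.

Lemma gl_thetaB (x y : gl) : gl_theta (x - y) = gl_theta x - gl_theta y.
Proof. by rewrite -scaleN1r addrC gl_theta_linear scaleN1r addrC. Qed.

Lemma glthM a (x y : gl) : glth a (x *m y) = glth a x *m glth a y.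
Proof. by case: a => //=; rewrite gl_thetaM. Qed.
Lemma glthB a (x y : gl) : glth a (x - y) = glth a x - glth a y.
Proof. by case: a => //=; rewrite gl_thetaB. Qed.
Lemma glth_comp a b (x : gl) : gl_comp b x = x -> glth a x = (-1) ^+ (a && b) *: x.
Proof.
move=> <-; case: a => /=; rewrite ?expr0 ?scale1r //.
by rewrite gl_comp_theta_sign.
Qed.
Lemma glth_add a b (x : gl) : glth a (glth b x) = glth (a (+) b) x.
Proof. by case: a; case: b => //=; rewrite gl_thetaK. Qed.

(** The sign (-1)^(|x||y|) is absorbed in [th a x], so that x may be inhomogeneous. Once the
    brackets are written as twisted commutators, both sides are sums of the same matrix products. *)
Lemma pe_jacobi a b (x y z : pe) : homog a y -> homog b z ->
  pe_bracket x (pe_bracket y z)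
  = pe_bracket (pe_bracket x y) z + pe_bracket y (pe_bracket (th a x) z).
Proof.
move=> hy hz; apply/val_inj => /=.
pose s : C := (-1) ^+ (a && b).
rewrite (gl_bracketE _ (gl_comp_bracket hy hz)) (gl_bracketEl _ hy).
rewrite !(gl_bracketE _ hz) (gl_bracketE _ hy).
rewrite !val_th !glthB !glthM !glth_add (glth_comp a hz) (glth_comp b hy).
rewrite [b && a]andbC -/s (gl_bracketEl _ hy) glthB !glthM !glth_add.
rewrite (glth_comp a hz) -/s [b (+) a]addbC addbA addbb addFb.
rewrite !(mulmxBl, mulmxBr) -!(scalemxAl, scalemxAr) -!mulmxA.
by rewrite !opprB [RHS]addrACA !subrKA addrACA [- _ + _]addrC addrACA.
Qed.

Lemma homog_th a b (x : pe) : homog b x -> homog b (th a x).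
Proof. by rewrite thE; case: a => // hx; rewrite (homog_theta hx); apply: homogZ. Qed.

Lemma homog_comp a (x : pe) : homog a (pe_comp a x).
Proof.
rewrite /homog /= /gl_comp; case: a;
by rewrite !(block_mxKul, block_mxKur, block_mxKdl, block_mxKdr).
Qed.

Lemma pe_compE (x : pe) : pe_comp true x + pe_comp false x = x.
Proof. by apply/val_inj; rewrite /= gl_compE. Qed.

Lemma homog_pe_comp a (x : pe) : homog a x -> pe_comp a x = x.
Proof. by move=> hx; apply/val_inj. Qed.
Lemma homog_pe_compN a (x : pe) : homog a x -> pe_comp (~~ a) x = 0.
Proof. by move=> hx; apply/val_inj => /=; exact: gl_compN. Qed.

Lemma thP a c (x y : pe) : th a (c *: x + y) = c *: th a x + th a y.
Proof. by rewrite !thE; case: a => //; rewrite pe_theta_linear. Qed.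
Lemma thD a (x y : pe) : th a (x + y) = th a x + th a y.
Proof. by rewrite -[x in LHS]scale1r thP scale1r. Qed.
Lemma thK a x : th a (th a x) = x.
Proof. by rewrite !thE; case: a => //; rewrite pe_thetaK. Qed.
Lemma th_theta a x : pe_theta (th a x) = th a (pe_theta x).
Proof. by rewrite !thE; case: a. Qed.
Lemma th_homog a b x : homog b x -> th a x = (-1) ^+ (a && b) *: x.
Proof.
rewrite thE; case: a => hx; last by rewrite expr0 scale1r.
by rewrite (homog_theta hx).
Qed.

Lemma pe_bracket_linl c (x x' y : pe) :
  pe_bracket (c *: x + x') y = c *: pe_bracket x y + pe_bracket x' y.
Proof.
apply/val_inj => /=; rewrite !gl_bracket_suml scaler_sumr -big_split /=.
apply: eq_bigr => b _; rewrite glth_linear mulmxDl mulmxDr -!(scalemxAl, scalemxAr).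
by rewrite scalerBr opprD addrACA.
Qed.

Lemma pe_bracketDl (x x' y : pe) :
  pe_bracket (x + x') y = pe_bracket x y + pe_bracket x' y.
Proof. by rewrite -[x in LHS]scale1r pe_bracket_linl scale1r. Qed.

Lemma pe_bracket_linr c (x y y' : pe) :
  pe_bracket x (c *: y + y') = c *: pe_bracket x y + pe_bracket x y'.
Proof.
apply/val_inj => /=; rewrite !gl_bracket_suml scaler_sumr -big_split /=.
apply: eq_bigr => b _; rewrite gl_comp_linear mulmxDl mulmxDr -!(scalemxAl, scalemxAr).
by rewrite scalerBr opprD addrACA.
Qed.

End Algebra.

(** * Supercommutation in modules *)

Section Ops.
Context (C : numClosedFieldType) (n : nat).
Local Notation pe := (pe C n).
Context (M : smod C n).

HB.instance Definition _ (x : pe) :=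
  GRing.isLinear.Build C M M *:%R (@act C n M x) (act_linr x).
HB.instance Definition _ :=
  GRing.isLinear.Build C M M *:%R (@par C n M) (@par_lin C n M).

Lemma actDl (x y : pe) (v : M) : act (x + y) v = act x v + act y v.
Proof. by rewrite -[x in LHS]scale1r act_linl scale1r. Qed.
Lemma act0l (v : M) : act 0 v = 0.
Proof. by apply: (@addrI _ (act 0 v)); rewrite -actDl !addr0. Qed.
Lemma actZl c (x : pe) (v : M) : act (c *: x) v = c *: act x v.
Proof. by rewrite -[c *: x]addr0 act_linl act0l addr0. Qed.

(** Each homogeneous component of x obeys the sign rule, and [th a] collects the signs. This is the
    form in which the module axiom is used below, with x arbitrary. *)
Lemma act_comm a (x y : pe) (v : M) : homog a y ->
  act x (act y v) = act y (act (th a x) v) + act (pe_bracket x y) v.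
Proof.
move=> hy.
have H b x' : homog b x' ->
    act x' (act y v) = act y (act (th a x') v) + act (pe_bracket x' y) v.
  move=> hx; rewrite (act_bracket _ hx hy) (th_homog _ hx) actZl linearZ /= andbC.
  by rewrite addrC subrK.
rewrite -[x in LHS]pe_compE actDl !(H _ _ (homog_comp _ _)).
rewrite addrACA -linearD /= -!actDl.
congr (act _ (act _ _) + act _ _); first by rewrite -thD pe_compE.
by rewrite -[x in RHS]pe_compE pe_bracketDl.
Qed.

Lemma par_actE x (v : M) : par (act x v) = act (pe_theta x) (par v).
Proof.
rewrite -{1}(pe_compE x) actDl linearD /= !(par_act _ (homog_comp _ _)).
by rewrite -!actZl -actDl expr1 expr0 scale1r scaleN1r addrC.
Qed.

End Ops.

(** * Triangular decomposition *)

Section Triangular.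
Context (C : numClosedFieldType) (n : nat).
Local Notation pe := (pe C n).
Local Notation gl := 'M[C]_(n + n).
Implicit Types (x y : pe).

Definition ul x : 'M[C]_n := ulsubmx x.
Definition ur x : 'M[C]_n := ursubmx x.
Definition dl x : 'M[C]_n := dlsubmx x.

Lemma pe_blockE x : x = block_mx (ul x) (ur x) (dl x) (- (ul x)^T) :> gl.
Proof.
have [A [B [D [hB hD e]]]] := peP x.
by rewrite /ul /ur /dl e block_mxKul block_mxKur block_mxKdl.
Qed.

Lemma pe_ext x y : ul x = ul y -> ur x = ur y -> dl x = dl y -> x = y.
Proof.
by move=> h1 h2 h3; apply/val_inj; rewrite /= (pe_blockE x) (pe_blockE y) h1 h2 h3.
Qed.

Lemma tr_ur x : (ur x)^T = ur x.
Proof. by have [A [B [D [hB hD e]]]] := peP x; rewrite /ur e block_mxKur. Qed.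
Lemma tr_dl x : (dl x)^T = - dl x.
Proof. by have [A [B [D [hB hD e]]]] := peP x; rewrite /dl e block_mxKdl. Qed.

Lemma pe_mxP c x y : c *: x + y = c *: (x : gl) + (y : gl) :> gl.
Proof. by []. Qed.
Lemma ulP c x y : ul (c *: x + y) = c *: ul x + ul y.
Proof. by rewrite /ul pe_mxP /ulsubmx !linearP. Qed.
Lemma urP c x y : ur (c *: x + y) = c *: ur x + ur y.
Proof. by rewrite /ur pe_mxP /ursubmx !linearP. Qed.
Lemma dlP c x y : dl (c *: x + y) = c *: dl x + dl y.
Proof. by rewrite /dl pe_mxP /dlsubmx !linearP. Qed.

Fact mkpe_subproof (A B D : 'M[C]_n) :
  block_mx A (B + B^T) (D - D^T) (- A^T) \in @is_pe C n.
Proof.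
apply/is_peP; exists A, (B + B^T), (D - D^T); split=> //.
  by rewrite linearD /= trmxK addrC.
by rewrite linearB /= trmxK opprB.
Qed.

(* The symmetrised form of the off-diagonal blocks makes [mkpe] total. *)
Definition mkpe A B D : pe := Pe (mkpe_subproof A B D).

Lemma ul_mkpe A B D : ul (mkpe A B D) = A. Proof. exact: block_mxKul. Qed.
Lemma ur_mkpe A B D : ur (mkpe A B D) = B + B^T. Proof. exact: block_mxKur. Qed.
Lemma dl_mkpe A B D : dl (mkpe A B D) = D - D^T. Proof. exact: block_mxKdl. Qed.

Lemma ul_theta x : ul (pe_theta x) = ul x.
Proof. by rewrite /ul val_pe_theta (pe_blockE x) gl_thetaE !block_mxKul. Qed.
Lemma ur_theta x : ur (pe_theta x) = - ur x.
Proof. by rewrite /ur val_pe_theta (pe_blockE x) gl_thetaE !block_mxKur. Qed.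
Lemma dl_theta x : dl (pe_theta x) = - dl x.
Proof. by rewrite /dl val_pe_theta (pe_blockE x) gl_thetaE !block_mxKdl. Qed.

Lemma ul_th a x : ul (th a x) = ul x.
Proof. by rewrite thE; case: a => //; exact: ul_theta. Qed.
Lemma ur_th a x : ur (th a x) = (-1) ^+ a *: ur x.
Proof. by rewrite thE; case: a; rewrite ?expr1 ?expr0 ?scaleN1r ?scale1r ?ur_theta. Qed.
Lemma dl_th a x : dl (th a x) = (-1) ^+ a *: dl x.
Proof. by rewrite thE; case: a; rewrite ?expr1 ?expr0 ?scaleN1r ?scale1r ?dl_theta. Qed.

Lemma homogE a x : homog a x <-> (if a then ul x = 0 else ur x = 0 /\ dl x = 0).
Proof.
rewrite /homog {2}(pe_blockE x) /gl_comp; case: a; split.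
- by case/eq_block_mx.
- by move=> ->; rewrite trmx0 oppr0.
- by case/eq_block_mx.
- move=> -[e1 e2]; rewrite e1 e2 -/(ul x); congr block_mx.
  by rewrite (pe_blockE x) block_mxKdr.
Qed.

Lemma bracket_block x y : [/\
  ul (pe_bracket x y) = ur x *m dl y + ur y *m dl x + (ul x *m ul y - ul y *m ul x),
  ur (pe_bracket x y) = ul x *m ur y + ur y *m (ul x)^T - (ur x *m (ul y)^T + ul y *m ur x) &
  dl (pe_bracket x y) = dl x *m ul y + (ul y)^T *m dl x - ((ul x)^T *m dl y + dl y *m ul x)].
Proof.
rewrite {1}/ul {3}/ur {3}/dl /= (pe_blockE x) (pe_blockE y).
move: (ul x) (ur x) (dl x) (ul y) (ur y) (dl y) => A B D A' B' D'.
rewrite /gl_bracket !big_bool /gl_comp.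
rewrite !(block_mxKul, block_mxKur, block_mxKdl, block_mxKdr) /=.
rewrite expr1 expr0 !scaleN1r !scale1r !opprK !mulmx_block.
rewrite !(mul0mx, mulmx0, addr0, add0r, oppr0, opp_block_mx, add_block_mx).
rewrite !(block_mxKul, block_mxKur, block_mxKdl, block_mxKdr).
rewrite !(mulmxN, mulNmx, opprK).
by split=> //; rewrite ?opprD // [LHS]addrC.
Qed.
Lemma ul_bracket x y : ul (pe_bracket x y)
  = ur x *m dl y + ur y *m dl x + (ul x *m ul y - ul y *m ul x).
Proof. by case: (bracket_block x y). Qed.
Lemma ur_bracket x y : ur (pe_bracket x y)
  = ul x *m ur y + ur y *m (ul x)^T - (ur x *m (ul y)^T + ul y *m ur x).
Proof. by case: (bracket_block x y). Qed.
Lemma dl_bracket x y : dl (pe_bracket x y)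
  = dl x *m ul y + (ul y)^T *m dl x - ((ul x)^T *m dl y + dl y *m ul x).
Proof. by case: (bracket_block x y). Qed.

Definition uppermx (A : 'M[C]_n) : 'M[C]_n :=
  \matrix_(i, j) if (i <= j)%N then A i j else 0.

Fact proj_key : unit. Proof. by []. Qed.
(** The projection to the Borel subalgebra along [mneg]. The factor 1/2 undoes the symmetrisation B
    + B^T in [mkpe]. *)
Definition bp : pe -> pe :=
  locked_with proj_key (fun x => mkpe (uppermx (ul x)) (2^-1 *: ur x) 0).
Definition mp : pe -> pe := locked_with proj_key (fun x => x - bp x).
Lemma bpE x : bp x = mkpe (uppermx (ul x)) (2^-1 *: ur x) 0.
Proof. by rewrite /bp unlock. Qed.
Lemma mpE x : mp x = x - bp x.
Proof. by rewrite /mp unlock. Qed.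

(** The strictly lower triangular part of g_0 together with all of g_(-1), so that the block [dl] is
    unrestricted. *)
Definition mneg x : Prop := ur x = 0 /\ forall i j : 'I_n, (i <= j)%N -> ul x i j = 0.

Lemma borelE x : borel x <-> dl x = 0 /\ forall i j : 'I_n, (j < i)%N -> ul x i j = 0.
Proof. by []. Qed.

Lemma ul_bp x : ul (bp x) = uppermx (ul x). Proof. by rewrite bpE; exact: ul_mkpe. Qed.
Lemma ur_bp x : ur (bp x) = ur x.
Proof.
by rewrite bpE ur_mkpe linearZ /= tr_ur -scalerDl -[2^-1]div1r -splitr scale1r.
Qed.
Lemma dl_bp x : dl (bp x) = 0. Proof. by rewrite bpE dl_mkpe trmx0 subr0. Qed.

Lemma ulB x y : ul (x - y) = ul x - ul y.
Proof. by rewrite addrC -scaleN1r ulP scaleN1r addrC. Qed.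
Lemma urB x y : ur (x - y) = ur x - ur y.
Proof. by rewrite addrC -scaleN1r urP scaleN1r addrC. Qed.
Lemma dlB x y : dl (x - y) = dl x - dl y.
Proof. by rewrite addrC -scaleN1r dlP scaleN1r addrC. Qed.

Lemma bp_borel x : borel (bp x).
Proof.
apply/borelE; rewrite dl_bp ul_bp; split=> // i j ij.
by rewrite mxE leqNgt ij.
Qed.

Lemma mp_mneg x : mneg (mp x).
Proof.
rewrite mpE /mneg urB ulB ur_bp ul_bp subrr; split=> // i j ij.
by rewrite !mxE ij subrr.
Qed.

Lemma bp_linear c x y : bp (c *: x + y) = c *: bp x + bp y.
Proof.
apply: pe_ext; rewrite ?(ulP, urP, dlP) ?(ul_bp, ur_bp, dl_bp) ?(ulP, urP, dlP) //.
  by apply/matrixP=> i j; rewrite !mxE; case: ifP => //; rewrite mulr0 addr0.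
by rewrite scaler0 addr0.
Qed.

Lemma mp_linear c x y : mp (c *: x + y) = c *: mp x + mp y.
Proof. by rewrite !mpE bp_linear scalerBr opprD addrACA. Qed.

Lemma bp_id x : borel x -> bp x = x.
Proof.
case/borelE=> h1 h2; apply: pe_ext; rewrite ?(ul_bp, ur_bp, dl_bp) //.
by apply/matrixP=> i j; rewrite [LHS]mxE; case: leqP => // /h2 ->; rewrite ?mxE.
Qed.
Lemma mp_borel x : borel x -> mp x = 0.
Proof. by move=> h; rewrite mpE bp_id // subrr. Qed.
Lemma bp_mneg x : mneg x -> bp x = 0.
Proof.
have e0 : [/\ ul 0 = 0, ur 0 = 0 & dl 0 = 0].
  by rewrite -(subrr x) ulB urB dlB !subrr.
case: e0 => e1 e2 e3 [h1 h2].
apply: pe_ext; rewrite ?(ul_bp, ur_bp, dl_bp) ?e1 ?e2 ?e3 //.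
by apply/matrixP=> i j; rewrite [LHS]mxE; case: leqP => [/h2 ->|_]; rewrite [RHS]mxE.
Qed.
Lemma mp_id x : mneg x -> mp x = x.
Proof. by move=> h; rewrite mpE bp_mneg // subr0. Qed.
Lemma mp_bp x : mp x + bp x = x. Proof. by rewrite mpE subrK. Qed.

Lemma bp_theta x : bp (pe_theta x) = pe_theta (bp x).
Proof.
by apply: pe_ext; rewrite ?ul_bp ?ur_bp ?dl_bp ?(ul_theta, ur_theta, dl_theta) ?ul_bp ?ur_bp ?dl_bp ?oppr0.
Qed.
Lemma mp_theta x : mp (pe_theta x) = pe_theta (mp x).
Proof.
rewrite !mpE bp_theta; have := @pe_theta_linear C n (-1) (bp x) x.
by rewrite !scaleN1r addrC [in RHS]addrC => ->.
Qed.

Lemma borel_th a x : borel x -> borel (th a x).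
Proof.
case/borelE => h1 h2; apply/borelE; rewrite ul_th dl_th h1 scaler0; split=> //.
Qed.
Lemma mneg_th a x : mneg x -> mneg (th a x).
Proof. by case=> h1 h2; rewrite /mneg ul_th ur_th h1 scaler0; split. Qed.
Lemma mx_comm (A B : 'M[C]_n) i j :
  (A *m B - B *m A) i j = \sum_k A i k * B k j - \sum_k B i k * A k j.
Proof. by rewrite mxE [X in X + _]mxE [X in _ + X]mxE [X in _ - X]mxE. Qed.
Lemma borel_bracket x y : borel x -> borel y -> borel (pe_bracket x y).
Proof.
case/borelE=> h1 h2 /borelE[h3 h4]; apply/borelE.
rewrite dl_bracket ul_bracket h1 h3 !(mulmx0, mul0mx, addr0, add0r, oppr0); split=> // i j ij.
rewrite mx_comm !big1 ?subrr // => k _.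
  by case: (ltnP k i) => ki; [rewrite (h4 i k)|rewrite (h2 k j)]; rewrite ?mulr0 ?mul0r // (leq_trans ij).
by case: (ltnP k i) => ki; [rewrite (h2 i k)|rewrite (h4 k j)]; rewrite ?mulr0 ?mul0r // (leq_trans ij).
Qed.
Lemma mneg_bracket x y : mneg x -> mneg y -> mneg (pe_bracket x y).
Proof.
case=> h1 h2 [h3 h4]; rewrite /mneg.
rewrite ur_bracket ul_bracket h1 h3 !(mulmx0, mul0mx, addr0, add0r, oppr0); split=> // i j ij.
rewrite mx_comm !big1 ?subrr // => k _.
  by case: (leqP i k) => ki; [rewrite (h4 i k)|rewrite (h2 k j)]; rewrite ?mulr0 ?mul0r // (leq_trans (ltnW ki)).
by case: (leqP i k) => ki; [rewrite (h2 i k)|rewrite (h4 k j)]; rewrite ?mulr0 ?mul0r // (leq_trans (ltnW ki)).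
Qed.

Variable lam : 'rV[C]_n.
Lemma weight_valE x : weight_val lam x = \sum_i lam 0 i * ul x i i.
Proof. by []. Qed.
Lemma weight_valP c x y :
  weight_val lam (c *: x + y) = c * weight_val lam x + weight_val lam y.
Proof.
rewrite !weight_valE mulr_sumr -big_split; apply: eq_bigr => i _ /=.
by rewrite ulP mxE [X in _ * (X + _)]mxE mulrDr mulrCA.
Qed.
Lemma weight_val_th a x : weight_val lam (th a x) = weight_val lam x.
Proof. by rewrite !weight_valE; apply: eq_bigr => i _; rewrite ul_th. Qed.
(** A commutator of upper triangular matrices has zero diagonal, and g_1 contributes nothing to the
    block [ul] because [dl] vanishes on the Borel subalgebra. Hence a weight is a character of
    it. *)
Lemma weight_val_bracket x y : borel x -> borel y ->
  weight_val lam (pe_bracket x y) = 0.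
Proof.
case/borelE=> h1 h2 /borelE[h3 h4]; rewrite weight_valE big1 // => i _.
rewrite ul_bracket h1 h3 !(mulmx0, addr0, add0r) mx_comm.
rewrite (bigD1 i) //= [X in _ - X](bigD1 i) //= !big1 ?addr0; last first.
- move=> k; rewrite -val_eqE /= neq_ltn => /orP[]ki; first by rewrite (h2 i k) // mul0r.
  by rewrite (h4 k i) // mulr0.
- move=> k; rewrite -val_eqE /= neq_ltn => /orP[]ki; first by rewrite (h4 i k) // mul0r.
  by rewrite (h2 k i) // mulr0.
by rewrite [X in _ - X]mulrC subrr mulr0.
Qed.

End Triangular.

(** * A decision procedure for abelian groups *)

Inductive zexp := ZAtom of nat | ZAdd of zexp & zexp | ZOpp of zexp | ZZero.

Fixpoint zeval (V : zmodType) (env : seq V) (e : zexp) : V :=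
  match e with
  | ZAtom k => nth 0 env k
  | ZAdd a b => zeval env a + zeval env b
  | ZOpp a => - zeval env a
  | ZZero => 0
  end.

Fixpoint zcoef (e : zexp) (k : nat) : int :=
  match e with
  | ZAtom j => (j == k)%:Z
  | ZAdd a b => zcoef a k + zcoef b k
  | ZOpp a => - zcoef a k
  | ZZero => 0
  end.

Lemma zeval_coef (V : zmodType) (env : seq V) e :
  zeval env e = \sum_(k < size env) nth 0 env k *~ zcoef e k.
Proof.
elim: e => [j|a IHa b IHb|a IHa|] /=.
- have [lt_j|ge_j] := ltnP j (size env); last first.
    rewrite nth_default // big1 // => k _; rewrite gtn_eqF ?mulr0z //.
    exact: leq_trans (ltn_ord k) ge_j.
  rewrite (bigD1 (Ordinal lt_j)) //= eqxx big1 ?addr0 ?mulr1z // => k ne.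
  by rewrite (_ : (j == k) = false) ?mulr0z //; apply: contraNF ne => /eqP e; exact/eqP/val_inj.
- by rewrite IHa IHb -big_split; apply: eq_bigr => k _; rewrite mulrzDr.
- by rewrite IHa -sumrN; apply: eq_bigr => k _; rewrite mulrNz.
- by rewrite big1 // => k _; rewrite mulr0z.
Qed.

Lemma zeval_eq (V : zmodType) (env : seq V) e1 e2 :
  all (fun k => zcoef e1 k == zcoef e2 k) (iota 0 (size env)) ->
  zeval env e1 = zeval env e2.
Proof.
move=> /allP h; rewrite !zeval_coef; apply: eq_bigr => k _; congr (_ *~ _).
by apply/eqP/h; rewrite mem_iota /= ltn_ord.
Qed.

(* Scalings are compared up to conversion. *)
Ltac zsame x y :=
  match constr:((x, y)) with
  | (?t, ?t) => constr:(true)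
  | (@GRing.scale _ _ ?c ?u, @GRing.scale _ _ ?d ?v) =>
      let _ := match goal with _ => unify c d; unify u v end in constr:(true)
  | _ => constr:(false)
  end.
Ltac zindex x l :=
  lazymatch l with
  | cons ?y ?l' =>
      let b := zsame x y in
      lazymatch b with
      | true => constr:(O)
      | false => let k := zindex x l' in constr:(S k)
      end
  end.
Ltac zmem x l :=
  lazymatch l with
  | nil => constr:(false)
  | cons ?y ?l' =>
      let b := zsame x y in
      lazymatch b with true => constr:(true) | false => zmem x l' end
  end.
Ltac zatoms t l :=
  lazymatch t with
  | (?a + ?b)%R => let l' := zatoms a l in zatoms b l'
  | (- ?a)%R => zatoms a l
  | (0)%R => l
  | _ => let b := zmem t l in
         lazymatch b with true => l | false => constr:(cons t l) end
  end.
Ltac zreify t l :=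
  lazymatch t with
  | (?a + ?b)%R =>
      let ea := zreify a l in let eb := zreify b l in constr:(ZAdd ea eb)
  | (- ?a)%R => let ea := zreify a l in constr:(ZOpp ea)
  | (0)%R => constr:(ZZero)
  | _ => let k := zindex t l in constr:(ZAtom k)
  end.

(* Decides identities of abelian groups; scalar multiples are atoms. *)
Ltac zmod :=
  lazymatch goal with
  | |- @eq ?V ?a ?b =>
      let l := zatoms a (@nil V) in let l := zatoms b l in
      let ea := zreify a l in let eb := zreify b l in
      exact: (@zeval_eq _ l ea eb isT)
  end.

(** * Verma modules are free over the negative part *)

Section LinearExtension.
Context (C : numClosedFieldType) (K : choiceType).
Local Notation W := {malg C[K]}.

Definition lin_ext (N : lmodType C) (phi : K -> N) (f : W) : N :=
  \sum_(k <- msupp f) f@_k *: phi k.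

Lemma lin_extEw (N : lmodType C) (phi : K -> N) (d : {fset K}) f :
  {subset msupp f <= d} -> lin_ext phi f = \sum_(k <- d) f@_k *: phi k.
Proof.
move=> le; rewrite /lin_ext (big_fset_incl _ (B := d)) //; first exact/fsubsetP.
by move=> x xd /mcoeff_outdom ->; rewrite scale0r.
Qed.

Lemma lin_extP (N : lmodType C) (phi : K -> N) c f g :
  lin_ext phi (c *: f + g) = c *: lin_ext phi f + lin_ext phi g.
Proof.
pose d := (msupp (c *: f + g) `|` (msupp f `|` msupp g))%fset.
rewrite !(@lin_extEw _ _ d) => [|x|x|x]; rewrite ?in_fsetU; try by move=> ->; rewrite ?orbT.
rewrite scaler_sumr -big_split; apply: eq_bigr => k _ /=.
by rewrite mcoeffD mcoeffZ scalerDl scalerA.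
Qed.

Lemma lin_extU (N : lmodType C) (phi : K -> N) k : lin_ext phi << k >> = phi k.
Proof.
rewrite (@lin_extEw _ _ [fset k]%fset) => [|x]; last by rewrite msuppU oner_eq0.
by rewrite big_seq_fset1 mcoeffUU scale1r.
Qed.

Lemma malg_span (P : W -> Prop) : P 0 ->
  (forall c u v, P u -> P v -> P (c *: u + v)) -> (forall k, P << k >>) -> forall f, P f.
Proof.
move=> P0 Pl Pk f; rewrite [f]monalgE; elim: {1}(enum_fset _) => [|k r IH].
  by rewrite big_nil.
rewrite big_cons; have -> : << f@_k *g k >> = f@_k *: << k >> :> W.
  by apply/malgP => k'; rewrite mcoeffZ 2!mcoeffU mulrnAr mulr1.
exact: Pl.
Qed.

End LinearExtension.

Section Free.
Context (C : numClosedFieldType) (n : nat).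
Local Notation pe := (pe C n).
Local Notation W := {malg C[seq pe]}.

(** Letters range over all of pe(n), those of the Borel subalgebra being zero, so that a letter x
    stands for [mp x]; this avoids a separate type for the negative part. The context words p and s
    make the span a two-sided ideal. *)
Inductive letter_rel : W -> Prop :=
| letter_linear (p : seq pe) c (x y : pe) (s : seq pe) : letter_rel
    (<< p ++ (c *: x + y) :: s >> - (c *: << p ++ x :: s >> + << p ++ y :: s >>))
| letter_borel (p : seq pe) (x : pe) (s : seq pe) of borel x : letter_rel << p ++ x :: s >>
| letter_bracket (p : seq pe) a b (x y : pe) (s : seq pe) of homog a x & homog b y & mneg x & mneg y :
    letter_rel (<< p ++ pe_bracket x y :: s >>
      - (<< p ++ x :: y :: s >> - (-1) ^+ (a && b) *: << p ++ y :: x :: s >>)).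

Inductive letter_span : W -> Prop :=
| letter_span0 : letter_span 0
| letter_spanP c u v of letter_span u & letter_span v : letter_span (c *: u + v)
| letter_span_rel u of letter_rel u : letter_span u.

(* The enveloping algebra of [mneg], the complement of the Borel subalgebra. *)
Definition Uneg := quotient (mk_subspace (submod_closedP letter_span0 letter_spanP)).

Definition Uword (w : seq pe) : Uneg := proj _ << w >>.

Definition compat (N : lmodType C) (phi : seq pe -> N) : Prop :=
  [/\ forall (p : seq pe) c (x y : pe) (s : seq pe), phi (p ++ (c *: x + y) :: s) = c *: phi (p ++ x :: s) + phi (p ++ y :: s),
      forall (p : seq pe) (x : pe) (s : seq pe), borel x -> phi (p ++ x :: s) = 0 &
      forall (p : seq pe) a b (x y : pe) (s : seq pe), homog a x -> homog b y ->
        mneg x -> mneg y -> phi (p ++ pe_bracket x y :: s)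
        = phi (p ++ x :: y :: s) - (-1) ^+ (a && b) *: phi (p ++ y :: x :: s)].

(** Evaluates a chosen representative. For compatible phi the result does not depend on the choice
    ([lift_proj]). *)
Definition lift_fun (N : lmodType C) (phi : seq pe -> N) (v : Uneg) : N :=
  lin_ext phi (repr v).

Lemma lin_ext_scalar (N : lmodType C) (phi : seq pe -> N) c f :
  lin_ext phi (c *: f) = c *: lin_ext phi f.
Proof.
have e0 : lin_ext phi 0 = 0.
  by have := lin_extP phi (-1) 0 0; rewrite scaler0 addr0 scaleN1r addNr.
by rewrite -[c *: f]addr0 lin_extP e0 addr0.
Qed.

Lemma lin_extB (N : lmodType C) (phi : seq pe -> N) f g :
  lin_ext phi (f - g) = lin_ext phi f - lin_ext phi g.
Proof. by rewrite [f - g]addrC -[- g]scaleN1r lin_extP scaleN1r addrC. Qed.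

Lemma lift_proj (N : lmodType C) (phi : seq pe -> N) f : compat phi ->
  lift_fun phi (proj _ f) = lin_ext phi f.
Proof.
case=> h1 h2 h3; apply/eqP; rewrite /lift_fun -subr_eq0 -lin_extB; apply/eqP.
have /mk_subspaceP : repr (proj (mk_subspace (submod_closedP letter_span0 letter_spanP)) f) - f
    \in mk_subspace (submod_closedP letter_span0 letter_spanP).
  by apply/projP; rewrite projK.
elim=> [|c u v _ IHu _ IHv|u].
- by rewrite -(scale0r 0) lin_ext_scalar scale0r.
- by rewrite lin_extP IHu IHv scaler0 addr0.
case=> [p c x y s|p x s bx|p a b x y s hx hy mx my].
- by rewrite lin_extB lin_extP !lin_extU h1 subrr.
- by rewrite lin_extU h2.
by rewrite !lin_extB lin_ext_scalar !lin_extU (h3 _ a b) // subrr.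
Qed.

Lemma Ulift_word (N : lmodType C) (phi : seq pe -> N) w : compat phi ->
  lift_fun phi (Uword w) = phi w.
Proof. by move=> h; rewrite lift_proj // lin_extU. Qed.

Lemma UliftP (N : lmodType C) (phi : seq pe -> N) : compat phi ->
  forall c u v, lift_fun phi (c *: u + v) = c *: lift_fun phi u + lift_fun phi v.
Proof.
move=> h c; elim/projW=> u; elim/projW => v.
by rewrite -proj_is_linear !lift_proj // lin_extP.
Qed.

Lemma Uword_span (P : Uneg -> Prop) : P 0 ->
  (forall c u v, P u -> P v -> P (c *: u + v)) -> (forall w, P (Uword w)) -> forall v, P v.
Proof.
move=> P0 Pl Pw; elim/projW; elim/malg_span => //; first by rewrite proj0.
by move=> c u v hu hv; rewrite proj_is_linear; exact: Pl.
Qed.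

Lemma word_rel f g : letter_rel (f - g) ->
  proj (mk_subspace (submod_closedP letter_span0 letter_spanP)) f = proj _ g.
Proof. by move=> h; apply/projP/mk_subspaceP/letter_span_rel. Qed.

Lemma Ucompat_word : compat Uword.
Proof.
split=> [p c x y s|p x s bx|p a b x y s hx hy mx my].
- by rewrite /Uword -proj_is_linear; apply/word_rel/letter_linear.
- by rewrite /Uword -[RHS]proj0; apply/word_rel; rewrite subr0; apply: letter_borel.
rewrite /Uword -scaleNr addrC -proj_is_linear; apply/word_rel.
by rewrite scaleNr [- _ + _]addrC; apply: letter_bracket.
Qed.

End Free.

(* [Uneg] is only used through this interface: with its concrete carrier,
   unification keeps unfolding the quotient. *)
Record neg_model (C : numClosedFieldType) (n : nat) := NegModel {
  neg_car :> lmodType C;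
  word : seq (pe C n) -> neg_car;
  lift : forall N : lmodType C, (seq (pe C n) -> N) -> neg_car -> N;
  compat_word : compat word;
  liftP : forall (N : lmodType C) (phi : seq (pe C n) -> N), compat phi ->
    forall c u v, lift phi (c *: u + v) = c *: lift phi u + lift phi v;
  lift_word : forall (N : lmodType C) (phi : seq (pe C n) -> N) w, compat phi ->
    lift phi (word w) = phi w;
  word_span : forall P : neg_car -> Prop, P 0 ->
    (forall c u v, P u -> P v -> P (c *: u + v)) -> (forall w, P (word w)) ->
    forall v, P v }.

Definition Uneg_model (C : numClosedFieldType) (n : nat) : neg_model C n :=
  @NegModel C n (Uneg C n) (@Uword C n) (@lift_fun C n) (@Ucompat_word C n)
    (@UliftP C n) (@Ulift_word C n) (@Uword_span C n).

Section NegativePart.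
Context (C : numClosedFieldType) (n : nat) (Uneg : neg_model C n).
Local Notation pe := (pe C n).
Local Notation word := (@word C n Uneg).
Local Notation lift := (@lift C n Uneg).
Implicit Types (v : Uneg).

Lemma Uneg_span (P : Uneg -> Prop) : P 0 ->
  (forall c u v, P u -> P v -> P (c *: u + v)) -> (forall w, P (word w)) -> forall v, P v.
Proof. exact: word_span. Qed.

Lemma compat_cons (N : lmodType C) (phi : seq pe -> N) z :
  compat phi -> compat (fun w => phi (z :: w)).
Proof.
case=> h1 h2 h3; split=> [p c x y s|p x s bx|p a b x y s hx hy mx my].
- exact: (h1 (z :: p)).
- exact: (h2 (z :: p)).
exact: (h3 (z :: p) a b).
Qed.

Definition Lop (x : pe) : Uneg -> Uneg := lift (fun w => word (x :: w)).

Lemma Lop_word x w : Lop x (word w) = word (x :: w).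
Proof. by rewrite /Lop lift_word //; apply: compat_cons; exact: compat_word. Qed.
Lemma Lop_linear x c u v : Lop x (c *: u + v) = c *: Lop x u + Lop x v.
Proof. by apply: liftP; apply: compat_cons; exact: compat_word. Qed.
HB.instance Definition _ x := GRing.isLinear.Build C Uneg Uneg *:%R (Lop x) (Lop_linear x).

Lemma Lop_0 x : Lop x 0 = 0. Proof. exact: linear0. Qed.
Lemma LopP c x y v : Lop (c *: x + y) v = c *: Lop x v + Lop y v.
Proof.
elim/Uneg_span: v => [|d u v IHu IHv|w]; first by rewrite !Lop_0 scaler0 addr0.
  rewrite !Lop_linear IHu IHv !scalerDr !scalerA mulrC -!addrA; congr (_ + _).
  by rewrite addrCA.
by rewrite !Lop_word; have [h _ _] := compat_word Uneg; exact: (h [::]).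
Qed.
Lemma LopD x y v : Lop (x + y) v = Lop x v + Lop y v.
Proof. by rewrite -[x in LHS]scale1r LopP scale1r. Qed.
Lemma Lop_borel x v : borel x -> Lop x v = 0.
Proof.
move=> bx; elim/Uneg_span: v => [|d u v IHu IHv|w]; first by rewrite Lop_0.
  by rewrite Lop_linear IHu IHv scaler0 addr0.
by rewrite Lop_word; have [_ h _] := compat_word Uneg; exact: (h [::]).
Qed.
Lemma Lop0 v : Lop 0 v = 0.
Proof. by apply: (@addrI _ (Lop 0 v)); rewrite -LopD !addr0. Qed.
Lemma LopZ c x v : Lop (c *: x) v = c *: Lop x v.
Proof. by rewrite -[c *: x]addr0 LopP Lop0 addr0. Qed.
Lemma Lop_mp x v : Lop (mp x) v = Lop x v.
Proof. by rewrite -[x in RHS]mp_bp LopD [X in _ + X]Lop_borel ?addr0 //; exact: bp_borel. Qed.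

Lemma Lop_bracket a b x y v : homog a x -> homog b y -> mneg x -> mneg y ->
  Lop (pe_bracket x y) v = Lop x (Lop y v) - (-1) ^+ (a && b) *: Lop y (Lop x v).
Proof.
move=> hx hy mx my; elim/Uneg_span: v => [|d u v IHu IHv|w].
- by rewrite !Lop_0 scaler0 subr0.
- rewrite !Lop_linear IHu IHv scalerBr scalerDr opprD addrACA.
  by rewrite !scalerA mulrC.
by rewrite !Lop_word; have [_ _ h] := compat_word Uneg; exact: (h [::]).
Qed.

Lemma Lop_D x u v : Lop x (u + v) = Lop x u + Lop x v.
Proof. exact: linearD. Qed.
Lemma Lop_Z x c v : Lop x (c *: v) = c *: Lop x v.
Proof. exact: linearZ. Qed.
Lemma Lop_B x u v : Lop x (u - v) = Lop x u - Lop x v.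
Proof. exact: linearB. Qed.

End NegativePart.

(** * The bracket, the grading and the triangular projections *)

Section MoreBracket.
Context (C : numClosedFieldType) (n : nat).
Local Notation pe := (pe C n).
Implicit Types (x y q : pe).

Lemma th_bracket a x y : th a (pe_bracket x y) = pe_bracket (th a x) (th a y).
Proof. by rewrite !thE; case: a => //; exact: pe_theta_bracket. Qed.

Lemma bracket_antisym a x q : homog a x -> pe_bracket (th a q) x = - pe_bracket x q.
Proof.
move=> hx; apply/val_inj => /=.
by rewrite (gl_bracketE _ hx) (gl_bracketEl _ hx) !val_th glth_add addbb opprB.
Qed.

Lemma bracketZl c x y : pe_bracket (c *: x) y = c *: pe_bracket x y.
Proof.
have h0 : pe_bracket 0 y = 0.
  by have := pe_bracket_linl (-1) 0 0 y; rewrite scaler0 addr0 scaleN1r addNr.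
by rewrite -[c *: x]addr0 pe_bracket_linl h0 addr0.
Qed.
Lemma bracketZr c x y : pe_bracket x (c *: y) = c *: pe_bracket x y.
Proof.
have h0 : pe_bracket x 0 = 0.
  by have := pe_bracket_linr (-1) x 0 0; rewrite scaler0 addr0 scaleN1r addNr.
by rewrite -[c *: y]addr0 pe_bracket_linr h0 addr0.
Qed.
Lemma bracketDr x y y' : pe_bracket x (y + y') = pe_bracket x y + pe_bracket x y'.
Proof. by rewrite -[y in LHS]scale1r pe_bracket_linr scale1r. Qed.

Lemma bp_th a x : bp (th a x) = th a (bp x).
Proof. by rewrite !thE; case: a => //; exact: bp_theta. Qed.

Lemma comp_th a x : pe_comp a x = 2^-1 *: (x + (-1) ^+ a *: pe_theta x).
Proof.
rewrite /pe_theta -{2}[x]pe_compE.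
have e (u v : pe) : u = 2^-1 *: (u + v + (u - v)).
  by rewrite addrACA subrr addr0 scalerDr -scalerDl -[2^-1]div1r -splitr scale1r.
case: a; rewrite ?expr1 ?expr0 ?scale1r ?scaleN1r ?opprB; first exact: e.
by rewrite [pe_comp true x + _]addrC; exact: e.
Qed.

Lemma pe_compP a c x y : pe_comp a (c *: x + y) = c *: pe_comp a x + pe_comp a y.
Proof. by apply/val_inj; rewrite /= gl_comp_linear. Qed.
Lemma bracket0r x : pe_bracket x 0 = 0.
Proof. by have := bracketZr 0 x 0; rewrite !scale0r. Qed.
Lemma bp0 : bp 0 = 0 :> pe.
Proof. by have := bp_linear (-1) (0 : pe) 0; rewrite scaler0 addr0 scaleN1r addNr. Qed.

Lemma bpZ c x : bp (c *: x) = c *: bp x.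
Proof.
have h0 : bp 0 = 0 :> pe by have := bp_linear (-1) (0 : pe) 0; rewrite scaler0 addr0 scaleN1r addNr.
by rewrite -[c *: x]addr0 bp_linear h0 addr0.
Qed.
Lemma bpD x y : bp (x + y) = bp x + bp y.
Proof. by rewrite -[x in LHS]scale1r bp_linear scale1r. Qed.
Lemma mpZ c x : mp (c *: x) = c *: mp x.
Proof. by rewrite !mpE bpZ scalerBr. Qed.
Lemma mpD x y : mp (x + y) = mp x + mp y.
Proof. by rewrite -[x in LHS]scale1r mp_linear scale1r. Qed.

Lemma bracket_mp_bp x y : pe_bracket (mp x) y + pe_bracket (bp x) y = pe_bracket x y.
Proof. by rewrite -pe_bracketDl mp_bp. Qed.
Lemma bp_bracket_bp x y : mneg y -> bp (pe_bracket x y) = bp (pe_bracket (bp x) y).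
Proof.
move=> my; rewrite -(bracket_mp_bp x) bpD (bp_mneg (mneg_bracket (mp_mneg x) my)).
by rewrite add0r.
Qed.

Lemma th_add a b x : th a (th b x) = th (a (+) b) x.
Proof. by rewrite !thE; case: a; case: b => //; rewrite pe_thetaK. Qed.

Lemma mp_comp a x : mp (pe_comp a x) = pe_comp a (mp x).
Proof.
by rewrite !comp_th mpZ addrC mp_linear mp_theta [in RHS]addrC.
Qed.
Lemma bp_comp a x : bp (pe_comp a x) = pe_comp a (bp x).
Proof.
by rewrite !comp_th bpZ addrC bp_linear bp_theta [in RHS]addrC.
Qed.
Lemma homog_mp a x : homog a x -> homog a (mp x).
Proof. by move=> hx; rewrite -(homog_pe_comp hx) mp_comp; exact: homog_comp. Qed.
Lemma homog_bp a x : homog a x -> homog a (bp x).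
Proof. by move=> hx; rewrite -(homog_pe_comp hx) bp_comp; exact: homog_comp. Qed.
Lemma mneg_comp a x : mneg x -> mneg (pe_comp a x).
Proof. by move=> /mp_id <-; rewrite -mp_comp; exact: mp_mneg. Qed.
Lemma borel_comp a x : borel x -> borel (pe_comp a x).
Proof. by move=> /bp_id <-; rewrite -bp_comp; exact: bp_borel. Qed.

Lemma sign_cancel a b (V : lmodType C) (v : V) :
  (-1) ^+ (a && b) *: ((-1) ^+ (a && b) *: v) = v.
Proof. by rewrite scalerA -expr2 sqrr_sign scale1r. Qed.

End MoreBracket.

Opaque pe_bracket pe_comp pe_theta bp mp th.

(** * The Verma action on the enveloping algebra of the negative part *)

Section VermaModel.
Context (C : numClosedFieldType) (n : nat) (Uneg : neg_model C n) (lam : 'rV[C]_n).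
Local Notation pe := (pe C n).
Local Notation word := (@word C n Uneg).
Implicit Types (x y : pe) (v : Uneg).

(** The bracket is taken with [mp x] because left multiplication by x only sees its negative
    component. *)
Lemma Lop_comm a x y v : homog a y -> mneg y ->
  Lop x (Lop y v) = Lop y (Lop (th a x) v) + Lop (pe_bracket (mp x) y) v.
Proof.
move=> hy my.
have H b x' : homog b x' -> Lop x' (Lop y v) = Lop y (Lop (th a x') v) + Lop (pe_bracket (mp x') y) v.
  move=> hx; rewrite (Lop_bracket _ (homog_mp hx) hy (mp_mneg _) my) !Lop_mp.
  rewrite (th_homog _ hx) LopZ linearZ /= andbC.
  by rewrite addrC subrK.
rewrite -[x in LHS]pe_compE LopD !(H _ _ (homog_comp _ _)).
rewrite addrACA -linearD /= -!LopD.
congr (Lop _ (Lop _ _) + Lop _ _); first by rewrite -thD pe_compE.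
by rewrite -pe_bracketDl !mp_comp pe_compE.
Qed.

(* Moves the Borel element [b] to the right through a word, where it acts on the
   highest weight vector by [lam]. *)
Fixpoint borel_word_rec (w : seq pe) (b : pe) : Uneg :=
  if w is y :: w' then
    Lop (pe_comp false y) (borel_word_rec w' b)
    + Lop (pe_comp true y) (borel_word_rec w' (pe_theta b))
    + (Lop (pe_bracket b (mp y)) (word w') + borel_word_rec w' (bp (pe_bracket b (mp y))))
  else weight_val lam b *: word [::].
Fact borel_word_key : unit. Proof. by []. Qed.
Definition borel_word := locked_with borel_word_key borel_word_rec.

Lemma borel_word_nil x : borel_word [::] x = weight_val lam x *: word [::].
Proof. by rewrite /borel_word unlock. Qed.
Lemma borel_wordE y w x : borel_word (y :: w) x =
  Lop (pe_comp false y) (borel_word w x)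
    + Lop (pe_comp true y) (borel_word w (pe_theta x))
    + (Lop (pe_bracket x (mp y)) (word w) + borel_word w (bp (pe_bracket x (mp y)))).
Proof. by rewrite /borel_word unlock. Qed.

Lemma borel_wordP w c x y :
  borel_word w (c *: x + y) = c *: borel_word w x + borel_word w y.
Proof.
elim: w c x y => [|z w IH] c x y.
  by rewrite !borel_word_nil weight_valP scalerDl scalerA.
rewrite !borel_wordE pe_theta_linear !pe_bracket_linl bp_linear !IH LopP !Lop_linear.
by rewrite !scalerDr; zmod.
Qed.

Lemma borel_wordZ w c x : borel_word w (c *: x) = c *: borel_word w x.
Proof.
have h0 : borel_word w 0 = 0.
  by have := borel_wordP w (-1) 0 0; rewrite scaler0 addr0 scaleN1r addNr.
by rewrite -[c *: x]addr0 borel_wordP h0 addr0.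
Qed.
Lemma borel_wordD w x y : borel_word w (x + y) = borel_word w x + borel_word w y.
Proof. by rewrite -[x in LHS]scale1r borel_wordP scale1r. Qed.
Lemma borel_wordB w x y : borel_word w (x - y) = borel_word w x - borel_word w y.
Proof. by rewrite borel_wordD -[- y]scaleN1r borel_wordZ scaleN1r. Qed.
Lemma LopB x y v : Lop (x - y) v = Lop x v - Lop y v.
Proof. by rewrite LopD -[- y]scaleN1r LopZ scaleN1r. Qed.
Lemma borel_word0 w : borel_word w 0 = 0.
Proof. by rewrite -(scale0r 0) borel_wordZ scale0r. Qed.

Lemma borel_word_cons a y w x : homog a y ->
  borel_word (y :: w) x = Lop y (borel_word w (th a x))
    + (Lop (pe_bracket x (mp y)) (word w) + borel_word w (bp (pe_bracket x (mp y)))).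
Proof.
move=> hy; rewrite borel_wordE; have := homog_pe_compN hy; have := homog_pe_comp hy.
by rewrite thE; case: a hy => hy -> ->; rewrite Lop0 ?addr0 ?add0r.
Qed.

(** The heart of the construction, in place of a basis theorem: moving t past the letter [x,y]
    agrees with moving it past x and y. It is the Jacobi identity, with [t,x] and [t,y] split into a
    negative component, which multiplies, and a Borel component, which is moved on to the right. *)
Lemma borel_word_bracket a b x y w t :
  homog a x -> homog b y -> mneg x -> mneg y ->
  borel_word (pe_bracket x y :: w) t
  = borel_word (x :: y :: w) t - (-1) ^+ (a && b) *: borel_word (y :: x :: w) t.
Proof.
move=> hx hy mx my; have mxy := mneg_bracket mx my.
rewrite (borel_word_cons _ _ (homog_bracket hx hy)) !(borel_word_cons _ _ hx).
rewrite !(borel_word_cons _ _ hy) !(mp_id mx) !(mp_id my) (mp_id mxy).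
rewrite !(borel_word_cons _ _ hx) !(mp_id mx) !Lop_D.
have e1 : th a (pe_bracket t y) = (-1) ^+ (a && b) *: pe_bracket (th a t) y.
  by rewrite th_bracket (th_homog a hy) bracketZr.
have e2 : th b (pe_bracket t x) = (-1) ^+ (a && b) *: pe_bracket (th b t) x.
  by rewrite th_bracket (th_homog b hx) bracketZr andbC.
set s := (-1) ^+ (a && b) in e1 e2 *.
have sK (v : Uneg) : s *: (s *: v) = v by exact: sign_cancel.
have sK' (z : pe) : s *: (s *: z) = z by exact: sign_cancel.
have eJ : pe_bracket t (pe_bracket x y)
    = pe_bracket (mp (pe_bracket t x)) y + pe_bracket (bp (pe_bracket t x)) y
      - s *: (pe_bracket (mp (pe_bracket t y)) x + pe_bracket (bp (pe_bracket t y)) x).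
  rewrite (pe_jacobi t hx hy). rewrite bracket_mp_bp. rewrite bracket_mp_bp. congr (_ + _).
  rewrite -[RHS]scaleNr. rewrite -[LHS]opprK. by rewrite -(bracket_antisym _ hx) th_bracket thK (th_homog a hy)
             bracketZr bracketZl scaleNr.
(* The negative components of [t,x] and [t,y] drop out, since their brackets with y and x are again
   negative. *)
have eB : bp (pe_bracket t (pe_bracket x y))
    = bp (pe_bracket (bp (pe_bracket t x)) y) - s *: bp (pe_bracket (bp (pe_bracket t y)) x).
  rewrite eJ bracket_mp_bp bracket_mp_bp bpD -[- (s *: _)]scaleNr bpZ scaleNr.
  by rewrite (bp_bracket_bp _ mx) (bp_bracket_bp _ my).
rewrite eB eJ (Lop_bracket _ hx hy mx my) -/s -!Lop_word.
rewrite !(Lop_comm _ _ hx mx) !(Lop_comm _ _ hy my) e1 e2.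
rewrite -!bp_th e1 e2 !bpZ borel_wordB !borel_wordZ LopB.
rewrite !th_add [b (+) a]addbC !LopZ !LopD !Lop_Z !scalerDr !sK.
zmod.
Qed.

Lemma compat_borel_word t : compat (fun w => borel_word w t).
Proof.
have [W1 W2 W3] := compat_word Uneg.
split=> [p c x y s|p x s bx|p a b x y s hx hy mx my]; elim: p t => [|z p IH] t /=.
- rewrite !borel_wordE !pe_compP mp_linear pe_bracket_linr bp_linear borel_wordP !LopP.
  by rewrite !scalerDr; zmod.
- by rewrite !borel_wordE !IH W1 !Lop_D !Lop_Z !scalerDr; zmod.
- rewrite borel_wordE (mp_borel bx) bracket0r bp0 borel_word0 Lop0.
  by rewrite !Lop_borel ?addr0 //; exact: borel_comp.
- by rewrite !borel_wordE !IH (W2 _ _ _ bx) !Lop_0 !addr0.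
- exact: borel_word_bracket.
rewrite !borel_wordE !IH (W3 _ a b) // !Lop_B !Lop_Z !scalerDr.
by zmod.
Qed.

Definition Bop (b : pe) : Uneg -> Uneg := lift (fun w => borel_word w b).
Lemma Bop_word b w : Bop b (word w) = borel_word w b.
Proof. by rewrite /Bop lift_word //; exact: compat_borel_word. Qed.
Lemma Bop_linear b c u v : Bop b (c *: u + v) = c *: Bop b u + Bop b v.
Proof. by apply: liftP; exact: compat_borel_word. Qed.
HB.instance Definition _ b := GRing.isLinear.Build C Uneg Uneg *:%R (Bop b) (Bop_linear b).
Lemma Bop_Z b c v : Bop b (c *: v) = c *: Bop b v.
Proof. exact: linearZ. Qed.
Lemma Bop_0 b : Bop b 0 = 0.
Proof. exact: linear0. Qed.
Lemma BopP c x y v : Bop (c *: x + y) v = c *: Bop x v + Bop y v.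
Proof.
elim/Uneg_span: v => [|d u v IHu IHv|w]; first by rewrite !Bop_0 scaler0 addr0.
  by rewrite !Bop_linear IHu IHv !scalerDr !scalerA mulrC; zmod.
by rewrite !Bop_word borel_wordP.
Qed.
Lemma BopD x y v : Bop (x + y) v = Bop x v + Bop y v.
Proof. by rewrite -[x in LHS]scale1r BopP scale1r. Qed.
Lemma Bop0 v : Bop 0 v = 0.
Proof. by apply: (@addrI _ (Bop 0 v)); rewrite -BopD !addr0. Qed.

Lemma Bop_L a x y v : homog a y -> mneg y ->
  Bop x (Lop y v) = Lop y (Bop (th a x) v)
    + (Lop (pe_bracket x y) v + Bop (bp (pe_bracket x y)) v).
Proof.
move=> hy my; elim/Uneg_span: v => [|d u v IHu IHv|w].
- by rewrite !(Lop_0, Bop_0) !addr0.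
- by rewrite !(Lop_linear, Bop_linear) IHu IHv !scalerDr; zmod.
by rewrite Lop_word !Bop_word (borel_word_cons _ _ hy) mp_id.
Qed.

Lemma Uneg_ind (P : Uneg -> Prop) : P 0 ->
  (forall c u v, P u -> P v -> P (c *: u + v)) -> P (word [::]) ->
  (forall a y v, homog a y -> mneg y -> P v -> P (Lop y v)) -> forall v, P v.
Proof.
move=> P0 Pl P1 Py; apply: Uneg_span => //; elim=> [//|x w IH].
rewrite -Lop_word -Lop_mp -(pe_compE (mp x)) LopD -[Lop _ _]scale1r.
by apply: (Pl); apply: Py (homog_comp _ _) _ IH; apply/mneg_comp/mp_mneg.
Qed.

Fact Aop_key : unit. Proof. by []. Qed.
(** The action of x = [mp x] + [bp x]; the first summand needs no projection, as [Lop] vanishes on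
    the Borel subalgebra. *)
Definition Aop : pe -> Uneg -> Uneg :=
  locked_with Aop_key (fun x v => Lop x v + Bop (bp x) v).
Lemma AopE x v : Aop x v = Lop x v + Bop (bp x) v.
Proof. by rewrite /Aop unlock. Qed.

Lemma Aop_linear x c u v : Aop x (c *: u + v) = c *: Aop x u + Aop x v.
Proof. by rewrite !AopE Lop_linear Bop_linear scalerDr; zmod. Qed.
Lemma AopP c x y v : Aop (c *: x + y) v = c *: Aop x v + Aop y v.
Proof. by rewrite !AopE LopP bp_linear BopP scalerDr; zmod. Qed.
Lemma AopD x y v : Aop (x + y) v = Aop x v + Aop y v.
Proof. by rewrite -[x in LHS]scale1r AopP scale1r. Qed.
Lemma Aop0 v : Aop 0 v = 0.
Proof. by apply: (@addrI _ (Aop 0 v)); rewrite -AopD !addr0. Qed.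
Lemma AopZ c x v : Aop (c *: x) v = c *: Aop x v.
Proof. by rewrite -[c *: x]addr0 AopP Aop0 addr0. Qed.
Lemma Aop_0 x : Aop x 0 = 0.
Proof. by rewrite !AopE Lop_0 Bop_0 addr0. Qed.
Lemma Aop_D x u v : Aop x (u + v) = Aop x u + Aop x v.
Proof. by rewrite -[u in LHS]scale1r Aop_linear scale1r. Qed.
Lemma Aop_Z x c v : Aop x (c *: v) = c *: Aop x v.
Proof. by rewrite -[c *: v]addr0 Aop_linear Aop_0 addr0. Qed.

Lemma Aop_mneg y v : mneg y -> Aop y v = Lop y v.
Proof. by move=> my; rewrite !AopE bp_mneg // Bop0 addr0. Qed.
Lemma Aop_borel x v : borel x -> Aop x v = Bop x v.
Proof. by move=> bx; rewrite !AopE bp_id // Lop_borel // add0r. Qed.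

Definition supercomm v := forall a x y, homog a y ->
  Aop x (Aop y v) = Aop y (Aop (th a x) v) + Aop (pe_bracket x y) v.

Lemma Aop_comm_mneg a x y v : homog a y -> mneg y ->
  Aop x (Aop y v) = Aop y (Aop (th a x) v) + Aop (pe_bracket x y) v.
Proof.
move=> hy my; rewrite !(Aop_mneg _ my) !AopE (Lop_comm _ _ hy my) (Bop_L _ _ hy my).
rewrite -(Lop_mp (pe_bracket x y)) -(bracket_mp_bp x y) mpD bpD.
have mxy := mneg_bracket (mp_mneg x) my.
by rewrite (mp_id mxy) (bp_mneg mxy) add0r !LopD Lop_D bp_th Lop_mp; zmod.
Qed.

Lemma Aop_comm_homog a b x y v : homog a x -> homog b y ->
  Aop y (Aop x v) = Aop x (Aop (th a y) v) + Aop (pe_bracket y x) v ->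
  Aop x (Aop y v) = Aop y (Aop (th b x) v) + Aop (pe_bracket x y) v.
Proof.
move=> hx hy; rewrite !(th_homog _ hx) !(th_homog _ hy) !AopZ !Aop_Z => ->.
have e : (-1) ^+ (a && b) *: pe_bracket y x = - pe_bracket x y.
  by rewrite -bracketZl -(th_homog a hy) (bracket_antisym _ hx).
rewrite [b && a]andbC scalerDr sign_cancel -[_ *: Aop (pe_bracket y x) v]AopZ e.
by rewrite -[- _]scaleN1r AopZ scaleN1r addrNK.
Qed.

(** If one of the two elements is negative, the relation holds by the definition of the action,
    possibly after exchanging the two. Only pairs of Borel elements remain. *)
Lemma supercommP v :
  (forall a x y, borel x -> homog a y -> borel y ->
    Aop x (Aop y v) = Aop y (Aop (th a x) v) + Aop (pe_bracket x y) v) ->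
  supercomm v.
Proof.
move=> H a x y hy.
rewrite -(mp_bp x) -(mp_bp y).
have hm := homog_mp hy; have hb := homog_bp hy.
rewrite bracketDr !pe_bracketDl thD !AopD !Aop_D.
rewrite !(Aop_comm_mneg _ _ hm (mp_mneg y)) (H a (bp x)) //; try exact: bp_borel.
have -> : Aop (mp x) (Aop (bp y) v) = Aop (bp y) (Aop (th a (mp x)) v) + Aop (pe_bracket (mp x) (bp y)) v.
  rewrite -(pe_compE (mp x)) thD !AopD Aop_D pe_bracketDl AopD.
  rewrite !(Aop_comm_homog (homog_comp _ _) hb (Aop_comm_mneg _ _ (homog_comp _ _) (mneg_comp _ (mp_mneg x)))).
  by zmod.
by zmod.
Qed.

(** Induction on v for all pairs at once. On the highest weight vector the relation holds because
    the weight is a character. On y v both Borel elements are moved past y, the relation for v is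
    applied to the resulting pairs, and the terms match by the Jacobi identity. *)
Lemma supercomm_all v : supercomm v.
Proof.
elim/Uneg_ind: v => [|c u v IHu IHv||c y v hy my IH].
- by move=> a x y hy; rewrite !Aop_0 addr0.
- move=> a x y hy; rewrite !Aop_linear (IHu a x y hy) (IHv a x y hy) !scalerDr.
  by zmod.
- apply: supercommP => a x y bx hy by_.
  rewrite !(Aop_borel _ by_) !(Aop_borel _ bx) (Aop_borel _ (borel_th _ bx)).
  rewrite (Aop_borel _ (borel_bracket bx by_)) !Bop_word !borel_word_nil !Bop_Z !Bop_word !borel_word_nil.
  by rewrite weight_val_bracket // weight_val_th scale0r addr0 !scalerA mulrC.
apply: supercommP => d b b' bb hb' bb'.
rewrite -!(Aop_mneg _ my).
have E x w : Aop x (Aop y w) = Aop y (Aop (th c x) w) + Aop (pe_bracket x y) w.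
  exact: Aop_comm_mneg.
rewrite !E !Aop_D !E.
have hz : homog (d (+) c) (pe_bracket b' y) by exact: homog_bracket.
rewrite (IH _ _ _ (homog_th c hb')) (IH _ (b) _ hz) (pe_jacobi _ hb' hy).
have hq : th d (pe_bracket b y) = (-1) ^+ (c && d) *: pe_bracket (th d b) y.
  by rewrite th_bracket (th_homog d hy) bracketZr andbC.
have hq' : pe_bracket (pe_bracket b y) (th c b') = - pe_bracket b' (pe_bracket (th d b) y).
  rewrite -(bracket_antisym _ hb') th_bracket thK (th_homog d hy) bracketZr bracketZl.
  by rewrite (th_homog c hb') bracketZr andbC.
rewrite [Aop (pe_bracket b y) _](IH _ _ _ (homog_th c hb')) hq hq'.
rewrite (th_homog c hb') !AopZ !Aop_Z sign_cancel !Aop_D.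
rewrite !th_bracket (th_homog c hb') !bracketZr.
rewrite !AopZ !Aop_Z !AopD !th_add [d (+) c]addbC.
by rewrite -[- pe_bracket _ _]scaleN1r AopZ scaleN1r; zmod.
Qed.

Definition Upar : Uneg -> Uneg := lift (fun w => word (map (@pe_theta C n) w)).

Lemma compat_par : compat (fun w => word (map (@pe_theta C n) w)).
Proof.
have [W1 W2 W3] := compat_word Uneg.
split=> [p c x y s|p x s bx|p a b x y s hx hy mx my]; rewrite !map_cat /=.
- by rewrite pe_theta_linear W1.
- by rewrite W2 //; have := borel_th true bx; rewrite thE.
rewrite pe_theta_bracket (W3 _ a b) //.
- by have := homog_th true hx; rewrite thE.
- by have := homog_th true hy; rewrite thE.
- by have := mneg_th true mx; rewrite thE.
- by have := mneg_th true my; rewrite thE.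
Qed.
Lemma Upar_word w : Upar (word w) = word (map (@pe_theta C n) w).
Proof. by rewrite /Upar lift_word //; exact: compat_par. Qed.
Lemma Upar_linear c u v : Upar (c *: u + v) = c *: Upar u + Upar v.
Proof. by apply: liftP; exact: compat_par. Qed.
HB.instance Definition _ := GRing.isLinear.Build C Uneg Uneg *:%R Upar Upar_linear.
Lemma Upar_D u v : Upar (u + v) = Upar u + Upar v.
Proof. exact: linearD. Qed.
Lemma Upar_Z c v : Upar (c *: v) = c *: Upar v.
Proof. exact: linearZ. Qed.
Lemma Upar0 : Upar 0 = 0.
Proof. exact: linear0. Qed.

Lemma Upar_Lop x v : Upar (Lop x v) = Lop (pe_theta x) (Upar v).
Proof.
elim/Uneg_span: v => [|d u v IHu IHv|w].
- by rewrite Lop_0 Upar0 Lop_0.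
- by rewrite Lop_linear !Upar_linear Lop_linear IHu IHv.
by rewrite Lop_word !Upar_word Lop_word.
Qed.

Lemma UparK : involutive Upar.
Proof.
elim/Uneg_span => [|d u v IHu IHv|w].
- by rewrite !Upar0.
- by rewrite !Upar_linear IHu IHv.
by rewrite !Upar_word -map_comp map_id_in // => x _ /=; rewrite pe_thetaK.
Qed.

Lemma Upar_Bop v : forall b, Upar (Bop b v) = Bop (pe_theta b) (Upar v).
Proof.
elim/Uneg_ind: v => [|d u v IHu IHv||a y v hy my IH] b.
- by rewrite Bop_0 Upar0 Bop_0.
- by rewrite Bop_linear !Upar_linear Bop_linear IHu IHv.
- rewrite Bop_word borel_word_nil Upar_Z !Upar_word /= Bop_word borel_word_nil.
  by have := weight_val_th lam true b; rewrite thE => ->.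
have hy' : homog a (pe_theta y) by have := homog_th true hy; rewrite thE.
have my' : mneg (pe_theta y) by have := mneg_th true my; rewrite thE.
rewrite (Bop_L _ _ hy my) !Upar_D !Upar_Lop (Bop_L _ _ hy' my') !IH.
by rewrite -th_theta -bp_theta -pe_theta_bracket.
Qed.

Lemma Upar_Aop x v : Upar (Aop x v) = Aop (pe_theta x) (Upar v).
Proof. by rewrite !AopE Upar_D Upar_Lop Upar_Bop bp_theta. Qed.

Definition Uneg_smod : smod C n.
Proof.
refine (@Smod C n Uneg Aop Upar AopP Aop_linear _ Upar_linear UparK _).
- move=> a b x y v hx hy; rewrite (supercomm_all v x hy) (th_homog b hx) AopZ Aop_Z andbC.
  by rewrite addrC addKr.
by move=> a x v hx; rewrite Upar_Aop (homog_theta hx) AopZ.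
Defined.

End VermaModel.

Transparent pe_bracket pe_comp pe_theta bp mp th.

Section VermaFree.
Context (C : numClosedFieldType) (n : nat) (lam : 'rV[C]_n).
Local Notation pe := (pe C n).

(* The Verma module is free of rank one over the enveloping algebra of [mneg]. *)
Theorem verma_free (N : lmodType C) (l : pe -> N -> N) (w0 : N) :
  (forall c x y v, l (c *: x + y) v = c *: l x v + l y v) ->
  (forall x c u v, l x (c *: u + v) = c *: l x u + l x v) ->
  (forall a b x y v, homog a x -> homog b y -> mneg x -> mneg y ->
    l (pe_bracket x y) v = l x (l y v) - (-1) ^+ (a && b) *: l y (l x v)) ->
  exists g : {linear verma lam -> N},
    g (verma_gen lam) = w0 /\ forall y v, mneg y -> g (act y v) = l y (g v).
Proof.
move=> l1 l2 l3; pose U := Uneg_model C n; pose M := Uneg_smod U lam.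
(* The universal property maps the Verma module to the model carried by the enveloping algebra.
   There a linear map is given by its values on words, which allows a target N that is a module over
   the negative part only. *)
have [f f1 _] : exists2 f : shom (verma lam) M, f (verma_gen lam) = @word _ _ U [::] &
    forall g : shom (verma lam) M, g (verma_gen lam) = @word _ _ U [::] -> g =1 f.
  apply: verma_universal => x bx; rewrite [LHS](Aop_borel lam _ bx).
  by rewrite Bop_word borel_word_nil.
pose phi (w : seq pe) : N := foldr (fun x => l (mp x)) w0 w.
have l0 v : l 0 v = 0.
  by have := l1 (-1) 0 0 v; rewrite scaler0 addr0 scaleN1r addNr.
have l0' x : l x 0 = 0.
  by have := l2 x (-1) 0 0; rewrite scaler0 addr0 scaleN1r addNr.
have cphi : compat phi.
  split=> [p c x y s|p x s bx|p a b x y s hx hy mx my]; elim: p => [|z p IH] /=.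
  - by rewrite mp_linear l1.
  - by rewrite IH l2.
  - by rewrite mp_borel // l0.
  - by rewrite IH l0'.
  - by rewrite !mp_id ?(l3 a b) //; exact: mneg_bracket.
  by rewrite IH addrC -scaleNr l2 scaleNr addrC.
pose g (v : verma lam) : N := lift phi (f v : U).
have gl c (u v : verma lam) : g (c *: u + v) = c *: g u + g v.
  by rewrite /g linearP liftP.
exists (HB.pack_for {linear verma lam -> N} g (GRing.isLinear.Build C (verma lam) N *:%R g gl)).
split=> [|y v my].
  by rewrite -[LHS]/(g _) /g f1 lift_word.
rewrite -[LHS]/(g _) -[X in l y X]/(g v) /g.
rewrite shom_act; move: (f v) => u.
rewrite -[LHS]/(lift phi (Aop lam y (u : U))) -[X in l y X]/(lift phi (u : U)).
rewrite (Aop_mneg lam _ my).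
have lift0 : lift phi (0 : U) = 0.
  by have := liftP cphi (-1) (0 : U) 0; rewrite scaler0 addr0 scaleN1r addNr.
elim/(@word_span C n U): u => [|c u u' IHu IHu'|w].
- by rewrite Lop_0 lift0 l0'.
- by rewrite Lop_linear !liftP // l2 IHu IHu'.
by rewrite Lop_word !lift_word //= mp_id.
Qed.
End VermaFree.

(** * Induction principles for Verma modules *)

Section VermaInduction.
Context (C : numClosedFieldType) (n : nat) (lam : 'rV[C]_n).
Local Notation pe := (pe C n).
Local Notation V := (verma lam).
Local Notation v0 := (verma_gen lam).

Lemma verma_borel (x : pe) : borel x -> act x v0 = weight_val lam x *: v0.
Proof.
move=> bx; rewrite /= /verma_gen verma_actE.
rewrite -[RHS]/(quot_scale _ (proj _ _)) -projZ; apply/verma_projP; rewrite mulr1.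
by have := verma_rel_borel lam 1 bx; rewrite mul1r.
Qed.

Lemma par_verma_gen : par v0 = v0.
Proof. by rewrite /= /verma_gen verma_parE T_par1. Qed.

Lemma verma_span (P : V -> Prop) :
  (forall c u v, P u -> P v -> P (c *: u + v)) -> P v0 ->
  (forall x v, P v -> P (act x v)) -> forall v, P v.
Proof.
move=> Pl P1 Pa.
have P0 : P 0 by have := Pl (-1) _ _ P1 P1; rewrite scaleN1r addNr.
elim/projW=> f; elim/T_ind: f => [|c f g IHf IHg|s].
- by rewrite proj0.
- by rewrite proj_is_linear; apply: Pl.
elim: s => [|x s IH]; first by rewrite -T1E.
by rewrite -[x :: s]cat1s -genM -genE; have := Pa x _ IH; rewrite /= verma_actE.
Qed.

Inductive neg_span : V -> Prop :=
| neg_span_gen : neg_span v0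
| neg_spanP c u v of neg_span u & neg_span v : neg_span (c *: u + v)
| neg_span_act a y v of homog a y & mneg y & neg_span v : neg_span (act y v).

Lemma neg_spanD u v : neg_span u -> neg_span v -> neg_span (u + v).
Proof. by move=> hu hv; rewrite -[u]scale1r; exact: neg_spanP. Qed.

Lemma neg_span_mneg y v : mneg y -> neg_span v -> neg_span (act y v).
Proof.
move=> my hv; rewrite -(pe_compE y) actDl.
by apply: neg_spanD; apply: neg_span_act (homog_comp _ _) (mneg_comp _ my) hv.
Qed.

(** A Borel element is moved to the right through the negative letters until it meets the highest
    weight vector. It is generalised in the inner induction, because each passage twists it by [th]
    and produces a bracket. *)
Lemma neg_span_all v : neg_span v.
Proof.
elim/verma_span: v => [c u v||x v hv]; [exact: neg_spanP|exact: neg_span_gen|].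
rewrite -(mp_bp x) actDl; apply: neg_spanD; first exact: neg_span_mneg (mp_mneg _) hv.
move: (bp x) (bp_borel x) => {}x bx; elim: hv x bx => [|c u w hu IHu hw IHw|a y w hy my hw IH] x bx.
(* [neg_span] has no constructor for zero, which is therefore written as -v0 + v0. *)
- rewrite verma_borel // -[_ *: _]addr0 -[X in _ + X](addNr v0) -scaleN1r.
  by do !apply: neg_spanP; exact: neg_span_gen.
- by rewrite linearP /=; apply: neg_spanP; [exact: IHu|exact: IHw].
rewrite (act_comm _ _ hy) -[pe_bracket x y]mp_bp actDl.
apply: neg_spanD; first by apply: neg_span_act hy my _; exact: IH (borel_th _ bx).
apply: neg_spanD; first exact: neg_span_mneg (mp_mneg _) hw.
exact: IH (bp_borel _).
Qed.

Lemma verma_ind (P : V -> Prop) :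
  (forall c u v, P u -> P v -> P (c *: u + v)) -> P v0 ->
  (forall a y v, homog a y -> mneg y -> P v -> P (act y v)) -> forall v, P v.
Proof.
move=> Pl P1 Py v; elim: (neg_span_all v) => // [c u w _ Pu _ Pw|a y w hy my _ Pw].
  exact: Pl.
exact: Py hy my Pw.
Qed.

End VermaInduction.

(* Stated for an abstract pair (V, v0), since unification against the concrete
   [verma] unfolds its quotient construction. *)
Record verma_spec (C : numClosedFieldType) (n : nat) (lam : 'rV[C]_n)
    (V : smod C n) (v0 : V) : Prop := VermaSpec {
  vs_borel : forall x : pe C n, borel x -> act x v0 = weight_val lam x *: v0;
  vs_par : par v0 = v0;
  vs_span : forall P : V -> Prop, (forall c u v, P u -> P v -> P (c *: u + v)) ->
    P v0 -> (forall x v, P v -> P (act x v)) -> forall v, P v;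
  vs_ind : forall P : V -> Prop, (forall c u v, P u -> P v -> P (c *: u + v)) ->
    P v0 -> (forall a y v, homog a y -> mneg y -> P v -> P (act y v)) -> forall v, P v;
  vs_free : forall (N : lmodType C) (l : pe C n -> N -> N) (w0 : N),
    (forall c x y v, l (c *: x + y) v = c *: l x v + l y v) ->
    (forall x c u v, l x (c *: u + v) = c *: l x u + l x v) ->
    (forall a b x y v, homog a x -> homog b y -> mneg x -> mneg y ->
      l (pe_bracket x y) v = l x (l y v) - (-1) ^+ (a && b) *: l y (l x v)) ->
    exists g : {linear V -> N},
      g v0 = w0 /\ forall y v, mneg y -> g (act y v) = l y (g v);
  vs_universal : forall (N : smod C n) (w0 : N),
    (forall x, borel x -> act x w0 = weight_val lam x *: w0) ->
    exists f : shom V N, f v0 = w0 }.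

Lemma vermaP (C : numClosedFieldType) (n : nat) (lam : 'rV[C]_n) :
  verma_spec lam (verma_gen lam).
Proof.
split; [exact: verma_borel|exact: par_verma_gen|exact: verma_span|exact: verma_ind| |].
  exact: verma_free.
by move=> N w0 hw; have [f f0 _] := verma_universal hw; exists f.
Qed.

(** * Root vectors *)

Section Roots.
Context (C : numClosedFieldType) (n : nat).
Local Notation pe := (pe C n).
Implicit Types (x y h : pe).

(** Root vectors for eps_i - eps_j, eps_i + eps_j and -(eps_i + eps_j). Both orders of i and j are
    kept: [sB] is symmetric and [cD] antisymmetric in them, with [cD i i] = 0. *)
Definition eE (i j : 'I_n) : pe := mkpe (delta_mx i j) 0 0.
Definition sB (i j : 'I_n) : pe := mkpe 0 (delta_mx i j) 0.
Definition cD (i j : 'I_n) : pe := mkpe 0 0 (delta_mx i j).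

Lemma ul_eE i j : ul (eE i j) = delta_mx i j. Proof. exact: ul_mkpe. Qed.
Lemma ur_eE i j : ur (eE i j) = 0. Proof. by rewrite ur_mkpe trmx0 addr0. Qed.
Lemma dl_eE i j : dl (eE i j) = 0. Proof. by rewrite dl_mkpe trmx0 subr0. Qed.
Lemma ul_sB i j : ul (sB i j) = 0. Proof. exact: ul_mkpe. Qed.
Lemma ur_sB i j : ur (sB i j) = delta_mx i j + delta_mx j i.
Proof. by rewrite ur_mkpe trmx_delta. Qed.
Lemma dl_sB i j : dl (sB i j) = 0. Proof. by rewrite dl_mkpe trmx0 subr0. Qed.
Lemma ul_cD i j : ul (cD i j) = 0. Proof. exact: ul_mkpe. Qed.
Lemma ur_cD i j : ur (cD i j) = 0. Proof. by rewrite ur_mkpe trmx0 addr0. Qed.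
Lemma dl_cD i j : dl (cD i j) = delta_mx i j - delta_mx j i.
Proof. by rewrite dl_mkpe trmx_delta. Qed.

Lemma homog_eE i j : homog false (eE i j).
Proof. by apply/homogE; rewrite ur_eE dl_eE. Qed.
Lemma homog_sB i j : homog true (sB i j).
Proof. by apply/homogE; rewrite ul_sB. Qed.
Lemma homog_cD i j : homog true (cD i j).
Proof. by apply/homogE; rewrite ul_cD. Qed.

Lemma mneg_eE (i j : 'I_n) : (j < i)%N -> mneg (eE i j).
Proof.
move=> ji; split; first exact: ur_eE.
move=> k l kl; rewrite ul_eE mxE; case: eqP => //= ek; case: eqP => //= el.
by move: kl; rewrite ek el leqNgt ji.
Qed.
Lemma mneg_cD i j : mneg (cD i j).
Proof. by split; rewrite ?ur_cD // => k l _; rewrite ul_cD mxE. Qed.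
Lemma borel_eE (i j : 'I_n) : (i <= j)%N -> borel (eE i j).
Proof.
move=> ij; apply/borelE; split; first exact: dl_eE.
move=> k l kl; rewrite ul_eE mxE; case: eqP => //= ek; case: eqP => //= el.
by move: kl; rewrite ek el ltnNge ij.
Qed.
Lemma borel_sB i j : borel (sB i j).
Proof. by apply/borelE; split; rewrite ?dl_sB // => k l _; rewrite ul_sB mxE. Qed.

Lemma ulD x y : ul (x + y) = ul x + ul y.
Proof. by rewrite -[x in LHS]scale1r ulP scale1r. Qed.
Lemma urD x y : ur (x + y) = ur x + ur y.
Proof. by rewrite -[x in LHS]scale1r urP scale1r. Qed.
Lemma dlD x y : dl (x + y) = dl x + dl y.
Proof. by rewrite -[x in LHS]scale1r dlP scale1r. Qed.
Lemma ul0 : ul (0 : pe) = 0. Proof. by rewrite -(subrr (0 : pe)) ulB subrr. Qed.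
Lemma ur0 : ur (0 : pe) = 0. Proof. by rewrite -(subrr (0 : pe)) urB subrr. Qed.
Lemma dl0 : dl (0 : pe) = 0. Proof. by rewrite -(subrr (0 : pe)) dlB subrr. Qed.
Lemma ulZ c x : ul (c *: x) = c *: ul x.
Proof. by rewrite -[c *: x]addr0 ulP ul0 addr0. Qed.
Lemma urZ c x : ur (c *: x) = c *: ur x.
Proof. by rewrite -[c *: x]addr0 urP ur0 addr0. Qed.
Lemma dlZ c x : dl (c *: x) = c *: dl x.
Proof. by rewrite -[c *: x]addr0 dlP dl0 addr0. Qed.
Lemma ul_sum (I : Type) (r : seq I) (F : I -> pe) : ul (\sum_(i <- r) F i) = \sum_(i <- r) ul (F i).
Proof. by elim: r => [|i r IH]; rewrite ?big_nil ?big_cons ?ul0 // ulD IH. Qed.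
Lemma ur_sum (I : Type) (r : seq I) (F : I -> pe) : ur (\sum_(i <- r) F i) = \sum_(i <- r) ur (F i).
Proof. by elim: r => [|i r IH]; rewrite ?big_nil ?big_cons ?ur0 // urD IH. Qed.
Lemma dl_sum (I : Type) (r : seq I) (F : I -> pe) : dl (\sum_(i <- r) F i) = \sum_(i <- r) dl (F i).
Proof. by elim: r => [|i r IH]; rewrite ?big_nil ?big_cons ?dl0 // dlD IH. Qed.

(** Each unordered pair occurs twice in the double sum, whence the factor 1/2. The signs s = 1 and s
    = -1 serve for the blocks [ur] and [dl]. *)
Lemma sym_sum_delta (s : C) (B : 'M[C]_n) :
  \sum_i \sum_j ((2^-1 * B i j) *: (delta_mx i j + s *: delta_mx j i))
  = 2^-1 *: (B + s *: B^T).
Proof.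
pose D : 'M[C]_n := \sum_i \sum_j B i j *: delta_mx i j.
have -> : 2^-1 *: (B + s *: B^T) = 2^-1 *: (D + s *: D^T) by rewrite /D -matrix_sum_delta.
rewrite /D raddf_sum scaler_sumr -big_split scaler_sumr; apply: eq_bigr => i _ /=.
rewrite raddf_sum scaler_sumr -big_split scaler_sumr; apply: eq_bigr => j _ /=.
by rewrite linearZ /= trmx_delta -scalerA scalerDr !scalerA [s * _]mulrC -!scalerA -scalerDr.
Qed.

Lemma pe_basisE x : x = \sum_i \sum_j (ul x i j *: eE i j
  + (2^-1 * ur x i j) *: sB i j + (2^-1 * dl x i j) *: cD i j).
Proof.
apply: pe_ext.
- rewrite ul_sum [LHS]matrix_sum_delta; apply: eq_bigr => i _.
  rewrite ul_sum; apply: eq_bigr => j _.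
  by rewrite !ulD !ulZ ul_eE ul_sB ul_cD !scaler0 !addr0.
- transitivity (2^-1 *: (ur x + 1 *: (ur x)^T)).
    by rewrite scale1r tr_ur scalerDr -scalerDl -[2^-1]div1r -splitr scale1r.
  rewrite -sym_sum_delta ur_sum; apply: eq_bigr => i _; rewrite ur_sum.
  apply: eq_bigr => j _; rewrite !urD !urZ ur_eE ur_sB ur_cD !scaler0 addr0 add0r.
  by rewrite scale1r.
- transitivity (2^-1 *: (dl x + (-1) *: (dl x)^T)).
    by rewrite scaleN1r tr_dl opprK scalerDr -scalerDl -[2^-1]div1r -splitr scale1r.
  rewrite -sym_sum_delta dl_sum; apply: eq_bigr => i _; rewrite dl_sum.
  apply: eq_bigr => j _; rewrite !dlD !dlZ dl_eE dl_sB dl_cD !scaler0 !add0r.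
  by rewrite scaleN1r.
Qed.

Lemma pe_span (P : pe -> Prop) : (forall c x y, P x -> P y -> P (c *: x + y)) -> P 0 ->
  (forall i j, P (eE i j)) -> (forall i j, P (sB i j)) -> (forall i j, P (cD i j)) ->
  forall x, P x.
Proof.
move=> Pl P0 PE PB PD x; rewrite (pe_basisE x).
have PDd u v : P u -> P v -> P (u + v) by move=> hu hv; rewrite -[u]scale1r; exact: Pl.
have PZ c u : P u -> P (c *: u) by move=> hu; rewrite -[c *: u]addr0; exact: Pl.
elim/big_ind: _ => // i _; elim/big_ind: _ => // j _.
by apply: (PDd); [apply: (PDd)|]; apply: PZ.
Qed.

Lemma mneg_span (P : pe -> Prop) : (forall c x y, P x -> P y -> P (c *: x + y)) -> P 0 ->
  (forall i j : 'I_n, (j < i)%N -> P (eE i j)) -> (forall i j, P (cD i j)) ->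
  forall x, mneg x -> P x.
Proof.
move=> Pl P0 PE PD x [h1 h2]; rewrite (pe_basisE x).
have PDd u v : P u -> P v -> P (u + v) by move=> hu hv; rewrite -[u]scale1r; exact: Pl.
have PZ c u : P u -> P (c *: u) by move=> hu; rewrite -[c *: u]addr0; exact: Pl.
elim/big_ind: _ => // i _; elim/big_ind: _ => // j _.
have h1' : ur x i j = 0 by rewrite h1 mxE.
rewrite h1' mulr0 scale0r addr0; apply: (PDd); last exact: PZ.
by case: (ltnP j i) => ij; [apply/PZ/PE|rewrite h2 // scale0r].
Qed.

Definition epsw (i : 'I_n) : 'rV[C]_n := delta_mx 0 i.

Lemma weight_val_eps i h : weight_val (epsw i) h = ul h i i.
Proof.
rewrite weight_valE (bigD1 i) //= mxE !eqxx mul1r big1 ?addr0 // => j ji.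
by rewrite mxE eqxx (negPf ji) mul0r.
Qed.
Lemma weight_valD (g1 g2 : 'rV[C]_n) h :
  weight_val (g1 + g2) h = weight_val g1 h + weight_val g2 h.
Proof. by rewrite !weight_valE -big_split; apply: eq_bigr => i _; rewrite mxE mulrDl. Qed.
Lemma weight_valN (g : 'rV[C]_n) h : weight_val (- g) h = - weight_val g h.
Proof. by rewrite !weight_valE -sumrN; apply: eq_bigr => i _; rewrite mxE mulNr. Qed.

Lemma cartanE h : cartan h ->
  exists d, [/\ ul h = diag_mx d, ur h = 0 & dl h = 0].
Proof.
move=> ch; have e (i j : 'I_(n + n)) : val i != val j -> (h : 'M_(n + n)) i j = 0.
  by move: ch => /is_diag_mxP; apply.
exists (\row_i ul h i i); split; apply/matrixP => i j.
- rewrite !mxE; case: eqP => [-> //|ne]; rewrite mulr0n.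
  by apply: e => /=; apply/eqP => /val_inj.
- rewrite !mxE; apply: e; rewrite /= ltn_eqF //; exact: ltn_addr.
- rewrite !mxE; apply: e; rewrite /= gtn_eqF //; exact: ltn_addr.
Qed.

Lemma cartan_borel h : cartan h -> borel h.
Proof.
case/cartanE => d [e1 e2 e3]; apply/borelE; split=> // i j ij.
by rewrite e1 mxE -val_eqE /= gtn_eqF ?mulr0n // .
Qed.
Lemma cartan_homog h : cartan h -> homog false h.
Proof. by case/cartanE => d [e1 e2 e3]; apply/homogE. Qed.

Definition rootv (g : 'rV[C]_n) x := forall h, cartan h -> pe_bracket h x = weight_val g h *: x.

Lemma diag_mx_diag (d : 'rV[C]_n) i : diag_mx d i i = d 0 i.
Proof. by rewrite mxE eqxx mulr1n. Qed.

Lemma diag_delta (d : 'rV[C]_n) (i j : 'I_n) :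
  diag_mx d *m delta_mx i j = d 0 i *: delta_mx i j.
Proof.
apply/matrixP => k l; rewrite mul_diag_mx !mxE.
by case: (k =P i) => [->|] //=; rewrite !mulr0.
Qed.
Lemma delta_diag (d : 'rV[C]_n) (i j : 'I_n) :
  delta_mx i j *m diag_mx d = d 0 j *: delta_mx i j.
Proof.
apply/matrixP => k l; rewrite mul_mx_diag !mxE mulrC.
by case: (l =P j) => [->|] //=; rewrite ?andbF !mulr0.
Qed.

Lemma rootv_eE i j : rootv (epsw i - epsw j) (eE i j).
Proof.
move=> h /cartanE[d [e1 e2 e3]]; rewrite weight_valD weight_valN !weight_val_eps.
apply: pe_ext.
- rewrite ul_bracket e2 e3 ulZ ul_eE !(mul0mx, mulmx0) addr0 add0r.
  by rewrite e1 diag_delta delta_diag !diag_mx_diag -scalerBl.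
- by rewrite ur_bracket e2 urZ ur_eE !(mul0mx, mulmx0, scaler0, addr0, oppr0).
- by rewrite dl_bracket e3 dlZ dl_eE !(mul0mx, mulmx0, scaler0, addr0, oppr0).
Qed.
Lemma rootv_sB i j : rootv (epsw i + epsw j) (sB i j).
Proof.
move=> h /cartanE[d [e1 e2 e3]]; rewrite weight_valD !weight_val_eps.
apply: pe_ext.
- by rewrite ul_bracket e2 e3 ulZ ul_sB dl_sB !(mul0mx, mulmx0, scaler0, addr0, oppr0).
- rewrite ur_bracket e2 urZ ul_sB !(mul0mx, mulmx0, addr0, oppr0) ur_sB.
  rewrite e1 tr_diag_mx mulmxDl mulmxDr !diag_delta !delta_diag !diag_mx_diag scalerDr !scalerDl.
  by zmod.
- by rewrite dl_bracket e3 dlZ dl_sB !(mul0mx, mulmx0, scaler0, addr0, oppr0).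
Qed.
Lemma rootv_cD i j : rootv (- (epsw i + epsw j)) (cD i j).
Proof.
move=> h /cartanE[d [e1 e2 e3]]; rewrite weight_valN weight_valD !weight_val_eps.
apply: pe_ext.
- by rewrite ul_bracket e2 e3 ulZ ul_cD ur_cD !(mul0mx, mulmx0, scaler0, addr0, oppr0).
- by rewrite ur_bracket e2 urZ ur_cD ul_cD !(mul0mx, mulmx0, scaler0, addr0, oppr0).
- rewrite dl_bracket e3 dlZ ul_cD trmx0 !(mul0mx, mulmx0) !add0r dl_cD.
  rewrite e1 tr_diag_mx mulmxBl mulmxBr !diag_delta !delta_diag !diag_mx_diag scalerBr !scaleNr !scalerDl.
  by zmod.
Qed.

End Roots.

(** * The action of a simple root vector *)

Section Operators.
Context (C : numClosedFieldType) (n : nat) (lam : 'rV[C]_n) (i0 i1 : 'I_n).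
Implicit Types (x y z : Defs.pe C n).
Hypothesis i01 : i1 = i0.+1 :> nat.
Local Notation pe := (pe C n).
Context (V : smod C n) (v0 : V) (HV : verma_spec lam v0).
Local Notation e := (eE C i0 i1).
Local Notation f := (eE C i1 i0).

Definition hE : pe := eE C i0 i0 - eE C i1 i1.
Local Notation h := hE.
(** The coefficient of f. As the root is simple, it is a character of the negative part
    ([chi_bracket]). *)
Definition chi (y : pe) : C := ul y i1 i0.

Lemma i01_lt : (i0 < i1)%N. Proof. by rewrite i01. Qed.
Lemma i01_neq : (i0 == i1) = false. Proof. by rewrite -val_eqE /= ltn_eqF // i01_lt. Qed.
Lemma i10_neq : (i1 == i0) = false. Proof. by rewrite eq_sym i01_neq. Qed.

Lemma mneg_f : mneg f. Proof. exact/mneg_eE/i01_lt. Qed.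
Lemma borel_e : borel e. Proof. exact/borel_eE/ltnW/i01_lt. Qed.

Lemma chiP c x y : chi (c *: x + y) = c * chi x + chi y.
Proof. by rewrite /chi ulP mxE [X in X + _]mxE. Qed.
Lemma chi_f : chi f = 1.
Proof. by rewrite /chi ul_eE mxE !eqxx. Qed.
Lemma chi_odd y : homog true y -> chi y = 0.
Proof. by move/homogE => hy; rewrite /chi hy mxE. Qed.

(** The entry (i1, i0) of a product of strictly lower triangular matrices is a sum over i0 < k < i1,
    which is empty. *)
Lemma chi_bracket x y : mneg x -> mneg y -> chi (pe_bracket x y) = 0.
Proof.
move=> [h1 h2] [h3 h4]; rewrite /chi ul_bracket h1 h3 !(mul0mx, mulmx0) !add0r mx_comm.
by rewrite !big1 ?subrr // => k _; case: (leqP i1 k) => ki;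
  rewrite ?(h2 i1 k ki) ?(h4 i1 k ki) ?mul0r //;
  [rewrite (h2 k i0)|rewrite (h4 k i0)]; rewrite ?mulr0 // -ltnS -i01.
Qed.

Lemma mul_delta (A : 'M[C]_n) (i j k l : 'I_n) :
  (delta_mx i j *m A) k l = (k == i)%:R * A j l.
Proof.
rewrite mxE (bigD1 j) //= mxE eqxx andbT big1 ?addr0 // => m mj.
by rewrite mxE (negPf mj) andbF mul0r.
Qed.
Lemma delta_mul (A : 'M[C]_n) (i j k l : 'I_n) :
  (A *m delta_mx i j) k l = A k i * (l == j)%:R.
Proof.
rewrite mxE (bigD1 i) //= mxE eqxx big1 ?addr0 // => m mj.
by rewrite mxE (negPf mj) mulr0.
Qed.

Lemma ul_bracket_eE (i j : 'I_n) y k l :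
  ul (pe_bracket (eE C i j) y) k l = (k == i)%:R * ul y j l - ul y k i * (l == j)%:R.
Proof.
rewrite ul_bracket ur_eE dl_eE mul0mx mulmx0 !add0r ul_eE mxE.
by rewrite [X in _ + X]mxE mul_delta delta_mul.
Qed.

Lemma ur_bracket_eE0 (i j : 'I_n) y : ur y = 0 -> ur (pe_bracket (eE C i j) y) = 0.
Proof. by move=> hy; rewrite ur_bracket ur_eE hy !(mul0mx, mulmx0, addr0, oppr0). Qed.

Lemma ulBe (x y : pe) (k l : 'I_n) : ul (x - y) k l = ul x k l - ul y k l.
Proof. by rewrite ulB mxE [X in _ + X]mxE. Qed.
Lemma ulZe c (x : pe) (k l : 'I_n) : ul (c *: x) k l = c * ul x k l.
Proof. by rewrite ulZ mxE. Qed.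
Lemma ul_eEe (i j k l : 'I_n) : ul (eE C i j) k l = ((k == i) && (l == j))%:R.
Proof. by rewrite ul_eE mxE. Qed.
Lemma cartan_eE (i : 'I_n) : cartan (eE C i i).
Proof.
apply/is_diag_mxP => k l kl; rewrite [eE C i i : 'M_(n + n)]pe_blockE ul_eE ur_eE dl_eE.
rewrite trmx_delta.
case: (split_ordP k) kl => k' ->; case: (split_ordP l) => l' -> kl.
- rewrite block_mxEul mxE; case: eqP => //= ek; case: eqP => //= el.
  by move: kl; rewrite ek el eqxx.
- by rewrite block_mxEur mxE.
- by rewrite block_mxEdl mxE.
- rewrite block_mxEdr mxE mxE; case: (k' =P i) => [ek|_]; case: (l' =P i) => [el|_];
    rewrite ?oppr0 //.
  by move: kl; rewrite ek el eqxx.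
Qed.
Lemma cartanP c x y : cartan x -> cartan y -> cartan (c *: x + y).
Proof.
move=> /is_diag_mxP hx /is_diag_mxP hy; apply/is_diag_mxP => k l kl.
by rewrite pe_mxP mxE [X in X + _]mxE hx // hy // mulr0 addr0.
Qed.
Lemma cartan_h : cartan h.
Proof.
by rewrite /hE addrC -scaleN1r; apply: cartanP; exact: cartan_eE.
Qed.

(** For a simple root, ad(e) keeps all negative root vectors negative except f, for which [e,f] = h.
    The component of f in z vanishes because twice a root is not a root. *)
Lemma bracket_e y : mneg y -> exists z,
  [/\ mneg z, chi z = 0 & pe_bracket e y = z + chi y *: h].
Proof.
move=> [h1 h2]; exists (pe_bracket e y - chi y *: h); split; last by rewrite subrK.
- split.
    rewrite urB urZ urB !ur_eE subrr scaler0 subr0; exact: ur_bracket_eE0.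
  move=> k l kl; rewrite ulBe ul_bracket_eE ulZe ulBe !ul_eEe /chi.
  have [ek|ki0] := eqVneq k i0.
    have -> : ul y k i0 = 0 by rewrite h2 // ek.
    rewrite mul0r subr0 ek i01_neq subr0 mul1r.
    have [->|li0] := eqVneq l i0; first by rewrite mulr1 subrr.
    rewrite (h2 i1 l) ?mulr0 ?subrr // i01 ltn_neqAle -ek kl andbT.
    by rewrite eq_sym ek; apply: contra li0 => /eqP /val_inj ->.
  rewrite mul0r !sub0r; have [el|li1] := eqVneq l i1; last first.
    by rewrite andbF mulr0 oppr0 mulr0 subrr.
  have [->|ki1] := eqVneq k i1; first by rewrite mulr1 mulrN1 opprK addNr.
  rewrite (h2 k i0) ?mul0r ?oppr0 ?mulr0 ?subrr // -ltnS -i01 ltn_neqAle -el kl andbT.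
  by apply: contra ki1 => /eqP /val_inj ->; rewrite el.
rewrite /chi ulBe ul_bracket_eE ulZe ulBe !ul_eEe.
by rewrite i10_neq i01_neq !andbF mul0r mulr0 !subrr mulr0 subrr.
Qed.

Lemma ul_bracket_cartan x y (k l : 'I_n) : cartan x ->
  ul (pe_bracket x y) k l = (ul x k k - ul x l l) * ul y k l.
Proof.
case/cartanE => d [e1 e2 e3]; rewrite ul_bracket e2 e3 mul0mx mulmx0 !add0r e1.
by rewrite mxE [X in _ + X]mxE mul_diag_mx mul_mx_diag !mxE !eqxx !mulr1n mulrBl [_ * d 0 l]mulrC.
Qed.
Lemma mneg_cartan_bracket x y : cartan x -> mneg y -> mneg (pe_bracket x y).
Proof.
move=> cx [h1 h2]; split; last by move=> k l kl; rewrite ul_bracket_cartan // h2 // mulr0.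
case/cartanE: cx => d [e1 e2 e3].
by rewrite ur_bracket h1 e2 !(mul0mx, mulmx0, addr0, oppr0).
Qed.
Lemma ul_h : (ul h i0 i0 = 1) * (ul h i1 i1 = -1).
Proof. by split; rewrite ulBe !ul_eEe !eqxx ?i01_neq ?i10_neq ?subr0 ?sub0r. Qed.
Lemma chi_bracket_h y : chi (pe_bracket h y) = - 2 * chi y.
Proof. by rewrite /chi ul_bracket_cartan ?ul_h; [rewrite -opprD|exact: cartan_h]. Qed.

Lemma bracket_ef : pe_bracket e f = h.
Proof.
apply: pe_ext.
- apply/matrixP => k l; rewrite ul_bracket_eE ulBe !ul_eEe !eqxx.
  by case: (k == i0); case: (k == i1); rewrite /= ?andbT ?mul0r ?mul1r ?mulr0 ?mulr1 // ?andbF.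
- by rewrite ur_bracket_eE0 ?urB ?ur_eE // subrr.
- by rewrite dl_bracket dlB !dl_eE !(mul0mx, mulmx0, addr0, subrr).
Qed.

Lemma weight_h : weight_val lam h = lam 0 i0 - lam 0 i1.
Proof.
have w (i : 'I_n) : weight_val lam (eE C i i) = lam 0 i.
  rewrite weight_valE (bigD1 i) //= ul_eEe !eqxx mulr1 big1 ?addr0 // => j ji.
  by rewrite ul_eEe (negPf ji) mulr0.
by rewrite /hE addrC -scaleN1r weight_valP !w mulN1r addrC.
Qed.

(** In the enveloping algebra of the negative part, [R] is right multiplication by f and [delta] is
    the derivation extending [chi]. Both come from freeness, [R] by sending the generator to f
    v0. *)
Lemma verma_operators : exists delta R : {linear V -> V},
  [/\ delta v0 = 0, forall y v, mneg y -> delta (act y v) = chi y *: v + act y (delta v),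
      R v0 = act f v0 & forall y v, mneg y -> R (act y v) = act y (R v)].
Proof.
have [R [R0 RP]] := @vs_free C n lam V v0 HV V (@act C n V) (act f v0) (@act_linl C n V)
  (@act_linr C n V) (fun a b x y v hx hy _ _ => act_bracket v hx hy).
pose VV : lmodType C := (smod_car V * smod_car V)%type.
(* The self-extension of V by the character [chi]. The first component of the resulting map from V
   is the identity, and the second is the derivation. *)
pose l (y : pe) (p : VV) : VV := (act y p.1, chi y *: p.1 + act y p.2).
have VE c (p q : VV) : c *: p + q = (c *: p.1 + q.1, c *: p.2 + q.2) by [].
have [D [D0 DP]] : exists g : {linear V -> VV},
    g v0 = (v0, 0) :> VV /\ forall y v, mneg y -> g (act y v) = l y (g v).
  apply: (vs_free HV).
  - move=> c x y [p q]; rewrite VE /l /=; congr (_, _); first exact: act_linl.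
    by rewrite act_linl chiP scalerDl scalerDr !scalerA /=; zmod.
  - move=> x c [p q] [p' q']; rewrite !VE /l /=; congr (_, _); first exact: act_linr.
    by rewrite act_linr !scalerDr !scalerA mulrC /=; zmod.
  move=> a b x y [p q] hx hy mx my; rewrite /l /=.
  have -> : forall u u' w w' : V, ((u, u') : VV) - (-1) ^+ (a && b) *: ((w, w') : VV)
      = (u - (-1) ^+ (a && b) *: w, u' - (-1) ^+ (a && b) *: w') :> VV by [].
  rewrite (act_bracket _ hx hy) (act_bracket _ hx hy) chi_bracket // scale0r add0r.
  congr (_, _).
  rewrite !act_linr !scalerDr.
  (* [chi] vanishes on odd elements, so the sign is 1 wherever a value of it survives. *)
  by case: a hx => hx; case: b hy => hy; rewrite ?(chi_odd hx) ?(chi_odd hy) /=;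
    rewrite ?expr0 ?scale1r ?scale0r ?scaler0 ?add0r ?addr0 //; zmod.
have D1 v : (D v).1 = v.
  elim/(vs_ind HV): v => [c u v IHu IHv||a y v hy my IH].
  - by rewrite linearP /= IHu IHv.
  - by rewrite D0.
  - by rewrite DP //= IH.
pose d (v : V) := (D v).2.
have dl c u v : d (c *: u + v) = c *: d u + d v by rewrite /d linearP.
exists (HB.pack_for {linear V -> V} d (GRing.isLinear.Build C V V *:%R d dl)), R.
split=> //=; first by rewrite /d D0.
by move=> y v my; rewrite /= /d DP //= D1.
Qed.

End Operators.

Section ActRight.
Context (C : numClosedFieldType) (n : nat) (M : smod C n).
Implicit Types (x : Defs.pe C n) (u v : M).
Lemma act0r x : act x 0 = 0 :> M. Proof. exact: linear0. Qed.
Lemma actDr x u v : act x (u + v) = act x u + act x v. Proof. exact: linearD. Qed.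
Lemma actBr x u v : act x (u - v) = act x u - act x v. Proof. exact: linearB. Qed.
Lemma actZr x c u : act x (c *: u) = c *: act x u. Proof. exact: linearZ. Qed.
Lemma par0 : par 0 = 0 :> M. Proof. exact: linear0. Qed.
Lemma parD u v : par (u + v) = par u + par v. Proof. exact: linearD. Qed.
Lemma parZ c u : par (c *: u) = c *: par u. Proof. exact: linearZ. Qed.
End ActRight.

(** * The sl_2-triple of a simple root and the operators [delta] and [R] *)

Section SimpleRoot.
Context (C : numClosedFieldType) (n : nat) (lam : 'rV[C]_n) (i0 i1 : 'I_n).
Implicit Types (x y z : Defs.pe C n).
Hypothesis i01 : i1 = i0.+1 :> nat.
Local Notation pe := (pe C n).
Context (V : smod C n) (v0 : V) (HV : verma_spec lam v0).
Implicit Types (u v w : V).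
Local Notation e := (eE C i0 i1).
Local Notation f := (eE C i1 i0).
Local Notation h := (hE C i0 i1).
Local Notation chi := (@chi C n i0 i1).
Local Notation a := (lam 0 i0 - lam 0 i1).

Lemma act_comm_even x y v : homog false x -> homog false y ->
  act x (act y v) = act y (act x v) + act (pe_bracket x y) v.
Proof. by move=> hx hy; rewrite (act_comm _ _ hy) (th_homog _ hx) expr0 scale1r. Qed.

Lemma act_comm_el a x y v : homog false x -> homog a y ->
  act x (act y v) = act y (act x v) + act (pe_bracket x y) v.
Proof. by move=> hx hy; rewrite (act_comm _ _ hy) (th_homog _ hx) andbF expr0 scale1r. Qed.

Lemma act_comm_evenl x y v : homog false x ->
  act x (act y v) = act y (act x v) + act (pe_bracket x y) v.
Proof.
move=> hx; rewrite -[y]pe_compE bracketDr !actDl linearD /=.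
by rewrite !(act_comm_el _ hx (homog_comp _ _)); zmod.
Qed.

Context (delta R : {linear V -> V}).
Hypotheses (delta0 : delta v0 = 0)
  (deltaP : forall y v, mneg y -> delta (act y v) = chi y *: v + act y (delta v))
  (R0 : R v0 = act f v0)
  (RP : forall y v, mneg y -> R (act y v) = act y (R v)).

Let homog_h : homog false h.
Proof. exact/cartan_homog/cartan_h. Qed.

Lemma delta_f v : delta (act f v) = v + act f (delta v).
Proof. by rewrite deltaP ?chi_f ?scale1r //; exact: mneg_f. Qed.

Lemma delta_R v : delta (R v) = v + R (delta v).
Proof.
elim/(vs_ind HV): v => [c u v IHu IHv||b y v hy my IH].
- by rewrite !linearP /= IHu IHv scalerDr; zmod.
- by rewrite R0 delta_f delta0 !linear0.
by rewrite RP // !deltaP // IH [act y (_ + _)]linearD [R (_ + _)]linearP /= RP //; zmod.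
Qed.

(** Removing a factor f raises the h-weight by 2. *)
Lemma delta_h v : delta (act h v) = act h (delta v) - 2 *: delta v.
Proof.
elim/(vs_ind HV): v => [c u v IHu IHv||b y v hy my IH].
- by rewrite !linearP /= IHu IHv !scalerDr !scalerN; zmod.
- rewrite (vs_borel HV); last exact/cartan_borel/cartan_h.
  by rewrite linearZ /= delta0 scaler0 linear0 scaler0 subr0.
have mh : mneg (pe_bracket h y) by apply: mneg_cartan_bracket => //; exact: cartan_h.
rewrite (act_comm_el _ homog_h hy) [delta (_ + _)]linearD /= !(deltaP _ my) (deltaP _ mh).
rewrite chi_bracket_h // IH.
rewrite [act y (_ - _)]linearB [act h (_ + _)]linearP /= (act_comm_el _ homog_h hy).
rewrite linearZ /= scalerDr scalerA mulNr scaleNr.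
by zmod.
Qed.

Lemma h_f v : act h (act f v) = act f (act h v) - 2 *: act f v.
Proof.
rewrite (act_comm_even _ homog_h (homog_eE _ _ _)).
rewrite rootv_eE ?weight_valD ?weight_valN ?weight_val_eps; last exact: cartan_h.
by rewrite !ul_h // -opprD actZl scaleNr.
Qed.
Lemma h_e v : act h (act e v) = act e (act h v) + 2 *: act e v.
Proof.
rewrite (act_comm_even _ homog_h (homog_eE _ _ _)).
rewrite rootv_eE ?weight_valD ?weight_valN ?weight_val_eps; last exact: cartan_h.
by rewrite !ul_h // opprK actZl.
Qed.
Lemma e_f v : act e (act f v) = act f (act e v) + act h v.
Proof. by rewrite (act_comm_even _ (homog_eE _ _ _) (homog_eE _ _ _)) bracket_ef. Qed.

Lemma h_R v : act h (R v) = R (act h v) - 2 *: R v.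
Proof.
elim/(vs_ind HV): v => [c u v IHu IHv||b y v hy my IH].
- by rewrite !linearP /= IHu IHv !scalerDr !scalerN; zmod.
- rewrite R0 h_f (vs_borel HV); last exact/cartan_borel/cartan_h.
  by rewrite !linearZ /= R0.
have mh : mneg (pe_bracket h y) by apply: mneg_cartan_bracket => //; exact: cartan_h.
rewrite (RP _ my) !(act_comm_el _ homog_h hy) IH [R (_ + _)]linearD /=.
by rewrite (RP _ my) (RP _ mh) [act y (_ - _)]linearB linearZ /=; zmod.
Qed.

(** The factor f appended next to v0 meets e and yields h v0 = a v0. Every h that e produces from
    another f of v now acts on a vector of weight lower by 2, which accounts for -2 R (delta v). *)
Lemma e_R v : act e (R v) = R (act e v) + a *: v - 2 *: R (delta v).
Proof.
elim/(vs_ind HV): v => [c u v IHu IHv||b y v hy my IH].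
- by rewrite !linearP /= IHu IHv !scalerDr !scalerN; zmod.
- rewrite R0 e_f (vs_borel HV); last exact: borel_e.
  rewrite (vs_borel HV); last exact/cartan_borel/cartan_h.
  have -> : weight_val lam e = 0.
    rewrite weight_valE big1 // => i _; rewrite ul_eEe.
    by case: eqP => [->|_]; rewrite ?(i01_neq i01) /= mulr0.
  by rewrite weight_h // scale0r delta0 !linear0 addr0.
have [z [mz chiz ez]] := bracket_e i01 my.
rewrite (RP _ my) !(act_comm_el _ (homog_eE C i0 i1) hy) IH ez !actDl !actZl.
rewrite [R (_ + _)]linearD /= (RP _ my) [R (_ + _)]linearD linearZ /= (RP _ mz) h_R.
rewrite (deltaP _ my) [R (_ + _)]linearP /= (RP _ my) linearB linearD !linearZ /=.
rewrite [R (act e v) + _]addrC linearP linearN /= !scalerN !scalerDr !scalerA [2 * chi y]mulrC.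
by zmod.
Qed.

(** In particular the kernel of [delta] is stable under e. *)
Lemma delta_e v : delta (act e v) = act e (delta v) - delta (delta v).
Proof.
elim/(vs_ind HV): v => [c u v IHu IHv||b y v hy my IH].
- by rewrite !linearP /= IHu IHv !scalerDr !scalerN; zmod.
- rewrite delta0 !linear0 ?subr0 ?addr0 (vs_borel HV); last exact: borel_e.
  by rewrite linearZ /= delta0 scaler0.
have [z [mz chiz ez]] := bracket_e i01 my.
rewrite !(act_comm_el _ (homog_eE C i0 i1) hy) ez !actDl !actZl.
rewrite [delta (_ + _)]linearD /= (deltaP _ my) [delta (_ + _)]linearD linearZ /=.
rewrite (deltaP _ mz) chiz scale0r add0r delta_h IH !(deltaP _ my).
rewrite [delta (_ + _)]linearP /= (deltaP _ my) [act e (_ + _)]linearP /=.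
rewrite (act_comm_el _ (homog_eE C i0 i1) hy) ez actDl actZl [act y (_ - _)]linearB /=.
rewrite scalerBr scalerA [chi y * 2]mulrC mulr2n mulrDl mul1r scalerDl.
by zmod.
Qed.

(** Left minus right multiplication by f, that is, ad(f) on the enveloping algebra of the negative
    part. Unlike f it is locally nilpotent; it preserves the kernel of [delta]. *)
Definition F0 v := act f v - R v.

Lemma F0P c u v : F0 (c *: u + v) = c *: F0 u + F0 v.
Proof. by rewrite /F0 !linearP /= scalerDr scalerN; zmod. Qed.
Lemma F00 : F0 0 = 0.
Proof. by rewrite /F0 !linear0 ?subrr ?addr0. Qed.
Lemma F0Z c u : F0 (c *: u) = c *: F0 u.
Proof. by rewrite -[c *: u]addr0 F0P F00 addr0. Qed.

Lemma F0_act y v : mneg y -> F0 (act y v) = act y (F0 v) + act (pe_bracket f y) v.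
Proof.
move=> my; rewrite /F0 (RP _ my) (act_comm_evenl _ _ (homog_eE C i1 i0)) linearB /=.
by zmod.
Qed.

Lemma iter0 (g : V -> V) N : g 0 = 0 -> iter N g 0 = 0.
Proof. by move=> g0; elim: N => //= N ->. Qed.
Lemma iter_linD (g : V -> V) N u v : (forall c u v, g (c *: u + v) = c *: g u + g v) ->
  iter N g (u + v) = iter N g u + iter N g v.
Proof.
by move=> gl; elim: N => //= N ->; rewrite -[iter N g u]scale1r gl !scale1r.
Qed.
Lemma iter_linZ (g : V -> V) N c u : (forall c u v, g (c *: u + v) = c *: g u + g v) ->
  iter N g (c *: u) = c *: iter N g u.
Proof.
move=> gl; have g0 : g 0 = 0 by have := gl (-1) 0 0; rewrite scaler0 addr0 scaleN1r addNr.
by elim: N => //= N ->; rewrite -[c *: iter N g u]addr0 gl g0 addr0.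
Qed.

(** Leibniz' rule for the extension of ad(f) to words, in the crude form that N + k applications
    suffice; K only bounds the double induction. *)
Lemma F0_leibniz K : forall N k y v, (N + k <= K)%N -> mneg y ->
  iter N F0 v = 0 -> iter k (pe_bracket f) y = 0 -> iter (N + k) F0 (act y v) = 0.
Proof.
elim: K => [|K IH] N k y v le_K my Nv ky.
  move: le_K Nv; rewrite leqn0 addn_eq0 => /andP[/eqP -> /eqP ->] /= ->.
  by rewrite linear0.
case: k ky le_K => [/= -> _|k ky le_K]; first by rewrite act0l iter0 // F00.
case: N Nv le_K => [/= -> _|N Nv le_K]; first by rewrite linear0 iter0 // F00.
have leK : (N + k.+1 <= K)%N by move: le_K; rewrite addSn.
have e1 : iter (N.+1 + k) F0 (act y (F0 v)) = 0.
  by rewrite addSnnS IH // -iterSr.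
have e2 : iter (N.+1 + k) F0 (act (pe_bracket f y) v) = 0.
  apply: IH => //; [by rewrite addSnnS|exact: mneg_bracket (mneg_f C i01) my|by rewrite -iterSr].
by rewrite addnS iterSr F0_act // iter_linD ?e1 ?e2 ?addr0 //; exact: F0P.
Qed.

(** The matrix of f squares to zero, and each term of the triple commutator contains two adjacent
    factors f. *)
Lemma ad_f_nilp y : iter 3 (pe_bracket f) y = 0.
Proof.
apply/val_inj => /=.
have hf : gl_comp false (f : 'M_(n + n)) = f := homog_eE C i1 i0.
have ff : (f : 'M_(n + n)) *m f = 0.
  rewrite [f : 'M_(n + n)]pe_blockE ur_eE dl_eE mulmx_block !(mulmx0, mul0mx, addr0, add0r).
  rewrite mulNmx mulmxN opprK -trmx_mul ul_eE.
  have -> : delta_mx i1 i0 *m delta_mx i1 i0 = 0 :> 'M[C]_n.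
    apply/matrixP => k l; rewrite mul_delta mxE (i01_neq i01) andFb mulr0.
    by rewrite mxE.
  by rewrite trmx0 block_mx0.
rewrite !(gl_bracketEl _ hf) /=.
set F := (f : 'M_(n + n)) in ff *; set Y := (y : 'M_(n + n)).
have ffr (X : 'M_(n + n)) : X *m F *m F = 0 by rewrite -mulmxA ff mulmx0.
rewrite !(mulmxBl, mulmxBr) !mulmxA !ff ?ffr !mul0mx ?ffr.
by zmod.
Qed.

Lemma F0_nilp v : exists N, iter N F0 v = 0.
Proof.
elim/(vs_ind HV): v => [c u v [N Nu] [M Mv]||b y v hy my [N Nv]].
- exists (N + M)%N; rewrite iter_linD ?iter_linZ; try exact: F0P.
  rewrite [X in iter X F0 u]addnC !iterD Nu Mv !iter0 ?scaler0 ?addr0 //; exact: F00.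
- by exists 1%N; rewrite /= /F0 R0 subrr.
by exists (N + 3)%N; apply: F0_leibniz (leqnn _) my Nv (ad_f_nilp y).
Qed.

Lemma delta_nilp v : exists N, iter N delta v = 0.
Proof.
elim/(vs_ind HV): v => [c u v [N Nu] [M Mv]||b y v hy my [N Nv]].
- exists (N + M)%N; rewrite iter_linD ?iter_linZ; try exact: linearP.
  by rewrite [X in iter X delta u]addnC !iterD Nu Mv !iter0 ?scaler0 ?addr0 ?linear0.
- by exists 1%N.
exists N.+1; elim: N v Nv => [|N IH] v Nv; first by rewrite /= in Nv *; rewrite Nv !linear0.
rewrite iterSr (deltaP _ my) iter_linD; last exact: linearP.
rewrite iter_linZ; last exact: linearP.
by rewrite IH -?iterSr // Nv scaler0 addr0.
Qed.

Local Notation fp j := (iter j (act f)).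
Let fp0 j : fp j (0 : V) = 0. Proof. by rewrite iter0 // linear0. Qed.
Let fpZ j c u : fp j (c *: u) = c *: fp j u.
Proof. by rewrite iter_linZ //; exact: linearP. Qed.
Let fpD j u v : fp j (u + v) = fp j u + fp j v.
Proof. by rewrite iter_linD //; exact: linearP. Qed.

(** A Weyl algebra argument: [delta, f] = 1 gives delta^(k+1) f = (k+1) delta^k + f delta^(k+1), so
    that f v = 0 lowers the nilpotency order of [delta] on v step by step to 0. *)
Lemma f_inj v : act f v = 0 -> v = 0.
Proof.
move=> fv; have [N] := delta_nilp v; elim: N => [//|N IH] dN; apply: IH.
have H k : iter k.+1 delta (act f v) = k.+1%:R *: iter k delta v + act f (iter k.+1 delta v).
  elim: k => [|k IH]; first by rewrite /= delta_f scale1r.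
  rewrite [LHS]iterS IH linearD linearZ /= delta_f -[k.+2]addn1 natrD scalerDl scale1r.
  by zmod.
have := H N; rewrite fv iter0 ?linear0 // dN linear0 addr0 => /esym/eqP.
by rewrite scaler_eq0 pnatr_eq0 => /eqP.
Qed.

Lemma h_fp j v : act h (fp j v) = fp j (act h v) - (2 * j%:R) *: fp j v.
Proof.
elim: j => [|j IH] /=; first by rewrite mulr0 scale0r subr0.
rewrite h_f IH actBr actZr -[j.+1]addn1 natrD mulrDr mulr1 [(2 * _ + _) *: _]scalerDl.
by zmod.
Qed.

(** The rule e f^j = f^j e + j f^(j-1) (h - j + 1) of sl_2; at j = 0 the truncated predecessor is
    multiplied by 0. *)
Lemma e_fp j v : act e (fp j v) = fp j (act e v)
  + j%:R *: fp j.-1 (act h v - (j%:R - 1) *: v).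
Proof.
elim: j => [|j IH] /=; first by rewrite scale0r addr0.
rewrite e_f IH h_fp actDr actZr; case: j IH => [|j] IH /=.
  by rewrite !mulr0 subrr !scale0r !subr0 addr0 scale1r.
rewrite -iterS -[j.+2]addn1 natrD addrK -!iterS; set t := j.+1%:R.
have fpB (g : C) u : fp j.+1 (u - g *: v) = fp j.+1 u - g *: fp j.+1 v.
  by rewrite -scaleNr fpD fpZ scaleNr.
rewrite !fpB; set X := fp j.+1 (act h v); set Y := fp j.+1 v.
rewrite !scalerBr !scalerA scalerDl scale1r.
have -> : (t + 1) * t = t * (t - 1) + 2 * t by ring.
by rewrite scalerDl; zmod.
Qed.

Lemma delta_fp j u : delta u = 0 -> delta (fp j u) = j%:R *: fp j.-1 u.
Proof.
move=> du; elim: j => [|j IH] /=; first by rewrite du scale0r.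
rewrite delta_f IH actZr -[j.+1]addn1 natrD scalerDl scale1r addrC.
by case: j {IH} => [|j] //=; rewrite !scale0r.
Qed.

Lemma delta_F0 u : delta u = 0 -> delta (F0 u) = 0.
Proof. by move=> du; rewrite /F0 linearB /= delta_f delta_R du !linear0 !addr0 subrr. Qed.
Lemma e_F0 u : delta u = 0 -> act e (F0 u) = F0 (act e u) + act h u - a *: u.
Proof.
move=> du; rewrite /F0 actBr e_f e_R du linear0 scaler0 subr0.
by zmod.
Qed.
Lemma h_F0 u : act h (F0 u) = F0 (act h u) - 2 *: F0 u.
Proof. by rewrite /F0 actBr h_f h_R scalerBr; zmod. Qed.
Lemma delta_ee j u : delta u = 0 -> delta (iter j (act e) u) = 0.
Proof. by move=> du; elim: j => //= j IH; rewrite delta_e IH act0r linear0 subr0. Qed.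
Lemma h_ee j u c : act h u = c *: u ->
  act h (iter j (act e) u) = (c + 2 * j%:R) *: iter j (act e) u.
Proof.
move=> hu; elim: j => [|j IH] /=; first by rewrite mulr0 addr0.
rewrite h_e IH actZr -scalerDl; congr (_ *: _).
by rewrite -[j.+1]addn1 natrD; ring.
Qed.

(** The sl_2-rule for moving e^j past the lowering operator [F0], on a vector of weight -k under h -
    a. *)
Lemma ee_F0 j u k : delta u = 0 -> act h u = (a - k) *: u ->
  iter j (act e) (F0 u)
  = F0 (iter j (act e) u) + (j%:R * (j%:R - 1 - k)) *: iter j.-1 (act e) u.
Proof.
move=> du hu; elim: j => [|j IH]; first by rewrite mul0r scale0r addr0.
rewrite [LHS]/= IH actDr actZr (e_F0 (delta_ee j du)) (h_ee j hu).
case: j IH => [|j] IH /=.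
  rewrite !mul0r scale0r mulr0 addr0 subrr sub0r mul1r addr0 -addrA -scalerBl.
  by congr (_ + _ *: _); ring.
rewrite -!iterS; set X := F0 _; set Y := iter j.+1 _ _.
have -> : j.+2%:R * (j.+2%:R - 1 - k) = (a - k + 2 * j.+1%:R - a) + j.+1%:R * (j.+1%:R - 1 - k).
  by rewrite -[j.+2]addn1 natrD; ring.
by rewrite [in RHS]scalerDl [in RHS]scalerBl; zmod.
Qed.

(* [F0] plays the role of ad(f) on the kernel of [delta], a locally finite
   sl_2-module for [e], [F0], [h - a]; there e^k is injective on the weight
   spaces of weight at most -k. *)
Lemma ee_inj N : forall k k' u, delta u = 0 -> iter N F0 u = 0 ->
  act h u = (a - k'%:R) *: u -> (k <= k')%N -> iter k (act e) u = 0 -> u = 0.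
Proof.
elim: N => [//|N IH] k k' u du Nu hu le_k eu.
(* The vector F0 u has smaller nilpotency order and weight lower by 2, and by [ee_F0] it is killed
   by e^(k+1). *)
have F0u : F0 u = 0.
  apply: (IH k.+1 k'.+2) => //; first exact: delta_F0.
  - by rewrite -iterSr.
  - rewrite h_F0 hu F0Z -scalerBl; congr (_ *: _).
    by rewrite -[k'.+2]addn2 natrD; ring.
  - by rewrite ltnW // ltnS.
  rewrite (ee_F0 k.+1 du hu) iterS eu act0r F00 add0r /=.
  by rewrite ?eu scaler0.
elim: k le_k eu => [|k IHk] lt_k eu //; apply: IHk; first exact: ltnW.
(* With F0 u = 0 the rule reads (k + 1)(k - k') e^k u = 0, where k < k'. *)
have := ee_F0 k.+1 du hu; rewrite F0u iter0 ?act0r // eu F00 add0r /= => /esym/eqP.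
rewrite scaler_eq0 => /orP[|/eqP //]; rewrite mulf_eq0 pnatr_eq0 /=.
rewrite -[k.+1]addn1 natrD addrK subr_eq0 eqr_nat => /eqP ek.
by rewrite ek ltnn in lt_k.
Qed.

(** Taylor expansion: if delta^(N+1) v = 0, then w = delta^N v / N! lies in the kernel of [delta],
    and v - f^N w is killed by delta^N. *)
Lemma f_expand v : exists (K : nat) (u : nat -> V),
  (forall j, delta (u j) = 0) /\ v = \sum_(j < K) fp j (u j).
Proof.
have [N] := delta_nilp v; elim: N v => [|N IH] v dN.
  by exists 0%N, (fun=> 0); split=> [j|]; rewrite ?linear0 // big_ord0.
pose w := (N`!%:R)^-1 *: iter N delta v.
have dw : delta w = 0 by rewrite /w linearZ /= -iterS dN scaler0.
have dfw k : (k <= N)%N -> iter k delta (fp N w) = (N ^_ k)%:R *: fp (N - k) w.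
  elim: k => [_|k IHk lt_k]; first by rewrite ffactn0 scale1r subn0.
  rewrite iterS IHk; last exact: ltnW.
  rewrite linearZ /= (delta_fp _ dw) scalerA -natrM subnS ffactnSr.
  by [].
have [|K [u [du vu]]] := IH (v - fp N w).
  have e := @iter_linD delta N v (- fp N w) (fun c u v => linearP delta c u v).
  rewrite e -scaleN1r iter_linZ; last exact: linearP.
  rewrite dfw // ffactnn subnn /= /w [N`!%:R *: _]scalerA mulfV ?scale1r ?scaleN1r ?subrr //.
  by rewrite pnatr_eq0 -lt0n fact_gt0.
exists (maxn K N.+1), (fun j => (if (j < K)%N then u j else 0) + (if j == N then w else 0)).
split=> [j|].
  by rewrite linearD /=; case: ifP => _; case: ifP => _; rewrite ?du ?dw ?linear0 ?addr0.
rewrite (eq_bigr (fun j : 'I_(maxn K N.+1) => (if (j < K)%N then fp j (u j) else 0)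
    + (if j == N :> nat then fp N w else 0))); last first.
  move=> j _; rewrite fpD; congr (_ + _); first by case: ifP => // _; rewrite fp0.
  by case: eqP => [->|_] //; rewrite fp0.
rewrite big_split /= -big_mkcond -(big_ord_widen _ (fun j => fp j (u j)) (leq_maxl _ _)).
rewrite -vu (bigD1 (Ordinal (leq_maxr K N.+1))) //= eqxx big1 ?addr0 ?subrK // => j.
by rewrite -val_eqE /= => /negPf ->.
Qed.

(** The power delta^K maps f^K u_K to K! u_K and kills the lower terms, so the coefficients vanish
    from the top down. *)
Lemma f_expand_eq0 K (u : nat -> V) : (forall j, delta (u j) = 0) ->
  \sum_(j < K) fp j (u j) = 0 -> forall j, (j < K)%N -> u j = 0.
Proof.
move=> du; elim: K => [//|K IH]; rewrite big_ord_recr /= => s0.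
have dk k v : delta v = 0 -> forall j, (k < j)%N -> iter j delta (fp k v) = 0.
  move=> dv; elim: k => [|k IHk] [//|j] lt_k.
    by rewrite iterSr /= dv iter0 // linear0.
  by rewrite iterSr (delta_fp _ dv) iter_linZ ?IHk ?scaler0 //; exact: linearP.
have dfw k w : delta w = 0 -> iter k delta (fp k w) = (k`!%:R) *: w.
  move=> dw; elim: k => [|k IHk]; first by rewrite scale1r.
  rewrite iterSr (delta_fp _ dw) iter_linZ ?IHk ?scalerA ?factS ?natrM //.
  exact: linearP.
have uK : u K = 0.
  have := congr1 (iter K delta) s0; rewrite iter_linD; last exact: linearP.
  rewrite dfw // iter0 ?linear0 //.
  have -> : iter K delta (\sum_(j < K) fp j (u j)) = 0.
    elim/big_ind: _ => [|x y hx hy|j _]; first by rewrite iter0 ?linear0.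
      by rewrite iter_linD ?hx ?hy ?addr0 //; exact: linearP.
    exact: dk.
  by rewrite add0r => /eqP; rewrite scaler_eq0 pnatr_eq0 -leqn0 leqNgt fact_gt0 => /eqP.
move=> j; rewrite ltnS leq_eqVlt => /orP[/eqP -> //|]; apply: IH.
by rewrite uK fp0 addr0 in s0.
Qed.

Lemma fp_sum m I (r : seq I) (P : pred I) (g : I -> V) :
  fp m (\sum_(j <- r | P j) g j) = \sum_(j <- r | P j) fp m (g j).
Proof. by apply: big_morph; [exact: fpD|exact: fp0]. Qed.

Lemma fp_shift m L (u : nat -> V) : (forall j, (j < m)%N -> u j = 0) -> (m <= L)%N ->
  \sum_(j < L) fp j (u j) = fp m (\sum_(j < L - m) fp j (u (j + m)%N)).
Proof.
move=> u0 le_mL; rewrite -(big_mkord xpredT (fun j => fp j (u j))).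
rewrite (big_cat_nat (leq0n m) le_mL) //= big_nat big1 ?add0r => [|j /andP[_ lt_j]]; last first.
  by rewrite u0 // fp0.
rewrite -{1}[m]add0n big_addn big_mkord fp_sum; apply: eq_bigr => j _.
by rewrite -iterD addnC.
Qed.

(** The claim amounts to u_j = 0 for j < m in the expansion of d by powers of f. Comparing
    coefficients of f e d and f^(m+1) w gives a recursion for e u_j that ends in e^m u_0 = 0. *)
Lemma f_divides p m (d w : V) : a + 1 = p%:R -> act h d = - (m.+1)%:R *: d ->
  act f (act e d) = fp m.+1 w -> exists x : V, d = fp m x.
Proof.
move=> ap hd fed; have [K [u [du dE]]] := f_expand d.
pose u' j := if (j < K)%N then u j else 0.
have du' j : delta (u' j) = 0 by rewrite /u'; case: ifP => _; rewrite ?du ?linear0.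
have [K' [y [dy yE]]] := f_expand w.
(* The coefficients of f^(m+1) w: those of w shifted by m + 1 and extended by zero. *)
pose y' j := if (m < j)%N && (j - m.+1 < K')%N then y (j - m.+1)%N else 0.
have dy' j : delta (y' j) = 0 by rewrite /y'; case: ifP => _; rewrite ?dy ?linear0.
(* Large enough for both expansions at once: K <= L, so that the coefficient of d at L is zero, and
   K' <= L - m. *)
pose L := (K + K' + m.+2)%N.
have le_KL : (K <= L)%N by rewrite /L -addnA leq_addr.
have dE' : d = \sum_(j < L) fp j (u' j).
  rewrite dE (big_ord_widen L (fun j => fp j (u j))) //.
  by rewrite big_mkcond; apply: eq_bigr => j _; rewrite /u'; case: ifP => // _; rewrite fp0.
(* As f^j lowers weights by 2j, uniqueness of the expansion makes each coefficient an
   h-eigenvector. *)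
have hu j : act h (u' j) = (2 * j%:R - m.+1%:R) *: u' j.
  have [lt_j|ge_j] := ltnP j L; last first.
    have -> : u' j = 0 by rewrite /u' ltnNge (leq_trans _ ge_j).
    by rewrite act0r scaler0.
  apply/eqP; rewrite -subr_eq0; apply/eqP.
  pose z j := act h (u' j) - (2 * j%:R - m.+1%:R) *: u' j.
  apply: (@f_expand_eq0 L z) lt_j => [k|].
    by rewrite /z linearB linearZ /= delta_h du' !linear0 ?scaler0 ?oppr0 ?addr0.
  have := hd; rewrite dE' linear_sum scaler_sumr /= => /eqP; rewrite -subr_eq0 => /eqP.
  rewrite -sumrB => hd'; rewrite -[RHS]hd'; apply: eq_bigr => k _.
  rewrite h_fp /z -[- (_ *: u' k)]scaleNr fpD fpZ -scaleNr -scaleNr -addrA -scalerDl.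
  by congr (_ + _ *: _); ring.
(* The coefficients of f e d. The factor j - m is the weight 2j - m - 1 of u_j minus the j - 1
   coming from e f^j. *)
pose c j := (if j is k.+1 then act e (u' k) else 0) + (j%:R * (j%:R - m%:R)) *: u' j.
have dc j : delta (c j) = 0.
  rewrite /c linearD linearZ /= du' scaler0 addr0; case: j => [|j]; rewrite ?linear0 //.
  by rewrite delta_e du' act0r linear0 subr0.
have u'L : u' L = 0 by rewrite /u' ltnNge le_KL.
have feE : act f (act e d) = \sum_(j < L.+1) fp j (c j).
  rewrite (eq_bigr (fun j : 'I_L.+1 => fp j (if val j is k.+1 then act e (u' k) else 0)
      + (j%:R * (j%:R - m%:R)) *: fp j (u' j))); last by move=> j _; rewrite fpD fpZ.
  rewrite big_split /= big_ord_recl fp0 add0r [X in _ + X]big_ord_recr /= u'L fp0 scaler0 addr0.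
  rewrite -big_split dE' !linear_sum /=; apply: eq_bigr => j _.
  rewrite e_fp hu -scalerBl actDr actZr -iterS; congr (_ + _).
  case: (val j) => [|k] /=; first by rewrite !mul0r !scale0r.
  rewrite -iterS fpZ scalerA; congr (_ *: _).
  by rewrite -[m.+1]addn1 natrD; ring.
have fwE : fp m.+1 w = \sum_(j < L.+1) fp j (y' j).
  rewrite (@fp_shift m.+1) => [|j lt_j|]; first last.
  - by rewrite /L; lia.
  - by rewrite /y' ltnNge -ltnS lt_j.
  congr (iter _ _ _); rewrite yE (big_ord_widen (L.+1 - m.+1) (fun j => fp j (y j))).
    rewrite big_mkcond; apply: eq_bigr => j _; rewrite /y' addnK.
    by rewrite addnS ltnS leq_addl; case: ifP => // _; rewrite fp0.
  by rewrite /L; lia.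
have cy j : (j <= m)%N -> c j = 0.
  move=> le_j; have -> : c j = c j - y' j by rewrite /y' ltnNge le_j subr0.
  apply: (@f_expand_eq0 L.+1 (fun j => c j - y' j)) => [k||].
  - by rewrite linearB /= dc dy' subrr.
  - apply/eqP; rewrite (eq_bigr (fun j : 'I_L.+1 => fp j (c j) - fp j (y' j))); last first.
      by move=> k _; rewrite fpD -scaleN1r fpZ scaleN1r.
    by rewrite sumrB -feE -fwE fed subrr.
  - by rewrite /L; lia.
have cu j : (j < m)%N -> act e (u' j) = (j.+1%:R * (m%:R - j.+1%:R)) *: u' j.+1.
  move=> lt_j; have /eqP := cy _ lt_j; rewrite addr_eq0 -scaleNr => /eqP ->.
  by congr (_ *: _); ring.
have u0 : (0 < m)%N -> u' 0%N = 0.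
  move=> m0; have ee j : (j < m)%N -> exists t, iter j (act e) (u' 0%N) = t *: u' j.
    elim: j => [|j IHj] lt_j; first by exists 1; rewrite scale1r.
    have [t et] := IHj (ltnW lt_j); exists (t * (j.+1%:R * (m%:R - j.+1%:R))).
    by rewrite iterS et actZr cu ?scalerA // ltnW.
  have [N FN] := F0_nilp (u' 0%N).
  (* The weight -(m + 1) of u_0 is a - (m + p), since a + 1 = p. The coefficient in [cu] vanishes at
     j = m - 1, whence e^m u_0 = 0. *)
  apply: (@ee_inj N m (m + p)%N) => //; last 1 first.
  - case: m m0 {hd fed y' dy' L le_KL dE' hu c dc u'L feE fwE cy} ee cu => [//|m] _ ee cu.
    have [t et] := ee m (ltnSn m); rewrite iterS et actZr cu // subrr mulr0 scale0r.
    by rewrite scaler0.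
  - rewrite hu; congr (_ *: _); rewrite natrD -ap -[m.+1]addn1 natrD; ring.
  - exact: leq_addr.
(* As long as j + 1 < m the coefficient in [cu] is nonzero, so that the vanishing of u_j passes to
   u_(j+1). *)
have uz j : (j < m)%N -> u' j = 0.
  elim: j => [|j IHj] lt_j; first exact: u0.
  have := cu j (ltnW lt_j); rewrite IHj ?act0r; last exact: ltnW.
  move=> /esym/eqP; rewrite scaler_eq0 => /orP[|/eqP //].
  by rewrite mulf_eq0 pnatr_eq0 /= subr_eq0 eqr_nat gtn_eqF.
exists (\sum_(j < L - m) fp j (u' (j + m)%N)).
by rewrite dE' (@fp_shift m) // /L; lia.
Qed.

End SimpleRoot.

Section SimpleRootTheorems.
Context (C : numClosedFieldType) (n : nat) (lam : 'rV[C]_n) (i0 i1 : 'I_n).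
Hypothesis i01 : i1 = i0.+1 :> nat.
Context (V : smod C n) (v0 : V) (HV : verma_spec lam v0).

Theorem verma_f_inj v : act (eE C i1 i0) v = 0 -> v = 0 :> V.
Proof.
have [delta [R [d0 dP R0 RP]]] := verma_operators i01 HV.
exact: (f_inj i01 HV d0 dP).
Qed.

Theorem verma_f_divides p m (d w : V) : lam 0 i0 - lam 0 i1 + 1 = p%:R ->
  act (hE C i0 i1) d = - (m.+1)%:R *: d ->
  act (eE C i1 i0) (act (eE C i0 i1) d) = iter m.+1 (act (eE C i1 i0)) w ->
  exists x : V, d = iter m (act (eE C i1 i0)) x.
Proof.
have [delta [R [d0 dP R0 RP]]] := verma_operators i01 HV.
exact: (f_divides i01 HV d0 dP R0 RP).
Qed.

End SimpleRootTheorems.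

(** * Weights *)

Section Kill.
Context (C : numClosedFieldType) (n : nat) (M : smod C n).
Implicit Types (h y : Defs.pe C n) (u v : M).

Definition hprod h (s : seq C) (v : M) : M := foldr (fun c u => act h u - c *: u) v s.

Lemma hprodP h s c u v : hprod h s (c *: u + v) = c *: hprod h s u + hprod h s v.
Proof.
elim: s => //= b s ->; rewrite act_linr scalerBr !scalerDr !scalerA mulrC.
by zmod.
Qed.
Lemma hprod0 h s : hprod h s 0 = 0.
Proof. by have := hprodP h s (-1) 0 0; rewrite scaler0 addr0 scaleN1r addNr. Qed.
Lemma hprodZ h s c u : hprod h s (c *: u) = c *: hprod h s u.
Proof. by rewrite -[c *: u]addr0 hprodP hprod0 addr0. Qed.
Lemma hprodD h s u v : hprod h s (u + v) = hprod h s u + hprod h s v.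
Proof. by rewrite -[u in LHS]scale1r hprodP scale1r. Qed.
Lemma hprod_cat h s t v : hprod h (s ++ t) v = hprod h s (hprod h t v).
Proof. exact: foldr_cat. Qed.
Lemma hprod_act h s v : hprod h s (act h v) = act h (hprod h s v).
Proof. by elim: s => //= c s ->; rewrite actBr actZr. Qed.
Lemma hprodC h s t v : hprod h s (hprod h t v) = hprod h t (hprod h s v).
Proof.
elim: t v => //= c t IH v.
by rewrite -scaleNr hprodD hprod_act hprodZ IH scaleNr.
Qed.
Lemma hprod_eig h s c v : act h v = c *: v ->
  hprod h s v = (\prod_(b <- s) (c - b)) *: v.
Proof.
move=> hv; elim: s => [|b s IH] /=; first by rewrite big_nil scale1r.
by rewrite IH actZr hv big_cons mulrC -scalerA scalerBl !scalerBr !scalerA [b * _]mulrC.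
Qed.

(* [v] is a sum of generalised [h]-eigenvectors with eigenvalues in [L]. *)
Definition kil h (L : C -> Prop) v : Prop :=
  exists2 s : seq C, (forall c, c \in s -> L c) & hprod h s v = 0.

Lemma kilP h L c u v : kil h L u -> kil h L v -> kil h L (c *: u + v).
Proof.
case=> s sL su [t tL tv]; exists (s ++ t).
  by move=> b; rewrite mem_cat => /orP[/sL|/tL].
by rewrite hprodP !hprod_cat [X in c *: X]hprodC su tv !hprod0 scaler0 addr0.
Qed.
Lemma kil0 h L : kil h L 0. Proof. by exists [::]. Qed.
Lemma kilD h L u v : kil h L u -> kil h L v -> kil h L (u + v).
Proof. by move=> hu hv; rewrite -[u]scale1r; exact: kilP. Qed.
Lemma kilZ h L c u : kil h L u -> kil h L (c *: u).
Proof. by move=> hu; rewrite -[c *: u]addr0; apply: kilP => //; exact: kil0. Qed.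
Lemma kil_eig h (L : C -> Prop) c v : L c -> act h v = c *: v -> kil h L v.
Proof.
by move=> Lc hv; exists [:: c] => [b|/=]; rewrite ?inE ?hv ?subrr // => /eqP ->.
Qed.
Lemma kil_mono h (L L' : C -> Prop) v : (forall c, L c -> L' c) -> kil h L v -> kil h L' v.
Proof. by move=> LL [s sL sv]; exists s => // c /sL /LL. Qed.

(** The two annihilating products are coprime: once all factors but one of the second are applied,
    the remaining h - c leaves an eigenvector or zero, and the first product acts on it by a nonzero
    scalar. *)
Lemma kil_disjoint h (L1 L2 : C -> Prop) v : (forall c, L1 c -> L2 c -> False) ->
  kil h L1 v -> kil h L2 v -> v = 0.
Proof.
move=> dis [s sL sv] [t tL]; elim: t v sv tL => [//|c t IH] v sv tL /= e.
apply: (IH v sv) => [b bt|]; first by apply: tL; rewrite inE bt orbT.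
set w := hprod h t v in e *.
have hw : act h w = c *: w by apply/eqP; rewrite -subr_eq0 e.
have : hprod h s w = 0 by rewrite /w hprodC sv hprod0.
rewrite (hprod_eig _ hw) => /eqP; rewrite scaler_eq0 => /orP[|/eqP //].
rewrite prodf_seq_eq0 => /hasP[b bs]; rewrite /= subr_eq0 => /eqP cb.
by case: (dis c); [rewrite cb; exact: sL|apply: tL; rewrite inE eqxx].
Qed.

Lemma kil_act h a y t (L1 L2 : C -> Prop) v : homog false h -> homog a y ->
  pe_bracket h y = t *: y -> (forall c, L1 c -> L2 (c + t)) ->
  kil h L1 v -> kil h L2 (act y v).
Proof.
move=> hh hy hty LL [s sL sv]; exists [seq c + t | c <- s].
  by move=> c /mapP[b /sL bL ->]; exact: LL.
suff -> : forall s, hprod h [seq c + t | c <- s] (act y v) = act y (hprod h s v).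
  by rewrite sv act0r.
elim=> //= c s' ->; rewrite (act_comm_el _ hh hy) hty actZl actBr actZr scalerDl.
by zmod.
Qed.

End Kill.

Section ShomLinear.
Context (C : numClosedFieldType) (n : nat) (M N : smod C n) (f : shom M N).
Lemma shom0 : f 0 = 0. Proof. exact: linear0. Qed.
Lemma shomD u v : f (u + v) = f u + f v. Proof. exact: linearD. Qed.
Lemma shomB u v : f (u - v) = f u - f v. Proof. exact: linearB. Qed.
Lemma shomZ c u : f (c *: u) = c *: f u. Proof. exact: linearZ. Qed.
Lemma shomP c u v : f (c *: u + v) = c *: f u + f v. Proof. exact: linearP. Qed.
End ShomLinear.

Lemma kil_hom (C : numClosedFieldType) (n : nat) (M N : smod C n) (f : shom M N)
  (h : pe C n) (L : C -> Prop) (v : M) : kil h L v -> kil h L (f v).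
Proof.
case=> s sL sv; exists s => //.
have -> : hprod h s (f v) = f (hprod h s v).
  by elim: s {sL sv} => //= c s ->; rewrite shomB shomZ shom_act.
by rewrite sv shom0.
Qed.

(** * Sums of weight vectors *)

Section WeightSums.
Context (C : numClosedFieldType) (n : nat) (M : smod C n).
Implicit Types (h y : Defs.pe C n) (u v : M).

Definition wsum (v : M) : Prop := exists2 s : seq ('rV[C]_n * M),
  (forall p, p \in s -> weight_vector p.1 p.2) & v = \sum_(p <- s) p.2.

Lemma wsum0 : wsum 0. Proof. by exists [::]; rewrite ?big_nil. Qed.
Lemma wsumD u v : wsum u -> wsum v -> wsum (u + v).
Proof.
case=> s sw -> [t tw ->]; exists (s ++ t); last by rewrite big_cat.
by move=> p; rewrite mem_cat => /orP[/sw|/tw].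
Qed.
Lemma weight_vectorZ g c v : weight_vector g v -> weight_vector g (c *: v).
Proof. by move=> gv h ch; rewrite actZr gv // !scalerA mulrC. Qed.
Lemma weight_vectorD g u v : weight_vector g u -> weight_vector g v -> weight_vector g (u + v).
Proof. by move=> gu gv h ch; rewrite actDr gv // gu // scalerDr. Qed.
Lemma wsumZ c v : wsum v -> wsum (c *: v).
Proof.
case=> s sw ->; exists [seq (p.1, c *: p.2) | p <- s].
  by move=> _ /mapP[p /sw pw ->] /=; exact: weight_vectorZ.
by rewrite big_map scaler_sumr.
Qed.
Lemma wsum_weight g v : weight_vector g v -> wsum v.
Proof.
by move=> gv; exists [:: (g, v)]; rewrite ?big_seq1 // => p; rewrite inE => /eqP ->.
Qed.

Lemma weight_vector_act g g' a y v : homog a y -> rootv g' y -> weight_vector g v ->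
  weight_vector (g + g') (act y v).
Proof.
move=> hy ry gv h ch; rewrite (act_comm_el _ (cartan_homog ch) hy) gv // ry //.
by rewrite actZr actZl -scalerDl weight_valD.
Qed.

Lemma wsum_act y v : wsum v -> wsum (act y v).
Proof.
case=> s sw ->; elim: s sw => [|p s IH] sw; first by rewrite big_nil act0r; exact: wsum0.
rewrite big_cons actDr; apply: wsumD; last first.
  by apply: IH => q qs; apply: sw; rewrite inE qs orbT.
have pw : weight_vector p.1 p.2 by apply: sw; rewrite inE eqxx.
clear IH; move: y; apply: pe_span => [c x y hx hy|||i j|i j].
- by rewrite act_linl; apply: wsumD => //; exact: wsumZ.
- by rewrite act0l; exact: wsum0.
- by move=> i j; apply: wsum_weight; exact: weight_vector_act (homog_eE _ _ _) (rootv_eE _ _) pw.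
- by apply: wsum_weight; exact: weight_vector_act (homog_sB _ _ _) (rootv_sB _ _) pw.
- by apply: wsum_weight; exact: weight_vector_act (homog_cD _ _ _) (rootv_cD _ _) pw.
Qed.

Lemma wsum_cartan_semisimple : (forall v, wsum v) <-> cartan_semisimple M.
Proof.
split=> hM v.
  have [s sw ->] := hM v; pose x0 : 'rV[C]_n * M := (0, 0).
  exists (size s), (fun i => (nth x0 s i).2), (fun i => (nth x0 s i).1); split.
    by rewrite (big_nth x0) big_mkord.
  by move=> i; apply: sw; exact: mem_nth.
have [k [u [g [-> ug]]]] := hM v; elim/big_ind: _ => [||i _]; [exact: wsum0|exact: wsumD|].
exact: wsum_weight (ug i).
Qed.

End WeightSums.

Section WeightLift.
Context (C : numClosedFieldType) (n : nat) (M N : smod C n).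

(* Projects to a weight space with polynomials in the Cartan elements. *)
Lemma weight_lift (p : shom M N) (q : N) g : cartan_semisimple M ->
  (exists x, p x = q) -> weight_vector g q -> exists x, p x = q /\ weight_vector g x.
Proof.
move=> ssM [x px] gq; have [s sw xs] := (wsum_cartan_semisimple M).2 ssM x.
(* Here w gathers the terms already known to have weight g. A remaining term either joins it or is
   annihilated by an operator [op] that fixes w and, on the side of N, the vector q. *)
suff H k (t : seq ('rV[C]_n * M)) (w : M) : (size t < k)%N ->
    (forall p, p \in t -> weight_vector p.1 p.2) ->
    weight_vector g w -> p (w + \sum_(r <- t) r.2) = q ->
    exists x, p x = q /\ weight_vector g x.
  apply: (H (size s).+1 s 0 _ sw) => //; last by rewrite add0r -xs.
  by move=> h ch; rewrite act0r scaler0.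
elim: k t w => [//|k IH] [|r t] w lt_k tw gw pw.
  by exists w; split => //; rewrite big_nil addr0 in pw.
have [rw tw'] : weight_vector r.1 r.2 /\ forall r, r \in t -> weight_vector r.1 r.2.
  by split=> [|r' rt]; apply: tw; rewrite inE ?eqxx // rt orbT.
case: (pselect (forall h, cartan h -> weight_val r.1 h = weight_val g h)) => [e|].
  apply: (IH t (w + r.2)) => //; last by rewrite big_cons addrA in pw.
  by apply: weight_vectorD => // h ch; rewrite -e // rw.
move=> /existsNP[h /not_implyP[ch /eqP ne]].
pose b := weight_val r.1 h.
have d0 : weight_val g h - b != 0 by rewrite subr_eq0 eq_sym.
pose d := (weight_val g h - b)^-1.
pose op (v : M) := d *: (act h v - b *: v).
have opD u v : op (u + v) = op u + op v.
  by rewrite /op actDr [b *: (u + v)]scalerDr -[RHS]scalerDr; congr (_ *: _); zmod.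
have op0 : op 0 = 0 by rewrite /op act0r scaler0 subr0 scaler0.
have opg : op w = w by rewrite /op gw // -scalerBl scalerA mulVf ?scale1r.
have opr : op r.2 = 0 by rewrite /op rw // subrr scaler0.
have opt r' : r' \in t -> op r'.2 = (d * (weight_val r'.1 h - b)) *: r'.2.
  by move=> /tw' rw'; rewrite /op rw' // -scalerBl scalerA.
apply: (IH [seq (r'.1, (d * (weight_val r'.1 h - b)) *: r'.2) | r' <- t] w) => //.
- by rewrite size_map.
- by move=> _ /mapP[r' /tw' rw' ->]; exact: weight_vectorZ.
have -> : \sum_(r' <- [seq (r'.1, (d * (weight_val r'.1 h - b)) *: r'.2) | r' <- t]) r'.2
    = \sum_(r' <- t) op r'.2.
  by rewrite big_map; apply: eq_big_seq => r' /opt ->.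
have -> : w + \sum_(r' <- t) op r'.2 = op (w + \sum_(r' <- r :: t) r'.2).
  by rewrite big_cons !opD opg opr add0r; congr (_ + _); apply/esym/big_morph.
by rewrite /op shomZ shomB shomZ shom_act pw gq // -scalerBl scalerA mulVf ?scale1r.
Qed.

End WeightLift.

Section DiagonalElements.
Context (C : numClosedFieldType) (n : nat).
Implicit Types (h x y : Defs.pe C n).

Lemma cartan_blocks x : is_diag_mx (ul x) -> ur x = 0 -> dl x = 0 -> cartan x.
Proof.
move=> /is_diag_mxP dx urx dlx; apply/is_diag_mxP => k l kl.
rewrite [x : 'M_(n + n)]pe_blockE urx dlx.
case: (split_ordP k) kl => k' ->; case: (split_ordP l) => l' -> kl.
- by rewrite block_mxEul dx //; apply: contra kl => /eqP ->.
- by rewrite block_mxEur mxE.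
- by rewrite block_mxEdl mxE.
- rewrite block_mxEdr mxE mxE dx ?oppr0 // eq_sym; apply: contra kl => /eqP e.
  by rewrite /= e.
Qed.

Definition diagE (d : 'rV[C]_n) : Defs.pe C n := mkpe (diag_mx d) 0 0.
Lemma cartan_diagE d : cartan (diagE d).
Proof.
apply: cartan_blocks; rewrite ?ul_mkpe ?diag_mx_is_diag ?ur_mkpe ?dl_mkpe ?trmx0 //.
  by rewrite addr0.
by rewrite subr0.
Qed.
Lemma ul_diagE d (i : 'I_n) : ul (diagE d) i i = d 0 i.
Proof. by rewrite ul_mkpe diag_mx_diag. Qed.

(** All roots take integral values on such h, so that the action of g preserves the cosets of its
    eigenvalues modulo the integers. *)
Definition integral_cartan h : Prop :=
  cartan h /\ forall i : 'I_n, exists z : int, ul h i i = z%:~R.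

Lemma integral_hE (i j : 'I_n) : integral_cartan (hE C i j).
Proof.
split; first exact: cartan_h.
by move=> k; exists ((k == i)%:Z - (k == j)%:Z); rewrite ulBe !ul_eEe !andbb rmorphB.
Qed.

(** The booleans choose the signs that distinguish the three families of roots. *)
Lemma int_eps h (i j : 'I_n) (s t : bool) : integral_cartan h ->
  exists z : int, weight_val ((-1) ^+ s *: epsw C i + (-1) ^+ t *: epsw C j) h = z%:~R.
Proof.
move=> [ch hz]; have [zi ei] := hz i; have [zj ej] := hz j.
exists ((-1) ^+ s * zi + (-1) ^+ t * zj).
have wZ (b : bool) k : weight_val ((-1) ^+ b *: epsw C k) h = (-1) ^+ b * ul h k k.
  by case: b; rewrite ?expr1 ?expr0 ?scaleN1r ?scale1r ?weight_valN ?mulN1r ?mul1r weight_val_eps.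
by rewrite weight_valD !wZ ei ej rmorphD !rmorphM !rmorphXn /= rmorphN1.
Qed.

End DiagonalElements.

Definition zcoset (C : numClosedFieldType) (a c : C) : Prop := exists z : int, c = a + z%:~R.

Lemma kil_int_act (C : numClosedFieldType) (n : nat) (M : smod C n) h a x (v : M) :
  integral_cartan h -> kil h (zcoset a) v -> kil h (zcoset a) (act x v).
Proof.
move=> hi hv; have [ch _] := hi.
have K b y t (z : int) : homog b y -> pe_bracket h y = t *: y -> t = z%:~R ->
    kil h (zcoset a) (act y v).
  move=> hy hty tz; apply: (kil_act (cartan_homog ch) hy hty) hv => c [z' ->].
  by exists (z' + z); rewrite tz rmorphD addrA.
move: x; apply: pe_span => [c x y hx hy||i j|i j|i j].
- by rewrite act_linl; exact: kilP.
- by rewrite act0l; exact: kil0.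
- have [z ez] := int_eps i j false true hi; rewrite expr0 scale1r expr1 scaleN1r in ez.
  exact: K (homog_eE _ _ _) (rootv_eE _ _ ch) ez.
- have [z ez] := int_eps i j false false hi; rewrite expr0 !scale1r in ez.
  exact: K (homog_sB _ _ _) (rootv_sB _ _ ch) ez.
- have [z ez] := int_eps i j true true hi; rewrite expr1 !scaleN1r -opprD in ez.
  exact: K (homog_cD _ _ _) (rootv_cD _ _ ch) ez.
Qed.

(** * The highest weight line of a Verma module *)

Section VermaWeights.
Context (C : numClosedFieldType) (n : nat) (lam : 'rV[C]_n).
Context (V : smod C n) (v0 : V) (HV : verma_spec lam v0).
Implicit Types (h x y : Defs.pe C n) (u v w : V).

Lemma verma_weight : weight_vector lam v0.
Proof. by move=> h ch; rewrite (vs_borel HV) //; exact: cartan_borel. Qed.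

Lemma verma_semisimple : cartan_semisimple V.
Proof.
apply/wsum_cartan_semisimple => v; elim/(vs_span HV): v => [c u v hu hv||x v hv].
- by apply: wsumD => //; exact: wsumZ.
- exact: wsum_weight verma_weight.
- exact: wsum_act.
Qed.

Lemma verma_kil_int h v : integral_cartan h -> kil h (zcoset (weight_val lam h)) v.
Proof.
move=> hi; have [ch _] := hi.
elim/(vs_span HV): v => [c u v hu hv||x v hv]; [exact: kilP| |exact: kil_int_act].
apply: (@kil_eig _ _ _ _ _ (weight_val lam h)); last exact: verma_weight.
by exists 0; rewrite addr0.
Qed.

(** The coefficient of the highest weight vector, which is the augmentation of the enveloping
    algebra of the negative part; freeness is applied to the zero action on C. *)
Lemma verma_counit : exists eps : {linear V -> C^o},
  eps v0 = 1 /\ forall y v, mneg y -> eps (act y v) = 0.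
Proof.
apply: (vs_free HV (l := fun _ _ => 0) 1) => *; rewrite ?scaler0 ?addr0 ?subr0 //.
Qed.

Context (eps : {linear V -> C^o}).
Hypotheses (eps0 : eps v0 = 1) (epsP : forall y v, mneg y -> eps (act y v) = 0).

(** The element diag(n, n - 1, ..., 1), on which all roots of the negative part, even and odd, take
    negative integral values. *)
Definition h0 : Defs.pe C n := diagE (\row_(i < n) (n - i)%:R).
Lemma cartan_h0 : cartan h0. Proof. exact: cartan_diagE. Qed.
Lemma ul_h0 (i : 'I_n) : ul h0 i i = (n - i)%:R.
Proof. by rewrite ul_diagE mxE. Qed.

(** What [eps] does not see involves at least one negative letter, and each letter lowers the
    eigenvalue of [h0] by a positive integer. *)
Lemma verma_kil_h0 v :
  kil h0 (fun c => exists k : nat, c = weight_val lam h0 - k.+1%:R) (v - eps v *: v0).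
Proof.
set L := (fun c => _).
have K y : mneg y -> forall v,
    kil h0 (fun c => exists k : nat, c = weight_val lam h0 - k%:R) v -> kil h0 L (act y v).
  move=> my {}v hv.
  have K a x t (m : nat) : homog a x -> pe_bracket h0 x = t *: x -> t = - m.+1%:R ->
      kil h0 L (act x v).
    move=> hx htx tm; apply: (kil_act (cartan_homog cartan_h0) hx htx) hv => c [k ->].
    by exists (k + m)%N; rewrite tm -addrA -opprD -natrD addnS.
  move: y my; apply: mneg_span => [c x y hx hy||i j ij|i j].
  - by rewrite act_linl; exact: kilP.
  - by rewrite act0l; exact: kil0.
  - apply: (K _ _ _ (i - j).-1) (homog_eE _ _ _) (rootv_eE _ _ cartan_h0) _.
    rewrite weight_valD weight_valN !weight_val_eps !ul_h0.
    rewrite prednK ?subn_gt0 // -opprB -natrB; last by rewrite leq_sub2l // ltnW.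
    by congr (- _%:R); have := ltn_ord i; lia.
  - apply: (K _ _ _ ((n - i) + (n - j)).-1) (homog_cD _ _ _) (rootv_cD _ _ cartan_h0) _.
    rewrite weight_valN weight_valD !weight_val_eps !ul_h0 -natrD prednK //.
    by have := ltn_ord i; lia.
have k0 u : kil h0 L (u - eps u *: v0) ->
    kil h0 (fun c => exists k : nat, c = weight_val lam h0 - k%:R) u.
  move=> hu; rewrite -[u](subrK (eps u *: v0)); apply: kilD.
    by apply: kil_mono hu => c [k ->]; exists k.+1.
  apply: kilZ; apply: (@kil_eig _ _ _ _ _ (weight_val lam h0)).
    by exists 0%N; rewrite subr0.
  exact: verma_weight cartan_h0.
elim/(vs_ind HV): v => [c u v hu hv||a y v hy my IH].
- have -> : c *: u + v - eps (c *: u + v) *: v0 = c *: (u - eps u *: v0) + (v - eps v *: v0).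
    rewrite linearP /= scalerDl scalerBr -scalerA; zmod.
  exact: kilP.
- by rewrite eps0 scale1r subrr; exact: kil0.
by rewrite epsP // scale0r subr0; apply: K => //; exact: k0.
Qed.

Lemma verma_top_weight v : weight_vector lam v -> v = eps v *: v0.
Proof.
move=> lv; apply/eqP; rewrite -subr_eq0; apply/eqP.
apply: kil_disjoint (verma_kil_h0 v) (_ : kil h0 (fun c => c = weight_val lam h0) _).
  move=> c [k ->] /eqP; rewrite -subr_eq0 addrAC subrr add0r oppr_eq0.
  by rewrite pnatr_eq0.
apply: (@kil_eig _ _ _ _ _ (weight_val lam h0)) => //.
rewrite actBr actZr lv ?verma_weight ?scalerBr ?scalerA; try exact: cartan_h0.
by rewrite mulrC.
Qed.

(** The product of factors [h0] - c that annihilates v - eps(v) v0 preserves S and maps v to a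
    nonzero multiple of v0. *)
Lemma verma_proper (S : submod V) v : v \in S -> eps v != 0 -> v0 \in S.
Proof.
move=> vS ev; have [s sL sv] := verma_kil_h0 v.
have hS t u : u \in S -> hprod h0 t u \in S.
  by move=> uS; elim: t => //= c t IH; rewrite -scaleNr rpredD ?rpredZ // submod_act.
have /eqP := sv; rewrite -scaleNr addrC hprodP addrC.
rewrite (hprod_eig _ (verma_weight cartan_h0)) addr_eq0 => /eqP e.
have := hS s v vS; rewrite e scalerA -scaleNr => H.
set t := - _ in H; have t0 : t != 0.
  rewrite /t oppr_eq0 mulf_neq0 ?oppr_eq0 // prodf_seq_neq0; apply/allP => c /sL [k ->] /=.
  by rewrite opprB addrC addrNK pnatr_eq0.
have : t^-1 *: (t *: v0) \in S by rewrite rpredZ.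
by rewrite scalerA mulVf // scale1r.
Qed.

End VermaWeights.

Lemma lincombD (R : pzRingType) (V : lmodType R) c (u v u' v' : V) :
  c *: u + v + (c *: u' + v') = c *: (u + u') + (v + v').
Proof. by rewrite scalerDr addrACA. Qed.
Lemma lincombB (R : pzRingType) (V : lmodType R) c (u v u' v' : V) :
  c *: u + v - (c *: u' + v') = c *: (u - u') + (v - v').
Proof. by rewrite scalerBr opprD addrACA. Qed.

(** * Parity of weight vectors *)

Section VermaParity.
Context (C : numClosedFieldType) (n : nat) (lam : 'rV[C]_n).
Context (V : smod C n) (v0 : V) (HV : verma_spec lam v0).
Implicit Types (h x y : Defs.pe C n) (u v w : V).

(** The grading element: its adjoint action is 2 on g_1, 0 on g_0 and -2 on g_(-1). *)
Definition zE : Defs.pe C n := diagE (const_mx 1).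
Lemma ul_zE (i : 'I_n) : ul zE i i = 1. Proof. by rewrite ul_diagE mxE. Qed.
Lemma cartan_zE : cartan zE. Proof. exact: cartan_diagE. Qed.

Definition zval (b : bool) (c : C) : Prop :=
  exists k : int, c = weight_val lam zE + (4 * k + 2 * b%:Z)%:~R.

(* The parity of a weight vector is read off its [zE]-eigenvalue modulo 4. *)
Lemma verma_kil_parity v : kil zE (zval false) (v + par v) /\ kil zE (zval true) (v - par v).
Proof.
have hz := cartan_homog cartan_zE.
elim/(vs_span HV): v => [c u v [hu hu'] [hv hv']||x v [hv hv']].
- by rewrite par_lin lincombD lincombB; split; exact: kilP.
- rewrite (vs_par HV) subrr; split; last exact: kil0.
  apply: kilD; apply: (@kil_eig _ _ _ _ _ (weight_val lam zE));
    by [exists 0; rewrite mulr0 add0r mulr0 addr0|exact: verma_weight HV _ cartan_zE].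
(* As k is odd, the shift 2k is 2 modulo 4, so that an odd y exchanges the two classes of
   eigenvalues; for even y the shift is 0. *)
have K a y (k : int) : homog a y -> pe_bracket zE y = (2 * k * a%:Z)%:~R *: y ->
    (exists j, k = 2 * j + 1) ->
    kil zE (zval false) (act y v + par (act y v)) /\ kil zE (zval true) (act y v - par (act y v)).
  move=> hy hzy [j jk]; rewrite (par_act _ hy); case: a hy hzy => hy hzy.
    rewrite expr1 scaleN1r opprK -actDr -actBr; split.
      apply: (kil_act hz hy hzy) hv' => c [i ->]; exists (i + j + 1).
      by rewrite -addrA -rmorphD; congr (_ + _%:~R); lia.
    apply: (kil_act hz hy hzy) hv => c [i ->]; exists (i + j).
    by rewrite -addrA -rmorphD; congr (_ + _%:~R); lia.
  rewrite expr0 scale1r -actDr -actBr; split.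
    by apply: (kil_act hz hy hzy) hv => c [i ->]; exists i; rewrite -addrA -rmorphD; congr (_ + _%:~R); lia.
  by apply: (kil_act hz hy hzy) hv' => c [i ->]; exists i; rewrite -addrA -rmorphD; congr (_ + _%:~R); lia.
move: x; apply: pe_span => [c x y [hx hx'] [hy hy']||i j|i j|i j].
- by rewrite act_linl par_lin lincombD lincombB; split; exact: kilP.
- by rewrite act0l par0 subrr addr0; split; exact: kil0.
- apply: (K _ _ 1) (homog_eE _ _ _) _ _; last by exists 0.
  rewrite (rootv_eE _ _ cartan_zE) weight_valD weight_valN !weight_val_eps !ul_zE.
  by rewrite subrr mulr0.
- apply: (K _ _ 1) (homog_sB _ _ _) _ _; last by exists 0.
  by rewrite (rootv_sB _ _ cartan_zE) weight_valD !weight_val_eps !ul_zE !mulr1 -(natrD _ 1 1).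
- apply: (K _ _ (-1)) (homog_cD _ _ _) _ _; last by exists (-1).
  rewrite (rootv_cD _ _ cartan_zE) weight_valN weight_valD !weight_val_eps !ul_zE !mulr1.
  by rewrite mulrN1 rmorphN -(natrD _ 1 1).
Qed.

(** The vectors v + par v and v - par v have the same [zE]-eigenvalue, which lies in at most one of
    the two classes; the vector that belongs to the other class vanishes. *)
Lemma verma_parity g v : weight_vector g v -> exists b : bool, par v = (-1) ^+ b *: v.
Proof.
move=> gv; have [h0 h1] := verma_kil_parity v.
have hz := cartan_homog cartan_zE.
have pz u : par (act zE u) = act zE (par u) by rewrite (par_act _ hz) expr0 scale1r.
have zv : act zE v = weight_val g zE *: v by apply: gv cartan_zE.
have zpv : act zE (par v) = weight_val g zE *: par v by rewrite -pz zv parZ.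
case: (pselect (zval false (weight_val g zE))) => [[k gk]|nk].
  exists false; rewrite expr0 scale1r; apply/esym/eqP; rewrite -subr_eq0; apply/eqP.
  apply: kil_disjoint h1 (_ : kil zE (fun c => c = weight_val g zE) _).
    move=> c [j ->] /eqP; rewrite gk => /eqP /addrI /eqP; rewrite eqr_int => /eqP; lia.
  by apply: (@kil_eig _ _ _ _ _ (weight_val g zE)) => //; rewrite actBr zv zpv scalerBr.
exists true; rewrite expr1 scaleN1r; apply/eqP; rewrite -addr_eq0 addrC; apply/eqP.
apply: kil_disjoint h0 (_ : kil zE (fun c => c = weight_val g zE) _).
  by move=> c + e; rewrite e.
by apply: (@kil_eig _ _ _ _ _ (weight_val g zE)) => //; rewrite actDr zv zpv scalerDr.
Qed.

End VermaParity.

(** * Singular vectors for simple roots *)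

Section SingularVectors.
Context (C : numClosedFieldType) (n : nat) (mu : 'rV[C]_n) (i0 i1 : 'I_n).
Hypothesis i01 : i1 = i0.+1 :> nat.
Context (V : smod C n) (v0 : V) (HV : verma_spec mu v0).
Implicit Types (h x y : Defs.pe C n) (u v w : V).
Local Notation e := (eE C i0 i1).
Local Notation f := (eE C i1 i0).
Local Notation h := (hE C i0 i1).
Local Notation a := (mu 0 i0 - mu 0 i1).

(** As the root is simple, the elements of the nilradical without component along e are stable under
    ad(f). They can be moved through f^j to v0, which they kill. *)
Lemma nilpotent_kills x j : dl x = 0 -> (forall k l : 'I_n, (l <= k)%N -> ul x k l = 0) ->
  ul x i0 i1 = 0 -> act x (iter j (act f) v0) = 0.
Proof.
elim: j x => [|j IH] x dx ux x01 /=.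
  rewrite (vs_borel HV); last by apply/borelE; split=> // k l kl; rewrite ux // ltnW.
  by rewrite weight_valE big1 ?scale0r // => k _; rewrite ux ?mulr0.
rewrite (act_comm _ _ (homog_eE _ _ _)) thE IH // act0r add0r.
have uf : ul (pe_bracket x f) = ul x *m delta_mx i1 i0 - delta_mx i1 i0 *m ul x.
  by rewrite ul_bracket ur_eE dl_eE mul0mx mulmx0 !add0r ul_eE.
have ufe k l : ul (pe_bracket x f) k l = ul x k i1 * (l == i0)%:R - (k == i1)%:R * ul x i0 l.
  by rewrite uf mxE [X in _ + X]mxE mul_delta delta_mul.
apply: IH.
- by rewrite dl_bracket dx dl_eE !(mul0mx, mulmx0, addr0, oppr0).
- move=> k l lk; rewrite ufe; have -> : ul x k i1 * (l == i0)%:R = 0.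
    case: eqP => [el|]; rewrite ?mulr0 // mulr1.
    case: (ltnP k i1) => [ki1|/ux -> //].
    have -> : k = i0 by apply/val_inj => /=; move: lk ki1; rewrite el i01 ltnS => *; apply/eqP; rewrite eqn_leq; apply/andP.
    exact: x01.
  case: eqP => [ek|]; rewrite ?mul0r ?subrr // mul1r sub0r.
  case: (leqP l i0) => [/ux ->|il]; first by rewrite oppr0.
  have -> : l = i1 by apply/val_inj => /=; apply/eqP; rewrite eqn_leq -{1}ek lk i01.
  by rewrite x01 oppr0.
- by rewrite ufe i10_neq // i01_neq // mulr0 mul0r subrr.
Qed.

Lemma e_iter_f j : act e (iter j (act f) v0) = (j%:R * (a - j%:R + 1)) *: iter j.-1 (act f) v0.
Proof.
rewrite (e_fp i01) (vs_borel HV); last exact: borel_e.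
have -> : weight_val mu e = 0.
  rewrite weight_valE big1 // => i _; rewrite ul_eEe.
  by case: eqP => [->|_]; rewrite ?(i01_neq i01) /= mulr0.
rewrite scale0r iter0 ?act0r // add0r (verma_weight HV) ?weight_h //; last exact: cartan_h.
rewrite -scalerBl iter_linZ ?scalerA; last exact: act_linr.
by congr (_ *: _); ring.
Qed.

Lemma iter_f_weight j : weight_vector (mu + j%:R *: (epsw C i1 - epsw C i0)) (iter j (act f) v0).
Proof.
elim: j => [|j IH]; first by rewrite scale0r addr0; exact: verma_weight HV.
have := weight_vector_act (homog_eE C i1 i0) (rootv_eE i1 i0) IH.
by rewrite -addrA -[X in _ + (_ + X)]scale1r -scalerDl -natr1.
Qed.

(** A Borel element is the sum of a diagonal one, a multiple of e and an element covered by
    [nilpotent_kills]. The coefficient m (a - m + 1) of e f^m v0 vanishes. *)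
Lemma singular_vector m : a + 1 = m%:R -> forall x, borel x ->
  act x (iter m (act f) v0) = weight_val (mu + m%:R *: (epsw C i1 - epsw C i0)) x *: iter m (act f) v0.
Proof.
move=> am x bx; have [dx ux] := (borelE x).1 bx.
set g := _ + _; pose d := diagE (\row_i ul x i i).
pose y := x - d - ul x i0 i1 *: e.
have xE : x = y + (d + ul x i0 i1 *: e).
  by rewrite /y -[x - d - _]addrA -opprD subrK.
have gd : weight_val g d = weight_val g x.
  by rewrite !weight_valE; apply: eq_bigr => i _; rewrite ul_diagE mxE.
have e0 : act e (iter m (act f) v0) = 0.
  by rewrite e_iter_f addrAC am subrr mulr0 scale0r.
have ue (k l : 'I_n) : ul y k l = ul x k l - diag_mx (\row_i ul x i i) k l
    - ul x i0 i1 * ((k == i0) && (l == i1))%:R.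
  by rewrite /y !ulBe ulZe ul_eEe /d ul_mkpe.
have y0 : act y (iter m (act f) v0) = 0.
  apply: nilpotent_kills => [|k l lk|].
  - by rewrite /y !dlB dlZ dl_eE scaler0 subr0 dx /d dl_mkpe trmx0 !subr0.
  - rewrite ue; have -> : (k == i0) && (l == i1) = false.
      by apply: contraTF lk => /andP[/eqP -> /eqP ->]; rewrite i01 ltnn.
    rewrite mulr0 subr0 [diag_mx _ _ _]mxE; case: (k =P l) => [->|ne].
      by rewrite mulr1n [(\row_i _) _ _]mxE subrr.
    by rewrite mulr0n subr0 ux // ltn_neqAle lk andbT; apply/eqP => /val_inj ee; apply: ne.
  - by rewrite ue !eqxx mulr1 [diag_mx _ _ _]mxE i01_neq // subr0 subrr.
rewrite [in LHS]xE actDl actDl actZl e0 scaler0 addr0 y0 add0r.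
by rewrite iter_f_weight ?gd //; exact: cartan_diagE.
Qed.

End SingularVectors.

(** * Morphisms and finite spans *)

Section Morphisms.
Context (C : numClosedFieldType) (n : nat).
Implicit Types (M N K : smod C n).

Lemma shom_inv M N (f : shom M N) : bijective f ->
  exists g : shom N M, cancel f g /\ cancel g f.
Proof.
case=> g fK gK.
have gl c u v : g (c *: u + v) = c *: g u + g v.
  by apply: (can_inj fK); rewrite shomP !gK.
have ga x v : g (act x v) = act x (g v).
  by apply: (can_inj fK); rewrite shom_act !gK.
by exists (mk_shom gl ga).
Qed.

Lemma inj_surj_bij M N (f : shom M N) : (forall x, f x = 0 -> x = 0) ->
  (forall y, exists x, f x = y) -> bijective f.
Proof.
move=> finj fsurj; pose g y := proj1_sig (cid (fsurj y)).
have gK : cancel g f by move=> y; rewrite /g; case: cid.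
exists g => // x; apply/eqP; rewrite -subr_eq0; apply/eqP/finj.
by rewrite shomB gK subrr.
Qed.

Lemma shom_id M : exists f : shom M M, forall x, f x = x.
Proof.
by exists (@mk_shom C n M M id (fun c u v => erefl) (fun x v => erefl)).
Qed.

Lemma shom_comp M N K (g : shom N K) (f : shom M N) :
  exists k : shom M K, forall x, k x = g (f x).
Proof.
have kl c u v : g (f (c *: u + v)) = c *: g (f u) + g (f v) by rewrite !shomP.
have ka x v : g (f (act x v)) = act x (g (f v)) by rewrite !shom_act.
by exists (mk_shom kl ka).
Qed.

Lemma shom_lincomb M N c (f g : shom M N) :
  exists k : shom M N, forall x, k x = c *: f x + g x.
Proof.
have kl d u v : c *: f (d *: u + v) + g (d *: u + v) = d *: (c *: f u + g u) + (c *: f v + g v).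
  by rewrite !shomP !scalerDr !scalerA [c * d]mulrC; zmod.
have ka x v : c *: f (act x v) + g (act x v) = act x (c *: f v + g v).
  by rewrite !shom_act actDr actZr.
by exists (mk_shom kl ka).
Qed.

Lemma shom_zero M N : exists k : shom M N, forall x, k x = 0.
Proof.
have kl c (u v : M) : (0 : N) = c *: 0 + 0 by rewrite scaler0 addr0.
have ka x (v : M) : (0 : N) = act x 0 by rewrite act0r.
by exists (mk_shom (f := fun=> 0) kl ka).
Qed.

Lemma shom_sum M N (I : finType) (c : I -> C) (f : I -> shom M N) :
  exists k : shom M N, forall x, k x = \sum_i c i *: f i x.
Proof.
suff [k kE] : exists k : shom M N, forall x, k x = \sum_(i <- enum I) c i *: f i x.
  by exists k => x; rewrite kE big_enum.
elim: (enum I) => [|i s [k kE]].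
  by have [k kE] := shom_zero M N; exists k => x; rewrite kE big_nil.
by have [k' kE'] := shom_lincomb (c i) (f i) k; exists k' => x; rewrite kE' kE big_cons.
Qed.

(** Later proofs use the quotient map only through these properties and never through
    representatives. *)
Lemma qproj_exists M (S : submod M) : exists q : shom M (quot_smod S),
  [/\ forall y, exists x, q x = y, forall x, q x = 0 <-> x \in S &
      forall x, par (q x) = q (par x)].
Proof.
pose q (v : M) : quot_smod S := proj S v.
have ql c u v : q (c *: u + v) = c *: q u + q v by exact: proj_is_linear.
have qa x v : q (act x v) = act x (q v) by rewrite /q /= act_proj.
exists (mk_shom ql qa); split=> [|x|x].
- by elim/projW => v; exists v.
- rewrite /= /q; split=> [e|xS].
    have /projP := etrans e (esym (proj0 S)); rewrite subr0; exact.
  by apply: etrans (proj0 S); apply/projP; rewrite subr0.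
by rewrite /= /q par_proj.
Qed.

Lemma sincl_exists M (S : submod M) : exists i : shom (sub_smod S) M,
  [/\ forall x, i x = subspace_val x, forall x, i x = 0 -> x = 0, forall x, i x \in S,
      forall y, y \in S -> exists x, i x = y & forall x, i (par x) = par (i x)].
Proof.
pose i (v : sub_smod S) : M := subspace_val v.
have il c u v : i (c *: u + v) = c *: i u + i v by [].
have ia x v : i (act x v) = act x (i v) by [].
exists (mk_shom il ia); split=> // [x|x|y yS].
- by move=> e; apply/val_inj.
- exact: (valP x).
- by exists (SubspaceOf yS).
Qed.

Lemma submodN M (S : submod M) x : x \in S -> - x \in S.
Proof. by move=> xS; rewrite -scaleN1r rpredZ. Qed.
Lemma submodB M (S : submod M) x y : x \in S -> y \in S -> x - y \in S.
Proof. by move=> xS yS; rewrite rpredD ?submodN. Qed.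

(** Submodules are graded, whereas a [shom] may fail to respect [par]; the hypothesis bridges this,
    as does the one for images below. *)
Lemma shom_ker M N (f : shom M N) : (forall x, f x = 0 -> f (par x) = 0) ->
  exists S : submod M, forall x, x \in S <-> f x = 0.
Proof.
move=> hp.
have [P0 [Pl Pa]] : f 0 = 0 /\ (forall c u v, f u = 0 -> f v = 0 -> f (c *: u + v) = 0) /\
    (forall x v, f v = 0 -> f (act x v) = 0).
  split; first exact: shom0.
  split=> [c u v fu fv|x v fv]; first by rewrite shomP fu fv scaler0 addr0.
  by rewrite shom_act fv act0r.
exists (prop_submod P0 Pl Pa hp) => x; exact: prop_submodP.
Qed.

Lemma shom_im M N (f : shom M N) : (forall x, exists y, par (f x) = f y) ->
  exists S : submod N, forall y, y \in S <-> exists x, f x = y.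
Proof.
move=> hp; pose P y := exists x, f x = y.
have P0 : P 0 by exists 0; exact: shom0.
have Pl c u v : P u -> P v -> P (c *: u + v).
  by move=> [x <-] [y <-]; exists (c *: x + y); rewrite shomP.
have Pa x v : P v -> P (act x v) by move=> [y <-]; exists (act x y); rewrite shom_act.
have Pp v : P v -> P (par v) by move=> [x <-]; have [y ->] := hp x; exists y.
by exists (prop_submod P0 Pl Pa Pp) => y; exact: prop_submodP.
Qed.

Lemma sub_factor M N (S : submod N) (f : shom M N) : (forall x, f x \in S) ->
  exists g : shom M (sub_smod S), forall x, subspace_val (g x) = f x.
Proof.
move=> fS; pose g x : sub_smod S := SubspaceOf (fS x).
have gl c u v : g (c *: u + v) = c *: g u + g v by apply/val_inj; rewrite /= shomP.
have ga x v : g (act x v) = act x (g v) by apply/val_inj; rewrite /= shom_act.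
by exists (mk_shom gl ga).
Qed.

End Morphisms.

(** * Local finiteness over the nilradical *)

Section FiniteSpan.
Context (C : numClosedFieldType) (n : nat) (M : smod C n).
Implicit Types (x y : Defs.pe C n) (u v w : M) (s : seq M).

Definition fspan s u : Prop := exists c : 'I_(size s) -> C, u = \sum_i c i *: s`_i.

Lemma fspanP s c u v : fspan s u -> fspan s v -> fspan s (c *: u + v).
Proof.
move=> [a ->] [b ->]; exists (fun i => c * a i + b i).
by rewrite scaler_sumr -big_split; apply: eq_bigr => i _; rewrite scalerDl scalerA.
Qed.
Lemma fspan0 s : fspan s 0.
Proof. by exists (fun=> 0); rewrite big1 // => i _; rewrite scale0r. Qed.
Lemma fspan_mem s u : u \in s -> fspan s u.
Proof.
move=> us; have lt_i : (index u s < size s)%N by rewrite index_mem.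
exists (fun i => (i == Ordinal lt_i)%:R); rewrite (bigD1 (Ordinal lt_i)) //= eqxx scale1r.
by rewrite nth_index // big1 ?addr0 // => i /negPf ->; rewrite scale0r.
Qed.
Lemma fspan_ind s (P : M -> Prop) : P 0 -> (forall c u v, P u -> P v -> P (c *: u + v)) ->
  (forall u, u \in s -> P u) -> forall u, fspan s u -> P u.
Proof.
move=> P0 Pl Ps u [c ->]; elim/big_ind: _ => // [x y Px Py|i _].
  by rewrite -[x]scale1r; exact: Pl.
by rewrite -[_ *: _]addr0; apply: Pl => //; apply/Ps/mem_nth.
Qed.
Lemma fspan_sub s t u : {subset s <= t} -> fspan s u -> fspan t u.
Proof.
by move=> st; apply: fspan_ind => [|c v w|v /st]; [exact: fspan0|exact: fspanP|exact: fspan_mem].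
Qed.

Definition basis_list : seq (Defs.pe C n) :=
  [seq eE C i j | i <- enum 'I_n, j <- enum 'I_n] ++
  [seq sB C i j | i <- enum 'I_n, j <- enum 'I_n] ++
  [seq cD C i j | i <- enum 'I_n, j <- enum 'I_n].

Lemma basis_listP x : x \in basis_list -> exists a, homog a x.
Proof.
rewrite !mem_cat => /or3P[] /allpairsP[[i j] [_ _ ->]].
- by exists false; exact: homog_eE.
- by exists true; exact: homog_sB.
- by exists true; exact: homog_cD.
Qed.
Lemma basis_list_mem (i j : 'I_n) :
  [/\ eE C i j \in basis_list, sB C i j \in basis_list & cD C i j \in basis_list].
Proof.
have ins (T : eqType) (g : 'I_n -> 'I_n -> T) :
    g i j \in [seq g i j | i <- enum 'I_n, j <- enum 'I_n].
  by apply/allpairsP; exists (i, j); rewrite !mem_enum.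
by rewrite !mem_cat !ins !orbT.
Qed.

Context (s0 : seq M).
Hypothesis s0_borel : forall x u, borel x -> u \in s0 -> fspan s0 (act x u).
Hypothesis s0_span : forall P : M -> Prop, P 0 -> (forall c u v, P u -> P v -> P (c *: u + v)) ->
  (forall u, u \in s0 -> P u) -> (forall x v, P v -> P (act x v)) -> forall v, P v.

(** The degree filtration of U(g) applied to a finite set with Borel-stable span. Every step is
    finite, and it is Borel-stable because moving a Borel element past a letter leaves a bracket,
    which is a single letter again. *)
Fixpoint word_list k : seq M :=
  if k is k'.+1 then word_list k' ++ [seq act x u | x <- basis_list, u <- word_list k'] else s0.

Lemma word_list_act k x u : fspan (word_list k) u -> fspan (word_list k.+1) (act x u).
Proof.
move=> hu; move: u hu x; apply: fspan_ind => [x|c u v hu hv x|u us].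
- by rewrite act0r; exact: fspan0.
- by rewrite act_linr; apply: fspanP.
have H y : y \in basis_list -> fspan (word_list k.+1) (act y u).
  by move=> yb; apply: fspan_mem; rewrite mem_cat; apply/orP; right; exact: allpairs_f.
apply: pe_span => [c x y hx hy||i j|i j|i j].
- by rewrite act_linl; exact: fspanP.
- by rewrite act0l; exact: fspan0.
- by apply: H; case: (basis_list_mem i j).
- by apply: H; case: (basis_list_mem i j).
- by apply: H; case: (basis_list_mem i j).
Qed.
Lemma word_list_mono k k' u : (k <= k')%N -> fspan (word_list k) u -> fspan (word_list k') u.
Proof.
move=> /subnK <-; elim: (k' - k)%N => //= j IH hu; apply: fspan_sub (IH hu).
by move=> v vs; rewrite mem_cat vs.
Qed.
Lemma word_list_borel k x u : borel x -> fspan (word_list k) u -> fspan (word_list k) (act x u).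
Proof.
move=> bx hu; move: u hu; elim: k x bx => [|k IH] x bx;
  apply: fspan_ind => [|c v w hv hw|v]; rewrite ?act0r ?act_linr;
  try exact: fspan0; try exact: fspanP.
  exact: s0_borel.
rewrite mem_cat => /orP[vs|/allpairsP[[y w] [/= /basis_listP[a hy] ws ->]]].
  by apply: (@word_list_mono k) => //; apply: IH => //; exact: fspan_mem.
rewrite (act_comm _ _ hy) -[X in X + _]scale1r; apply: fspanP; apply: word_list_act.
  by apply: IH; [exact: borel_th|exact: fspan_mem].
exact: fspan_mem.
Qed.
Lemma word_list_all u : exists k, fspan (word_list k) u.
Proof.
elim/s0_span: u => [|c u v [k ku] [l lv]|u us|x u [k ku]].
- by exists 0%N; exact: fspan0.
- exists (maxn k l); apply: fspanP; [apply: word_list_mono ku|apply: word_list_mono lv].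
    exact: leq_maxl.
  exact: leq_maxr.
- by exists 0%N; exact: fspan_mem.
by exists k.+1; exact: word_list_act.
Qed.

Lemma nilradical_borel x : nilradical x -> borel x.
Proof. by case=> h1 h2; split=> // i j ij; apply: h2; exact: ltnW. Qed.

Lemma borel_span_locally_finite : locally_nilradical_finite M.
Proof.
move=> v; have [k kv] := word_list_all v; exists (word_list k) => u gu.
have P0 : fspan (word_list k) 0 by exact: fspan0.
have Pl c u1 w : fspan (word_list k) u1 -> fspan (word_list k) w ->
    fspan (word_list k) (c *: u1 + w).
  exact: fspanP.
have := gu (mk_subspace (submod_closedP P0 Pl)).
rewrite mk_subspaceP; apply=> [x w /nilradical_borel bx|w ->].
  by rewrite !mk_subspaceP; exact: word_list_borel.
by rewrite mk_subspaceP.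
Qed.

End FiniteSpan.

(** * Simple tops of Verma modules *)

Section Preimage.
Context (C : numClosedFieldType) (n : nat) (M N : smod C n) (f : shom M N).
Lemma shom_preim (S : submod N) : (forall x, par (f x) = f (par x)) ->
  exists T : submod M, forall x, x \in T <-> f x \in S.
Proof.
move=> fp; have P0 : f 0 \in S by rewrite shom0 rpred0.
have Pl c u v : f u \in S -> f v \in S -> f (c *: u + v) \in S.
  by move=> uS vS; rewrite shomP rpredD ?rpredZ.
have Pa x v : f v \in S -> f (act x v) \in S by move=> vS; rewrite shom_act submod_act.
have Pp v : f v \in S -> f (par v) \in S by move=> vS; rewrite -fp submod_par.
by exists (prop_submod P0 Pl Pa Pp) => y; exact: prop_submodP.
Qed.

Lemma shom_iter m x v : f (iter m (act x) v) = iter m (act x) (f v).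
Proof. by elim: m => //= m IH; rewrite shom_act IH. Qed.
Lemma shom_weight g v : weight_vector g v -> weight_vector g (f v).
Proof. by move=> gv h ch; rewrite -shom_act gv // shomZ. Qed.
End Preimage.

Lemma sum_submodP (C : numClosedFieldType) (n : nat) (M : smod C n) (F : submod M -> Prop) v :
  v \in sum_submod F <-> sum_pred F v.
Proof. exact: prop_submodP. Qed.

(** All that is used of L(mu). The endomorphisms in [ss_end] may mix parities, and [ss_nilp]
    expresses that the singular vector f^m v0 dies in the simple quotient. *)
Record simple_spec (C : numClosedFieldType) (n : nat) (mu : 'rV[C]_n)
    (L : smod C n) (l0 : L) : Prop := SimpleSpec {
  ss_borel : forall x : Defs.pe C n, borel x -> act x l0 = weight_val mu x *: l0;
  ss_par : par l0 = l0;
  ss_neq0 : l0 != 0;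
  ss_span : forall P : L -> Prop, (forall c u v, P u -> P v -> P (c *: u + v)) ->
    P l0 -> (forall x v, P v -> P (act x v)) -> forall v, P v;
  ss_simple : simple L;
  ss_end : forall g : shom L L, exists c, forall x, g x = c *: x;
  ss_nilp : forall (i0 i1 : 'I_n) m, i1 = i0.+1 :> nat -> (0 < m)%N ->
    mu 0 i0 - mu 0 i1 + 1 = m%:R -> iter m (act (eE C i1 i0)) l0 = 0 }.

Section SimpleTop.
Context (C : numClosedFieldType) (n : nat) (mu : 'rV[C]_n).
Context (V : smod C n) (v0 : V) (HV : verma_spec mu v0).

Context (eps : {linear V -> C^o}).
Hypotheses (eps0 : eps v0 = 1) (epsP : forall y v, mneg y -> eps (act y v) = 0).

Lemma counit_par v : eps (par v) = eps v.
Proof.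
elim/(vs_ind HV): v => [c u v hu hv||a y v hy my _]; last 1 first.
- by have := mneg_th true my; rewrite thE => my'; rewrite par_actE !epsP.
- by rewrite par_lin !linearP hu hv.
by rewrite (vs_par HV).
Qed.

Lemma foldr_act_lin s c u v :
  foldr (@act C n V) (c *: u + v) s = c *: foldr (@act C n V) u s + foldr (@act C n V) v s.
Proof. by elim: s => //= x s ->; rewrite act_linr. Qed.

Lemma foldr_act_par s v :
  foldr (@act C n V) (par v) s = par (foldr (@act C n V) v (map (@pe_theta C n) s)).
Proof. by elim: s => //= x s ->; rewrite par_actE pe_thetaK. Qed.

Lemma verma_all (S : submod V) : v0 \in S -> forall v, v \in S.
Proof.
move=> vS v; elim/(vs_span HV): v => // [c u v uS vS'|x v vS']; first by rewrite rpredD ?rpredZ.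
exact: submod_act.
Qed.

(** By [verma_proper] a proper submodule lies in the kernel of [eps]. The vectors that all words map
    into this kernel form a graded submodule containing every proper one, hence the radical. *)
Lemma radical_counit v : v \in radical V -> eps v = 0.
Proof.
move=> rv0; have rv := (sum_submodP _ _).1 rv0.
pose P u := forall s, eps (foldr (@act C n V) u s) = 0.
have P0 : P 0 by move=> s; elim: s => [|x s IH] /=; rewrite ?linear0 // (_ : foldr _ _ _ = 0) ?act0r ?linear0 //; elim: (s) => //= y t ->; rewrite act0r.
have Pl c u w : P u -> P w -> P (c *: u + w).
  by move=> Pu Pw s; rewrite foldr_act_lin linearP Pu Pw scaler0 addr0.
have Pa x u : P u -> P (act x u).
  by move=> Pu s; have := Pu (rcons s x); rewrite -cats1 foldr_cat.
have Pp u : P u -> P (par u).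
  by move=> Pu s; rewrite foldr_act_par counit_par Pu.
suff /prop_submodP Pv : v \in prop_submod P0 Pl Pa Pp by exact: (Pv [::]).
apply: rv => S [w wS] u uS; apply/prop_submodP => s.
apply/eqP/negPn/negP => e; have : foldr (@act C n V) u s \in S.
  by elim: s {e} => //= x s IH; exact: submod_act.
by move=> /(verma_proper HV eps0 epsP)/(_ e)/verma_all/(_ w); rewrite (negPf wS).
Qed.

(** A singular vector is the image of the highest weight vector of another Verma module, and f^m
    with m > 0 puts that whole image into the kernel of [eps], so it is proper. It is graded because
    v has a parity by [verma_parity]. *)
Lemma singular_radical (v : V) g m : (0 < m)%N -> forall i0 i1 : 'I_n, i1 = i0.+1 :> nat ->
  v = iter m (act (eE C i1 i0)) v0 ->
  (forall x, borel x -> act x v = weight_val g x *: v) -> v \in radical V.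
Proof.
move=> m0 i0 i1 i01 vE bv.
have [w0 | ] := eqVneq v 0; first by rewrite w0 rpred0.
move=> _; have := vermaP g; move: (verma g) (verma_gen g) => W z0 HW.
have [k k0] := vs_universal HW bv.
have ke (u : W) : eps (k u) = 0.
  elim/(vs_ind HW): u => [c u w hu hw||a y u _ my _].
  - by rewrite shomP linearP hu hw scaler0 addr0.
  - rewrite k0 vE; case: (m) m0 => // j _; rewrite iterS epsP //.
    by apply: mneg_eE; rewrite i01.
  by rewrite shom_act epsP.
have pp : exists b : bool, par v = (-1) ^+ b *: v.
  rewrite vE; apply: (verma_parity HV (g := mu + m%:R *: (epsw C i1 - epsw C i0))).
  exact: iter_f_weight.
have kp (u : W) : exists w, par (k u) = k w.
  elim/(vs_ind HW): u => [c u w [u' hu] [w' hw]||a y u _ my [u' hu]].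
  - by exists (c *: u' + w'); rewrite !shomP par_lin hu hw.
  - by rewrite k0; case: pp => b ->; exists ((-1) ^+ b *: z0); rewrite shomZ k0.
  by exists (act (pe_theta y) u'); rewrite !shom_act par_actE hu.
have [S SP] := shom_im kp.
apply/sum_submodP => T; apply; last by apply/SP; exists z0.
exists v0; apply/negP => /SP[u ku]; have := ke u; rewrite ku eps0 => /eqP.
by rewrite oner_eq0.
Qed.

Context (L : smod C n) (q : shom V L).
Hypotheses (qsurj : forall y : L, exists x : V, q x = y) (qker : forall x : V, q x = 0 <-> x \in radical V)
  (qpar : forall x : V, par (q x) = q (par x)).

Lemma simple_top_spec : simple_spec mu (q v0).
Proof.
have sp (P : L -> Prop) : (forall c u v, P u -> P v -> P (c *: u + v)) ->
    P (q v0) -> (forall x v, P v -> P (act x v)) -> forall v, P v.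
  move=> Pl P0 Pa v; have [u <-] := qsurj v.
  elim/(vs_span HV): u => [c u w hu hw||x u hu] //; first by rewrite shomP; apply: Pl.
  by rewrite shom_act; apply: Pa.
have q0 : q v0 != 0.
  by apply/eqP => /qker /radical_counit /eqP; rewrite eps0 oner_eq0.
split=> //.
- by move=> x bx; rewrite -shom_act (vs_borel HV) // shomZ.
- by rewrite qpar (vs_par HV).
- split; first by exists (q v0).
  move=> S; have [T TP] := shom_preim S qpar.
  case: (pselect (exists v, v \notin T)) => [Tp|Ta]; [left|right] => y.
    have [x <-] := qsurj y => xS; apply/qker/sum_submodP => U; apply; first exact: Tp.
    exact/TP.
  have [x <-] := qsurj y; apply/TP/negPn/negP => xT; by apply: Ta; exists x.
(* The image of the generator lifts to a vector of weight mu in V, which is a multiple of v0; so g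
   is a scalar on the generator. *)
- move=> g; have gw : weight_vector mu (g (q v0)).
    by apply: shom_weight; apply: shom_weight; exact: verma_weight HV.
  have [x [qx xw]] := weight_lift (verma_semisimple HV) (qsurj (g (q v0))) gw.
  exists (eps x); apply: sp => [c u v hu hv||y v hv].
  - by rewrite shomP hu hv scalerDr !scalerA mulrC.
  - by rewrite -qx [x in LHS](verma_top_weight HV eps0 epsP xw) shomZ.
  by rewrite shom_act hv actZr.
move=> i0 i1 m i01 m0 hm; rewrite -shom_iter; apply/qker.
by apply: (singular_radical m0 i01 erefl); exact: singular_vector HV _ hm.
Qed.

End SimpleTop.

Lemma simple_topP (C : numClosedFieldType) (n : nat) (mu : 'rV[C]_n) :
  exists l0 : simple_top mu, simple_spec mu l0.
Proof.
have [eps [e0 eP]] := verma_counit (vermaP mu).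
have [q [q1 q2 q3]] := qproj_exists (radical (verma mu)).
by exists (q (verma_gen mu)); exact: (simple_top_spec (vermaP mu) e0 eP).
Qed.

(** * Verma modules are Noetherian *)

Section Noetherian.
Context (C : numClosedFieldType) (n : nat) (V : smod C n).
Local Notation pe := (Defs.pe C n).

Definition subspace (X : V -> Prop) : Prop :=
  X 0 /\ forall c u v, X u -> X v -> X (c *: u + v).
Definition stable (Y : pe -> Prop) (X : V -> Prop) : Prop :=
  forall a v, Y a -> X v -> X (act a v).

(** Chains are only required to be stable under Y, with X in the role of U(Y) v0. This makes an
    induction possible that enlarges Y by one element at a time. *)
Definition acc (Y : pe -> Prop) (X : V -> Prop) : Prop :=
  forall F : nat -> V -> Prop,
    (forall k, subspace (F k) /\ stable Y (F k)) ->
    (forall k v, F k v -> X v) -> (forall k v, F k v -> F k.+1 v) ->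
    exists N, forall k, (N <= k)%N -> forall v, F k v -> F N v.

Definition noetherian_part (v0 : V) (Y : pe -> Prop) : Prop :=
  exists X, [/\ subspace X, X v0, stable Y X & acc Y X].

Lemma chain_mono (F : nat -> V -> Prop) : (forall k v, F k v -> F k.+1 v) ->
  forall j k v, (j <= k)%N -> F j v -> F k v.
Proof. by move=> Fm j k v /subnK <-; elim: (k - j)%N => //= i IH /IH/Fm. Qed.

Lemma subspaceD X u v : subspace X -> X u -> X v -> X (u + v).
Proof. by move=> [_ hX] hu hv; rewrite -[u]scale1r; exact: hX. Qed.
Lemma subspaceZ X c u : subspace X -> X u -> X (c *: u).
Proof. by move=> [X0 hX] hu; rewrite -[c *: u]addr0; exact: hX. Qed.
Lemma subspaceB X u v : subspace X -> X u -> X v -> X (u - v).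
Proof. by move=> hX hu hv; apply: subspaceD => //; rewrite -scaleN1r; exact: subspaceZ. Qed.

Section Step.
Context (Y : pe -> Prop) (b : bool) (y : pe) (X : V -> Prop).
Hypotheses (hy : homog b y) (Yth : forall a, Y a -> Y (th b a))
  (Yy : forall a, Y a -> Y (pe_bracket a y)).
Hypotheses (Xs : subspace X) (XY : stable Y X).
Local Notation yy := (@act C n V y).

(** The sum, not necessarily direct, of y^i X over i < j. *)
Fixpoint Xf (j : nat) (v : V) : Prop :=
  if j is j'.+1 then exists x w, [/\ X x, Xf j' w & v = iter j' yy x + w] else v = 0.

Lemma iter_yP j c u v : iter j yy (c *: u + v) = c *: iter j yy u + iter j yy v.
Proof. by elim: j => //= j ->; rewrite act_linr. Qed.
Lemma iter_y0 j : iter j yy 0 = 0. Proof. by elim: j => //= j ->; rewrite act0r. Qed.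

Lemma Xf_subspace j : subspace (Xf j).
Proof.
elim: j => [|j [F0 Fl]]; first by split=> // c u v -> ->; rewrite scaler0 addr0.
split=> [|c u v [x [w [Xx Fw ->]]] [x' [w' [Xx' Fw' ->]]]].
  by exists 0, 0; split; rewrite ?iter_y0 ?addr0 //; exact: Xs.1.
exists (c *: x + x'), (c *: w + w'); split; [exact: Xs.2|exact: Fl|].
by rewrite iter_yP lincombD.
Qed.
Lemma XfS j v : Xf j v -> Xf j.+1 v.
Proof.
by move=> hv; exists 0, v; split; rewrite ?iter_y0 ?add0r //; exact: Xs.1.
Qed.
Lemma Xf_mono i j v : (i <= j)%N -> Xf i v -> Xf j v.
Proof. exact: chain_mono XfS i j v. Qed.
Lemma Xf_iter j x : X x -> Xf j.+1 (iter j yy x).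
Proof. by move=> Xx; exists x, 0; split; rewrite ?addr0 //; exact: (Xf_subspace j).1. Qed.
Lemma Xf_y j v : Xf j v -> Xf j.+1 (yy v).
Proof.
elim: j v => [v ->|j IH v [x [w [Xx Fw ->]]]]; first by rewrite act0r; exact: (Xf_subspace 1).1.
rewrite actDr; apply: subspaceD; [exact: Xf_subspace|exact: Xf_iter j.+1 x Xx|].
by apply: XfS; exact: IH.
Qed.
Lemma Xf_stable j : stable Y (Xf j).
Proof.
elim: j => [a v _ ->|j IH a v Ya [x [w [Xx Fw ->]]]]; first by rewrite act0r.
rewrite actDr; apply: subspaceD; [exact: Xf_subspace| |by apply: XfS; exact: IH].
case: j IH Fw => [_ _|j IH _]; first by rewrite -[act a _]/(iter 0 yy (act a x)); apply/Xf_iter/XY.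
rewrite iterS (act_comm _ _ hy); apply: subspaceD; first exact: Xf_subspace.
  by apply: Xf_y; apply: IH; [exact: Yth|exact: Xf_iter].
by apply: XfS; apply: IH; [exact: Yy|exact: Xf_iter].
Qed.

(** Since [Y, y] lies in Y, elements of Y commute with y^j up to a twist by [th] and terms of lower
    degree in y. This makes the spaces of leading coefficients Y-stable. *)
Lemma iter_y_act j a x : Y a -> X x -> exists a' w,
  [/\ Y a', Xf j w & iter j yy (act a x) = act a' (iter j yy x) + w].
Proof.
move=> Ya Xx; elim: j => [|j [a' [w [Ya' Fw e]]]]; first by exists a, 0; rewrite addr0.
exists (th b a'), (- act (pe_bracket (th b a') y) (iter j yy x) + yy w); split.
- exact: Yth.
- apply: subspaceD; [exact: Xf_subspace| |exact: Xf_y].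
  rewrite -scaleN1r; apply: subspaceZ; first exact: Xf_subspace.
  by apply: Xf_stable; [exact/Yy/Yth|exact: Xf_iter].
by rewrite !iterS e actDr (act_comm _ _ hy) thK addrA addrK.
Qed.

(* Hilbert's basis argument: the leading coefficients, with respect to [y], of
   the elements of [F] of degree [j]. *)
Definition leading (F : V -> Prop) (j : nat) (x : V) : Prop :=
  X x /\ exists u w, [/\ F u, Xf j w & iter j yy x = u + w].

Lemma leading_subspace F j : subspace F -> subspace (leading F j).
Proof.
move=> Fs; have [F0 Fl] := Xf_subspace j.
split=> [|c u v [Xu [p [w [Fp Fw e]]]] [Xv [p' [w' [Fp' Fw' e']]]]].
  split; first exact: Xs.1.
  by exists 0, 0; split; rewrite ?iter_y0 ?addr0 //; exact: Fs.1.
split; first exact: Xs.2.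
exists (c *: p + p'), (c *: w + w'); split; [exact: Fs.2|exact: Fl|].
by rewrite iter_yP e e' lincombD.
Qed.
Lemma leading_stable F j : subspace F -> stable Y F -> stable Y (leading F j).
Proof.
move=> Fs FY a x Ya [Xx [u [w [Fu Fw e]]]]; split; first exact: XY.
have [a' [w' [Ya' Fw' ->]]] := iter_y_act j Ya Xx.
exists (act a' u), (act a' w + w'); split; first exact: FY.
  by apply: subspaceD => //; [exact: Xf_subspace|exact: Xf_stable].
by rewrite e actDr addrA.
Qed.
Lemma leadingS F j x : (forall u, F u -> F (yy u)) -> leading F j x -> leading F j.+1 x.
Proof.
move=> Fy [Xx [u [w [Fu Fw e]]]]; split=> //; exists (yy u), (yy w).
by split; [exact: Fy|exact: Xf_y|rewrite iterS e actDr].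
Qed.

(** The diagonal chain of leading spaces, with degree and index both k, becomes stationary at some K
    and thereby settles all degrees from K on. The finitely many smaller degrees are settled one at
    a time. *)
Lemma acc_step (Y' : pe -> Prop) : acc Y X -> (forall a, Y a -> Y' a) -> Y' y ->
  acc Y' (fun v => exists j, Xf j v).
Proof.
move=> accX YY' Y'y F Fs FX Fm.
have Fsub k := (Fs k).1; have FY k : stable Y (F k) by move=> a v /YY'; exact: (Fs k).2.
have Fy k u : F k u -> F k (yy u) by exact: (Fs k).2.
have LS j k : subspace (leading (F k) j) /\ stable Y (leading (F k) j).
  by split; [exact: leading_subspace|exact: leading_stable].
have LX j k v : leading (F k) j v -> X v by case.
have Lk j k v : leading (F k) j v -> leading (F k.+1) j v.
  by move=> [Xv [u [w [Fu Fw e]]]]; split=> //; exists u, w; split=> //; exact: Fm.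
have Lj j k v : leading (F k) j v -> leading (F k) j.+1 v by move=> h; apply: leadingS h => u; exact: Fy.
have [K hK] := accX (fun k => leading (F k) k) (fun k => LS k k) (fun k => LX k k)
  (fun k v h => Lj _ _ _ (Lk _ _ _ h)).
have Lmono j k j' k' v : (j <= j')%N -> (k <= k')%N -> leading (F k) j v -> leading (F k') j' v.
  move=> jj kk h.
  have h1 := chain_mono (F := fun i => leading (F i) j) (fun i u => Lk j i u) kk h.
  exact: (chain_mono (F := fun i => leading (F k') i) (fun i u => Lj i k' u) jj h1).
have [N hN] : exists N, forall j k v, (j < K)%N -> (N <= k)%N ->
    leading (F k) j v -> leading (F N) j v.
  elim: K {hK} => [|K [N hN]]; first by exists 0%N.
  have [M hM] := accX (fun k => leading (F k) K) (LS K) (LX K) (Lk K).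
  exists (maxn N M) => j k v; rewrite ltnS geq_max leq_eqVlt => /orP[/eqP ->|jK] /andP[Nk Mk].
    move=> /(hM k Mk) h; apply: Lmono h => //; exact: leq_maxr.
  move=> /(hN j k v jK Nk) h; apply: Lmono h => //; exact: leq_maxl.
pose M := maxn K N; exists M => k Mk v Fv; have [j vj] := FX k v Fv.
have [KM NM] : (K <= M)%N /\ (N <= M)%N by rewrite leq_maxl leq_maxr.
have Lstab i u : leading (F k) i u -> leading (F M) i u.
  have [iK h|Ki h] := ltnP i K.
    by apply: (Lmono i N) => //; apply: hN h => //; exact: leq_trans NM Mk.
  apply: (Lmono K K) => //; apply: (hK (maxn i k)); first by rewrite leq_max Ki.
  by apply: Lmono h; rewrite ?leq_maxl ?leq_maxr.
(* Subtracting an element of F M with the same leading coefficient lowers the degree. *)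
elim: j v Fv vj => [v _ ->|j IH v Fv [x [w [Xx Fw e]]]]; first exact: (Fsub M).1.
have [|_ [u [w' [Fu Fw' e']]]] := Lstab j x.
  split=> //; exists v, (- w); split=> //; last by rewrite e addrK.
  by rewrite -scaleN1r; apply: subspaceZ => //; exact: Xf_subspace.
have -> : v = u + (v - u) by rewrite addrC subrK.
apply: subspaceD => //; apply: IH.
  by apply: subspaceB => //; exact: (chain_mono Fm) Mk Fu.
rewrite e e' (_ : u + w' + w - u = w' + w); last by zmod.
by apply: subspaceD => //; exact: Xf_subspace.
Qed.
End Step.

Lemma noetherian_step (v0 : V) (Y Y' : pe -> Prop) b y : homog b y ->
  (forall a, Y a -> Y (th b a)) -> (forall a, Y a -> Y (pe_bracket a y)) ->
  (forall a, Y a -> Y' a) -> Y' y -> (forall a, Y' a -> exists c a', Y a' /\ a = c *: y + a') ->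
  noetherian_part v0 Y -> noetherian_part v0 Y'.
Proof.
move=> hy Yth Yy YY' Y'y Y'd [X [Xs Xv XY aX]].
exists (fun v => exists j, Xf y X j v); split.
- split; first by exists 0%N.
  move=> c u v [j ju] [k kv]; exists (maxn j k).
  by apply: (Xf_subspace _ Xs _).2; [apply: Xf_mono ju|apply: Xf_mono kv]; rewrite // ?leq_maxl ?leq_maxr.
- by exists 1%N; apply: (Xf_iter _ Xs 0).
- move=> a v /Y'd[c [a' [Ya' ->]]] [j jv]; exists j.+1.
  rewrite act_linl; apply: (Xf_subspace _ Xs _).2; first exact: Xf_y.
  by apply: XfS => //; exact: (Xf_stable hy Yth Yy Xs XY Ya' jv).
exact: (acc_step hy Yth Yy Xs XY).
Qed.

End Noetherian.

Section VermaNoetherian.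
Context (C : numClosedFieldType) (n : nat) (lam : 'rV[C]_n).
Context (V : smod C n) (v0 : V) (HV : verma_spec lam v0).
Local Notation pe := (Defs.pe C n).

Lemma noetherian_start : noetherian_part v0 (fun a : pe => a = 0).
Proof.
exists (fun v => exists c, v = c *: v0); split.
- split; first by exists 0; rewrite scale0r.
  by move=> c u v [d ->] [d' ->]; exists (c * d + d'); rewrite scalerDl scalerA.
- by exists 1; rewrite scale1r.
- by move=> a v -> _; exists 0; rewrite act0l scale0r.
move=> F Fs FX Fm; case: (pselect (exists k, F k v0)) => [[N vN]|nv].
  exists N => k _ v /FX[c ->]; exact: subspaceZ (Fs N).1 vN.
exists 0%N => k _ v Fv; have [c vc] := FX _ _ Fv; have [c0|c0] := eqVneq c 0.
  by rewrite vc c0 scale0r; exact: (Fs 0%N).1.1.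
case: nv; exists k; rewrite -[v0]scale1r -(mulVf c0) -scalerA -vc.
exact: subspaceZ (Fs k).1 Fv.
Qed.

(* The negative part is built up from zero by adjoining one root vector at a
   time: first the odd ones, then E_ij with i > j by decreasing i * n + j. *)
Definition odd_part (t : nat) (a : pe) : Prop := [/\ ul a = 0, ur a = 0 &
  forall k l : 'I_n, (l < k)%N -> (t <= k * n + l)%N -> dl a k l = 0].
Definition neg_part (t : nat) (a : pe) : Prop := ur a = 0 /\
  forall k l : 'I_n, ~~ (l < k)%N || (k * n + l < t)%N -> ul a k l = 0.

Lemma pos_inj (k l i j : 'I_n) : (k * n + l = i * n + j)%N -> k = i /\ l = j.
Proof.
move=> e; have n0 := leq_ltn_trans (leq0n l) (ltn_ord l).
have ki : k = i.
  apply/val_inj; have := congr1 (divn^~ n) e.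
  by rewrite /= !divnMDl // !divn_small ?addn0.
by split=> //; apply/val_inj; move: e; rewrite ki => /addnI.
Qed.
Lemma pos_exists t : (t < n * n)%N -> exists i j : 'I_n, t = (i * n + j)%N.
Proof.
move=> tn; have n0 : (0 < n)%N by case: (n) tn.
have h1 : (t %/ n < n)%N by rewrite ltn_divLR.
by exists (Ordinal h1), (Ordinal (ltn_pmod t n0)); rewrite /= -divn_eq.
Qed.

Lemma dl_cDe (i j k l : 'I_n) :
  dl (cD C i j) k l = ((k == i) && (l == j))%:R - ((k == j) && (l == i))%:R.
Proof. by rewrite dl_cD !mxE. Qed.
Lemma dlBe (x y : pe) (k l : 'I_n) : dl (x - y) k l = dl x k l - dl y k l.
Proof. by rewrite dlB !mxE. Qed.
Lemma dlZe c (x : pe) (k l : 'I_n) : dl (c *: x) k l = c * dl x k l.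
Proof. by rewrite dlZ !mxE. Qed.

(** All brackets within g_(-1) vanish, so every new vector normalises the part before it. A position
    on or above the diagonal contributes no vector. *)
Lemma odd_part_step t : (t < n * n)%N ->
  noetherian_part v0 (odd_part t) -> noetherian_part v0 (odd_part t.+1).
Proof.
move=> /pos_exists[i [j tE]]; have [ji|ij] := ltnP j i.
  apply: (@noetherian_step _ _ V v0 _ _ true (cD C i j)); first exact: homog_cD.
  - move=> a [h1 h2 h3]; split; rewrite ?ul_th ?ur_th ?h1 ?h2 ?scaler0 // => k l lk tk.
    by rewrite dl_th mxE h3 ?mulr0.
  - move=> a [h1 h2 h3]; have -> : pe_bracket a (cD C i j) = 0.
      apply: pe_ext; rewrite ?ul_bracket ?ur_bracket ?dl_bracket h1 ?h2 ?ur_cD ul_cD ?ul0 ?ur0 ?dl0;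
      by rewrite ?(trmx0, mulmx0, mul0mx, addr0, subr0).
    by split; rewrite ?ul0 ?ur0 // => k l; rewrite dl0 mxE.
  - by move=> a [h1 h2 h3]; split=> // k l lk tk; apply: h3 => //; exact: ltnW.
  - split; rewrite ?ul_cD ?ur_cD // => k l lk tk; rewrite dl_cDe.
    have -> : (k == i) && (l == j) = false.
      by apply: contraTF tk => /andP[/eqP -> /eqP ->]; rewrite tE -leqNgt.
    have -> : (k == j) && (l == i) = false.
      by apply: contraTF lk => /andP[/eqP -> /eqP ->]; rewrite -leqNgt ltnW.
    by rewrite subrr.
  move=> a [h1 h2 h3]; exists (dl a i j), (a - dl a i j *: cD C i j).
  split; last by rewrite addrC subrK.
  split; rewrite ?ulB ?urB ?ulZ ?urZ ?ul_cD ?ur_cD ?h1 ?h2 ?scaler0 ?subr0 // => k l lk.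
  rewrite leq_eqVlt dlBe dlZe dl_cDe => /orP[/eqP|tk].
    rewrite tE => /pos_inj[<- <-]; rewrite !eqxx (_ : (i == j) = false) ?andbF ?subr0 ?mulr1 ?subrr //.
    by apply: contraTF ji => /eqP ->; rewrite ltnn.
  have -> : (k == i) && (l == j) = false.
    by apply: contraTF tk => /andP[/eqP -> /eqP ->]; rewrite tE ltnn.
  have -> : (k == j) && (l == i) = false.
    by apply: contraTF lk => /andP[/eqP -> /eqP ->]; rewrite -leqNgt ltnW.
  by rewrite h3 // subrr mulr0 subr0.
have -> // : odd_part t.+1 = odd_part t.
apply/funext => a; apply/propext; split=> -[h1 h2 h3]; split=> // k l lk; last first.
  by move=> tk; apply: h3 => //; exact: ltnW.
rewrite leq_eqVlt => /orP[/eqP|tk]; last exact: h3.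
by rewrite tE => /pos_inj[ei ej]; move: lk; rewrite -ei -ej ltnNge ij.
Qed.

(** The order of positions makes E_ij normalise the part already present: row j of the even block of
    a is zero, as j < i, so that [a, E_ij] only moves entries of column i, in rows k > i, to column
    j. *)
Lemma neg_part_step t : (t < n * n)%N ->
  noetherian_part v0 (neg_part t.+1) -> noetherian_part v0 (neg_part t).
Proof.
move=> /pos_exists[i [j tE]]; have [ji|ij] := ltnP j i.
  have nij : (i == j) = false by apply: contraTF ji => /eqP ->; rewrite ltnn.
  apply: (@noetherian_step _ _ V v0 _ _ false (eE C i j)); first exact: homog_eE.
  - by move=> a; rewrite thE.
  - move=> a [h1 h2]; split=> [|k l hkl].
      by rewrite ur_bracket h1 ur_eE !(mul0mx, mulmx0, addr0, subr0).
    have -> : ul (pe_bracket a (eE C i j)) k l = ul a k i * (l == j)%:R - (k == i)%:R * ul a j l.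
      rewrite ul_bracket h1 ur_eE !mul0mx !add0r ul_eE.
      have mB (A B : 'M[C]_n) : (A - B) k l = A k l - B k l by rewrite !mxE.
      by rewrite mB delta_mul mul_delta.
    have -> : ul a j l = 0.
      apply: h2; have [lj|//] := ltnP l j; rewrite /= tE ltnS.
      have := leq_mul2r n j.+1 i; rewrite ji orbT mulSn => h.
      apply: leq_trans (leq_trans _ h) (leq_addr _ _).
      by rewrite addnC leq_add2r ltnW.
    rewrite mulr0 subr0; have [lj|_] := eqVneq l j; last by rewrite mulr0.
    rewrite mulr1; apply: h2; move: hkl; rewrite lj => /orP[kj|kt].
      by rewrite -leqNgt (leq_trans _ (ltnW ji)) // leqNgt.
    have [ki|//] := ltnP i k; move: kt; rewrite ltnS tE leq_add2r leq_mul2r.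
    rewrite [(k <= i)%N]leqNgt ki orbF => /eqP n0.
    by move: (ltn_ord i); rewrite [in X in (_ < X)%N]n0.
  - move=> a [h1 h2]; split=> // k l /orP[kl|kt]; apply: h2; rewrite ?kl ?orTb //.
    by rewrite (ltnW kt : (_ < _.+1)%N) orbT.
  - split=> [|k l hkl]; first by rewrite ur_eE.
    rewrite ul_eEe (_ : _ && _ = false) //; apply: contraTF hkl => /andP[/eqP -> /eqP ->].
    by rewrite ji tE ltnn.
  move=> a [h1 h2]; exists (ul a i j), (a - ul a i j *: eE C i j).
  split; last by rewrite addrC subrK.
  split=> [|k l]; first by rewrite urB urZ ur_eE h1 scaler0 subr0.
  rewrite ulBe ulZe ul_eEe; case: (k =P i) => [->|ki] /=; last first.
    rewrite mulr0 subr0 ltnS [(_ + _ <= _)%N]leq_eqVlt => /orP[kl|/orP[/eqP|kt]]; last 1 first.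
    - by apply: h2; rewrite kt orbT.
    - by apply: h2; rewrite kl.
    by rewrite tE => /pos_inj[].
  case: (l =P j) => [->|lj]; first by rewrite mulr1 subrr.
  rewrite mulr0 subr0 ltnS [(_ + _ <= _)%N]leq_eqVlt => /orP[kl|/orP[/eqP|kt]]; last 1 first.
  - by apply: h2; rewrite kt orbT.
  - by apply: h2; rewrite kl.
  by rewrite tE => /pos_inj[].
have -> // : neg_part t.+1 = neg_part t.
apply/funext => a; apply/propext; split=> -[h1 h2]; split=> // k l.
  by case/orP=> [kl|kt]; apply: h2; rewrite ?kl // (ltnW kt : (_ < _.+1)%N) orbT.
rewrite ltnS [(_ + _ <= _)%N]leq_eqVlt => /orP[kl|/orP[/eqP|kt]]; last 1 first.
- by apply: h2; rewrite kt orbT.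
- by apply: h2; rewrite kl.
by rewrite tE => /pos_inj[-> ->]; apply: h2; rewrite -leqNgt ij.
Qed.

Lemma noetherian_neg : noetherian_part v0 (@mneg C n).
Proof.
have oddP t : (t <= n * n)%N -> noetherian_part v0 (odd_part t).
  elim: t => [_|t IH tn]; last by apply: odd_part_step => //; apply: IH; exact: ltnW.
  suff -> : odd_part 0 = (fun a : pe => a = 0) by exact: noetherian_start.
  apply/funext => a; apply/propext; split=> [[h1 h2 h3]|->]; last first.
    by split; rewrite ?ul0 ?ur0 // => k l; rewrite dl0 mxE.
  apply: pe_ext; rewrite ?h1 ?h2 ?ul0 ?ur0 ?dl0 //; apply/matrixP => k l; rewrite [in RHS]mxE.
  have tr : dl a l k = - dl a k l by have := congr1 (fun B : 'M[C]_n => B k l) (tr_dl a); rewrite !mxE.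
  case: (ltngtP k l) => [kl|lk|/val_inj kl]; last 1 first.
  - move: tr; rewrite kl => /eqP; rewrite -subr_eq0 opprK -mulr2n -mulr_natr mulf_eq0 pnatr_eq0 orbF.
    by move=> /eqP.
  - by apply/eqP; rewrite -oppr_eq0 -tr h3.
  by rewrite h3.
have negP t : (t <= n * n)%N -> noetherian_part v0 (neg_part (n * n - t)).
  elim: t => [_|t IH tn].
    rewrite subn0; suff -> : neg_part (n * n) = odd_part (n * n) by exact: oddP.
    have lt (k l : 'I_n) : (k * n + l < n * n)%N.
      have := leq_mul2r n k.+1 n; rewrite ltn_ord orbT mulSn => h.
      by apply: leq_trans h; rewrite addnC ltn_add2r.
    apply/funext => a; apply/propext; split=> [[h1 h2]|[h1 h2 h3]]; split=> //.
    - by apply/matrixP => k l; rewrite [in RHS]mxE h2 ?lt ?orbT.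
    - by move=> k l _; rewrite leqNgt lt.
    by move=> k l _; rewrite h1 mxE.
  apply: neg_part_step; first by rewrite ltn_subrL /= (leq_ltn_trans _ tn).
  by rewrite subnSK //; apply: IH; exact: ltnW.
have := negP _ (leqnn _); rewrite subnn; suff -> : neg_part 0 = @mneg C n by [].
apply/funext => a; apply/propext; split=> -[h1 h2]; split=> // k l kl; apply: h2.
  by rewrite -leqNgt kl.
by move: kl; rewrite ltn0 orbF -leqNgt.
Qed.

Lemma verma_noetherian (F : nat -> submod V) :
  (forall k, {subset F k <= F k.+1}) -> exists N, forall k, (N <= k)%N -> {subset F k <= F N}.
Proof.
have [X [Xs Xv XY aX]] := noetherian_neg.
have Xall v : X v.
  by elim/(vs_ind HV): v => [c u v||a y v _ my Xv0] //; [exact: Xs.2|exact: XY].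
move=> Fm.
have Fs k : subspace (fun v => v \in F k) /\ stable (@mneg C n) (fun v => v \in F k).
  split; last by move=> a v _ vF; exact: submod_act.
  by split; [exact: rpred0|move=> c u v uF vF; rewrite rpredD ?rpredZ].
have [N hN] := aX (fun k v => v \in F k) Fs (fun k v _ => Xall v) Fm.
by exists N => k Nk v; exact: hN.
Qed.

End VermaNoetherian.

Lemma shom_image (C : numClosedFieldType) (n : nat) (N M : smod C n) (f : shom N M)
    (T : submod N) : (forall x, f (par x) = par (f x)) ->
  exists T' : submod M, forall w, w \in T' <-> exists2 x, x \in T & f x = w.
Proof.
move=> fpar; pose P w := exists2 x, x \in T & f x = w.
have P0 : P 0 by exists 0; [exact: rpred0|exact: shom0].
have Pl c u w : P u -> P w -> P (c *: u + w).
  move=> [x xT <-] [y yT <-]; exists (c *: x + y); first by rewrite rpredD ?rpredZ.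
  exact: shomP.
have Pa a u : P u -> P (act a u).
  by move=> [x xT <-]; exists (act a x); [exact: submod_act|exact: shom_act].
have Pp u : P u -> P (par u).
  by move=> [x xT <-]; exists (par x); [exact: submod_par|exact: fpar].
by exists (prop_submod P0 Pl Pa Pp) => w; exact: prop_submodP.
Qed.

Lemma restr_submodP (C : numClosedFieldType) (n : nat) (M : smod C n) (S T : submod M) x :
  x \in restr_submod S T <-> subspace_val x \in S.
Proof. exact: prop_submodP. Qed.

(** * Multiplicities in the socle *)

Section Lattice.
Context (C : numClosedFieldType) (n : nat) (M : smod C n).
Implicit Types (S T F : submod M) (v w : M).

Lemma simple_sub S : simple (sub_smod S) <->
  (exists2 v, v \in S & v != 0) /\
  forall T, {subset T <= S} -> (forall v, v \in T -> v = 0) \/ {subset S <= T}.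
Proof.
split=> [[[v v0] hS]|[[v vS v0] hS]].
  split; first by exists (subspace_val v); [exact: (valP v)|].
  move=> T TS; case: (hS (restr_submod T S)) => h; [left=> w wT|right=> w wS].
    by have /restr_submodP/h/(congr1 (@subspace_val _ _ _)) : subspace_val (SubspaceOf (TS w wT)) \in T.
  by have /restr_submodP := h (SubspaceOf wS).
split; first by exists (SubspaceOf vS); apply: contra v0 => /eqP/(congr1 val)/= ->.
move=> T; have [i [iE iinj iS isurj ipar]] := sincl_exists S.
have [T' T'P] := shom_image T ipar.
have T'S : {subset T' <= S} by move=> w /T'P[x _ <-].
case: (hS T' T'S) => h; [left=> x xT|right=> x].
  by apply: iinj; apply: h; apply/T'P; exists x.
have /T'P[y yT] := h _ (iS x); move/eqP; rewrite -subr_eq0 -shomB => /eqP/iinj/eqP.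
by rewrite subr_eq0 => /eqP <-.
Qed.

Lemma subquotient_proj F F' : exists q : shom (sub_smod F') (subquotient F F'),
  [/\ forall y, exists x, q x = y, forall x, q x = 0 <-> subspace_val x \in F &
      forall x, par (q x) = q (par x)].
Proof.
have [q [qs qk qp]] := qproj_exists (restr_submod F F'); exists q; split=> // x.
by split=> [/qk/restr_submodP|h] //; apply/qk/restr_submodP.
Qed.

Lemma simple_subquotient F F' : (exists2 v, v \in F' & v \notin F) ->
  (forall T, {subset F <= T} -> {subset T <= F'} -> {subset T <= F} \/ {subset F' <= T}) ->
  {subset F <= F'} -> simple (subquotient F F').
Proof.
move=> [v vF' vF] h FF'.
have [g [gsurj gk gpar]] := subquotient_proj F F'.
have [i [iE iinj iF' isurj ipar]] := sincl_exists F'.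
split.
  by exists (g (SubspaceOf vF')); apply/eqP => /gk; rewrite /= (negPf vF).
move=> T; have [T1 T1P] := shom_preim T gpar.
have [T' T'P] := shom_image T1 ipar.
have FT' : {subset F <= T'}.
  move=> w wF; have [x xw] := isurj w (FF' w wF); apply/T'P; exists x => //.
  by apply/T1P; rewrite (gk x).2 ?rpred0 // -iE xw.
have T'F' : {subset T' <= F'} by move=> w /T'P[x _ <-].
case: (h T' FT' T'F') => hT; [left=> y yT|right=> y].
  have [x gx] := gsurj y; rewrite -gx; apply/gk; rewrite -iE; apply/hT/T'P; exists x => //.
  by apply/T1P; rewrite gx.
have [x <-] := gsurj y; have /T'P[x' /T1P x'T] := hT _ (iF' x).
by move/eqP; rewrite -subr_eq0 -shomB => /eqP/iinj/eqP; rewrite subr_eq0 => /eqP <-.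
Qed.

Lemma inter_submod S T : exists U : submod M, forall v, v \in U <-> v \in S /\ v \in T.
Proof.
pose P v := v \in S /\ v \in T.
have P0 : P 0 by split; exact: rpred0.
have Pl c u w : P u -> P w -> P (c *: u + w).
  by move=> [h1 h2] [h3 h4]; split; rewrite rpredD ?rpredZ.
have Pa a u : P u -> P (act a u) by move=> [h1 h2]; split; exact: submod_act.
have Pp u : P u -> P (par u) by move=> [h1 h2]; split; exact: submod_par.
by exists (prop_submod P0 Pl Pa Pp) => w; exact: prop_submodP.
Qed.

Lemma sum2_submod S T : exists U : submod M,
  forall v, v \in U <-> exists a b, [/\ a \in S, b \in T & v = a + b].
Proof.
pose P v := exists a b, [/\ a \in S, b \in T & v = a + b].
have P0 : P 0 by exists 0, 0; rewrite !rpred0 addr0.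
have Pl c u v : P u -> P v -> P (c *: u + v).
  move=> [a [b [aS bT ->]]] [a' [b' [aS' bT' ->]]]; exists (c *: a + a'), (c *: b + b').
  by rewrite !rpredD ?rpredZ // scalerDr addrACA.
have Pa x v : P v -> P (act x v).
  by move=> [a [b [aS bT ->]]]; exists (act x a), (act x b); rewrite !submod_act // actDr.
have Pp v : P v -> P (par v).
  by move=> [a [b [aS bT ->]]]; exists (par a), (par b); rewrite !submod_par // parD.
by exists (prop_submod P0 Pl Pa Pp) => v; exact: prop_submodP.
Qed.

End Lattice.

(** Otherwise the axiom of choice yields a strictly increasing chain of submodules with property
    P. *)
Lemma acc_exhaust (C : numClosedFieldType) (n : nat) (M : smod C n) (P : submod M -> Prop) F0 :
  (forall F : nat -> submod M, (forall k, {subset F k <= F k.+1}) ->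
    exists N, forall k, (N <= k)%N -> {subset F k <= F N}) ->
  P F0 ->
  (forall F, P F -> (exists v, v \notin F) ->
    exists F', [/\ P F', {subset F <= F'} & exists2 v, v \in F' & v \notin F]) ->
  exists F, P F /\ forall v, v \in F.
Proof.
move=> accM P0 Pstep; apply: contrapT => none.
have next (F : {F | P F}) : exists F' : {F | P F}, {subset sval F <= sval F'} /\
    exists2 v, v \in sval F' & v \notin sval F.
  case: F => F PF /=; have [|F' [PF' FF' hv]] := Pstep F PF; last by exists (exist _ F' PF').
  apply: contrapT => nv; apply: none; exists F; split=> // v.
  by apply/negPn/negP => vF; apply: nv; exists v.
have {}[nx nxP] := choice next.
pose G k := iter k nx (exist _ F0 P0).
have [N hN] := accM (fun k => sval (G k)) (fun k => (nxP (G k)).1).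
have [v vN] := (nxP (G N)).2; apply/negP; rewrite negbK.
exact: hN N.+1 (leqnSn N) v vN.
Qed.

(** * Composition series of a sum of simple submodules *)

Section SemisimpleCount.
Context (C : numClosedFieldType) (n : nat) (M L : smod C n).
Hypothesis M_acc : forall F : nat -> submod M, (forall k, {subset F k <= F k.+1}) ->
    exists N, forall k, (N <= k)%N -> {subset F k <= F N}.
Hypothesis M_simples : forall T : submod M,
  (forall S : submod M, simple (sub_smod S) -> {subset S <= T}) -> forall v, v \in T.
Hypothesis L_simple : simple L.
Hypothesis L_end : forall g : shom L L, exists c, forall x, g x = c *: x.
Hypothesis LM_homog : forall f : shom L M, exists s : bool,
  forall x, f (par x) = (-1) ^+ s *: par (f x).

Lemma schur (K : smod C n) (f : shom L K) (s : bool) :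
  (forall x, f (par x) = (-1) ^+ s *: par (f x)) -> (exists x, f x != 0) ->
  forall x, f x = 0 -> x = 0.
Proof.
move=> fs [x fx]; have [S SP] : exists S : submod L, forall x, x \in S <-> f x = 0.
  by apply: shom_ker => y fy; rewrite fs fy par0 scaler0.
case: (L_simple.2 S) => h y /SP; first exact: h.
by have /SP/eqP := h x; rewrite (negPf fx).
Qed.

Lemma shom_im_homog (K : smod C n) (f : shom L K) (s : bool) :
  (forall x, f (par x) = (-1) ^+ s *: par (f x)) ->
  exists S : submod K, forall y, y \in S <-> exists x, f x = y.
Proof.
move=> fs; apply: shom_im => x; exists ((-1) ^+ s *: par x).
by rewrite shomZ fs scalerA -signr_addb addbb scale1r.
Qed.

(** The first d members of g are a basis of Hom(L, F). The family is indexed by all natural numbers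
    so that it can be prolonged without a change of type. *)
Definition hom_basis (F : submod M) (d : nat) (g : nat -> shom L M) : Prop :=
  [/\ forall i x, (i < d)%N -> g i x \in F,
      forall f : shom L M, (forall x, f x \in F) ->
        exists u : nat -> C, forall x, f x = \sum_(i < d) u i *: g i x &
      forall u : nat -> C, (forall x, \sum_(i < d) u i *: g i x = 0) ->
        forall i, (i < d)%N -> u i = 0].

Definition composition (F : submod M) (k : nat) (G : nat -> submod M) : Prop :=
  [/\ forall v, v \in G 0%N -> v = 0, G k = F &
      forall i, (i < k)%N -> {subset G i <= G i.+1} /\ simple (subquotient (G i) (G i.+1))].

Definition length_at (G : nat -> submod M) k : nat :=
  (\sum_(i < k) `[< isomorphic (subquotient (G i) (G i.+1)) L >])%N.

(** F is enlarged by a simple submodule S that it does not contain, so that F' is the direct sum of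
    F and S. The number of factors L and the dimension of Hom(L, F) grow together: by 1 if S is
    isomorphic to L, and by 0 otherwise. *)
Lemma semisimple_step (F : submod M) k G g : composition F k G ->
  hom_basis F (length_at G k) g -> (exists v, v \notin F) ->
  exists F' k' G' g', [/\ composition F' k' G', hom_basis F' (length_at G' k') g',
    {subset F <= F'} & exists2 v, v \in F' & v \notin F].
Proof.
move=> [G0 Gk Gs] [gF gspan gfree] [v0 v0F].
have [S [Ssim [s sS sF]]] : exists S : submod M, simple (sub_smod S) /\
    exists2 s, s \in S & s \notin F.
  apply: contrapT => none; move: v0F; apply/negP; rewrite negbK.
  apply: M_simples => S Ssim s sS; apply/negPn/negP => sF; apply: none.
  by exists S; split=> //; exists s.
have [Sn0 Smin] := (simple_sub S).1 Ssim.
have SF0 v : v \in S -> v \in F -> v = 0.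
  have [T TP] := inter_submod S F.
  case: (Smin T) => [w /TP[]//|h vS vF|/(_ s sS)/TP[_]]; first exact/h/TP.
  by rewrite (negPf sF).
have [F' F'P] := sum2_submod F S.
have FF' : {subset F <= F'} by move=> v vF; apply/F'P; exists v, 0; rewrite vF rpred0 addr0.
have SF' : {subset S <= F'} by move=> v vS; apply/F'P; exists 0, v; rewrite vS rpred0 add0r.
have F'sim : simple (subquotient F F').
  apply: simple_subquotient => //; first by exists s => //; exact: SF'.
  move=> T FT TF'.
  case: (pselect {subset S <= T}) => [ST|nST]; [right|left] => v.
    by move=> /F'P[a [b [/FT aT /ST bT ->]]]; exact: rpredD.
  move=> vT; have /F'P[a [b [aF bS e]]] := TF' v vT.
  have bT : b \in T.
    have -> : b = v - a by rewrite e; zmod.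
    by apply: submodB => //; exact: FT.
  have [U UP] := inter_submod S T.
  case: (Smin U) => [w /UP[]//|h|h].
    by have b0 : b = 0 by [apply/h/UP]; rewrite e b0 addr0.
  by case: nST => w /h/UP[].
pose G' i := if (i <= k)%N then G i else F'.
have G'k : G' k.+1 = F' by rewrite /G' ltnn.
have G'i i : (i <= k)%N -> G' i = G i by rewrite /G' => ->.
have comp' : composition F' k.+1 G'.
  split=> // i.
  rewrite ltnS leq_eqVlt => /orP[/eqP ->|ik]; first by rewrite G'k G'i // Gk.
  by rewrite !G'i ?(ltnW ik) //; exact: Gs.
have lenE : length_at G' k.+1 = (length_at G k + `[< isomorphic (subquotient F F') L >])%N.
  rewrite /length_at big_ord_recr /= G'k G'i // Gk; congr (_ + _)%N.
  by apply: eq_bigr => i _; rewrite !G'i // ltnW.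
have F'new : exists2 v, v \in F' & v \notin F by exists s => //; exact: SF'.
pose d := length_at G k.
have [q [qsurj q0 qpar]] := subquotient_proj F F'.
case: (pselect (isomorphic (subquotient F F') L)) => [iso|niso]; last first.
  exists F', k.+1, G', g; split=> //; rewrite lenE (asboolF niso) addn0.
  split=> // [i x id|f fF']; first exact/FF'/gF.
  (* The composite of f with the projection to F'/F is zero, as a nonzero one would be an
     isomorphism. *)
  apply: gspan => x; have [f1 f1E] := sub_factor fF'.
  have [psi psiE] := shom_comp q f1; have [t ft] := LM_homog f.
  have psit y : psi (par y) = (-1) ^+ t *: par (psi y).
    by rewrite !psiE qpar -shomZ; congr (q _); apply/val_inj; rewrite /= !f1E ft.
  rewrite -f1E; apply/q0; rewrite -psiE; apply/eqP/negPn/negP => px; apply: niso.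
  have pinj := schur psit (ex_intro _ x px).
  have [U UP] := shom_im_homog psit.
  have psurj y : exists z, psi z = y.
    case: (F'sim.2 U) => h; last by apply/UP.
    have px0 : psi x = 0 by apply/h/UP; exists x.
    by rewrite px0 eqxx in px.
  have [k0 [kK Kk]] := shom_inv (inj_surj_bij pinj psurj).
  by exists k0; exists psi.
have [r rbij] := iso.
have [iS [iSE iSinj iSS iSsurj iSp]] := sincl_exists S.
have [i1 i1E] : exists i1 : shom (sub_smod S) (sub_smod F'), forall x, subspace_val (i1 x) = iS x.
  by apply: sub_factor => x; exact/SF'/iSS.
have [p pE] := shom_comp q i1; have [rp rpE] := shom_comp r p.
have rinj x : r x = 0 -> x = 0.
  by move=> rx; apply: (bij_inj rbij); rewrite rx shom0.
have rpbij : bijective rp.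
  apply: inj_surj_bij => [x|y].
    by rewrite rpE pE => /rinj/q0; rewrite i1E => h; apply/iSinj/SF0.
  have [r' rK r'K] := rbij; have [v vE] := qsurj (r' y).
  have /F'P[a [b [aF bS vab]]] := valP v; have [x xb] := iSsurj b bS; exists x.
  rewrite rpE pE -[RHS]r'K -vE; congr (r _); apply/eqP; rewrite -subr_eq0 -shomB; apply/eqP/q0.
  by rewrite /= i1E xb [subspace_val v]vab opprD addrCA subrr addr0 submodN.
(* The inverse of S -> F'/F -> L, followed by the inclusion of S, is the new basis element. *)
have [j [rpj jrp]] := shom_inv rpbij.
have [iota iE] := shom_comp iS j.
have iotaS x : iota x \in S by rewrite iE.
pose g' i := if (i < d)%N then g i else iota.
have g'd : g' d = iota by rewrite /g' ltnn.
have g'i i : (i < d)%N -> g' i = g i by rewrite /g' => ->.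
have [l l0] := L_simple.1.
have sumE (u : nat -> C) x : \sum_(i < d.+1) u i *: g' i x = \sum_(i < d) u i *: g i x + u d *: iota x.
  by rewrite big_ord_recr /= g'd; congr (_ + _); apply: eq_bigr => i _; rewrite g'i.
exists F', k.+1, G', g'; split=> //; rewrite lenE (asboolT iso) addn1 -/d.
split=> [i x|f fF'|u hu].
- rewrite ltnS leq_eqVlt => /orP[/eqP ->|id]; first by rewrite g'd; exact/SF'.
  by rewrite g'i //; exact/FF'/gF.
(* The composite of f with F' -> F'/F -> L is a scalar c by Schur's lemma, and f - c iota then takes
   values in F. *)
- have [f1 f1E] := sub_factor fF'; have [psi psiE] := shom_comp q f1.
  have [psi' psi'E] := shom_comp r psi; have [c cE] := L_end psi'.
  have [f' f'E] := shom_lincomb (- c) iota f.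
  have f'F x : f' x \in F.
    have -> : f' x = subspace_val (f1 x - c *: i1 (j x)).
      by rewrite f'E /= f1E i1E iE scaleNr addrC.
    apply/q0/rinj; rewrite shomB shomZ -pE -psiE shomB shomZ -psi'E cE -rpE jrp.
    exact: subrr.
  have [u uE] := gspan f' f'F; pose u' i := if (i < d)%N then u i else c; exists u' => x.
  rewrite (sumE u') /u' ltnn (eq_bigr (fun i : 'I_d => u i *: g i x)) => [|i _]; last by rewrite ltn_ord.
  by rewrite -uE f'E scaleNr addrAC addNr add0r.
(* A nonzero coefficient of iota would put a nonzero vector of S into F. *)
have ud : u d = 0.
  apply/eqP/negPn/negP => ud; case/negP: l0; apply/eqP.
  have il0 : iota l = 0.
    apply: SF0 => //; rewrite -[iota l]scale1r -(mulVf ud) -scalerA rpredZ //.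
    have := hu l; rewrite sumE addrC => /eqP; rewrite addr_eq0 => /eqP ->.
    by rewrite submodN // rpred_sum // => i _; rewrite rpredZ // gF.
  have jl : j l = 0 by apply: iSinj; rewrite -iE.
  by rewrite -(jrp l) jl shom0.
move=> i; rewrite ltnS leq_eqVlt => /orP[/eqP -> //|id].
by apply: gfree id => x; have := hu x; rewrite sumE ud scale0r addr0.
Qed.

Theorem semisimple_count : exists d (g : nat -> shom L M),
  [/\ multiplicity M L d,
      forall f : shom L M, exists u : nat -> C, forall x, f x = \sum_(i < d) u i *: g i x &
      forall u : nat -> C, (forall x, \sum_(i < d) u i *: g i x = 0) ->
        forall i, (i < d)%N -> u i = 0].
Proof.
pose P F := exists k G g, composition F k G /\ hom_basis F (length_at G k) g.
have [Z ZP] : exists Z : submod M, forall v, v \in Z <-> v = 0.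
  have [f fE] := shom_id M.
  have h x : f x = 0 -> f (par x) = 0 by rewrite !fE => ->; exact: par0.
  by have [S SP] := shom_ker h; exists S => v; rewrite SP fE.
have [z _] := shom_zero L M.
have PZ : P Z.
  exists 0%N, (fun=> Z), (fun=> z); split; first by split=> // v /ZP.
  rewrite /length_at big_ord0; split=> // f fZ; exists (fun=> 0) => x.
  by rewrite big_ord0; exact/ZP.
have [F PF vF|F [[k [G [g [[G0 Gk Gs] [gF gspan gfree]]]]] Fall]] := acc_exhaust M_acc PZ.
  have [k [G [g [cF bF]]]] := PF.
  have [F' [k' [G' [g' [cF' bF' FF' nF]]]]] := semisimple_step cF bF vF.
  by exists F'; split=> //; exists k', G', g'.
exists (length_at G k), g; split=> //; last by move=> f; apply: gspan => x; exact: Fall.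
by exists k, G; split=> // v; rewrite Gk; exact: Fall.
Qed.

End SemisimpleCount.

(** * Morphisms from L to a quotient of a Verma module *)

Section SocleCount.
Context (C : numClosedFieldType) (n : nat) (mu lam : 'rV[C]_n).
Context (V : smod C n) (v0 : V) (HV : verma_spec lam v0).
Context (L : smod C n) (l0 : L) (HL : simple_spec mu l0).
Context (Q : smod C n) (q : shom V Q).
Hypotheses (qsurj : forall y : Q, exists x : V, q x = y)
  (qpar : forall x : V, par (q x) = q (par x)).

Lemma simple_weight : weight_vector mu l0.
Proof. by move=> h ch; rewrite (ss_borel HL) //; exact: cartan_borel. Qed.

(** The image of l0 lifts to a weight vector of V, which has a parity by [verma_parity]; the sign
    then propagates from the generator to all of L. *)
Lemma shom_homog_quot (f : shom L Q) : exists s : bool,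
  forall x : L, f (par x) = (-1) ^+ s *: par (f x).
Proof.
have [x [qx xw]] := weight_lift (verma_semisimple HV) (qsurj (f l0)) (shom_weight f simple_weight).
have [b xb] := verma_parity HV xw.
have fb : par (f l0) = (-1) ^+ b *: f l0 by rewrite -qx qpar xb shomZ.
exists b => y; elim/(ss_span HL): y => [c u v hu hv||x' v hv].
- by rewrite par_lin !shomP hu hv par_lin scalerDr !scalerA mulrC.
- by rewrite (ss_par HL) fb scalerA -signr_addb addbb scale1r.
by rewrite par_actE !shom_act hv actZr par_actE.
Qed.

Lemma shom_homog_sub (K : smod C n) (i : shom K Q) (f : shom L K) :
  (forall x, i x = 0 -> x = 0) -> (forall x, i (par x) = par (i x)) ->
  exists s : bool, forall x : L, f (par x) = (-1) ^+ s *: par (f x).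
Proof.
move=> iinj ipar; have [k kE] := shom_comp i f; have [s ks] := shom_homog_quot k.
exists s => x; apply/eqP; rewrite -subr_eq0; apply/eqP/iinj.
by rewrite shomB shomZ ipar -!kE ks subrr.
Qed.

(** The image of f is a submodule by homogeneity, and simple or zero because L is simple. *)
Lemma shom_socle (f : shom L Q) x : f x \in socle Q.
Proof.
have [s fs] := shom_homog_quot f.
have [S SP] := shom_im_homog fs.
case: (pselect (exists y, f y != 0)) => [fn0|f0]; last first.
  suff -> : f x = 0 by exact: rpred0.
  by apply/eqP/negPn/negP => fx; apply: f0; exists x.
apply/sum_submodP => T; apply; last by apply/SP; exists x.
apply/simple_sub; split.
  by have [y fy] := fn0; exists (f y) => //; apply/SP; exists y.
move=> U US; have [p [ps pk pp]] := qproj_exists U; have [g gE] := shom_comp p f.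
have gk y : g y = 0 -> g (par y) = 0.
  by rewrite !gE fs shomZ -pp => ->; rewrite par0 scaler0.
have [K KP] := shom_ker gk; case: ((ss_simple HL).2 K) => h; [left=> u uU|right=> u].
  have /SP[y yu] := US u uU; have /h y0 : y \in K by apply/KP; rewrite gE yu; apply/pk.
  by rewrite -yu y0 shom0.
by move=> /SP[y <-]; apply/pk; rewrite -gE; exact/KP.
Qed.

Local Notation M := (sub_smod (socle Q)).

(** A chain is pushed forward to Q and pulled back to V, where it becomes stationary. *)
Lemma socle_acc (F : nat -> submod M) : (forall k, {subset F k <= F k.+1}) ->
  exists N, forall k, (N <= k)%N -> {subset F k <= F N}.
Proof.
move=> Fm; have [i [iE iinj iS isurj ipar]] := sincl_exists (socle Q).
have [F1 F1P] := choice (fun k => shom_image (F k) ipar).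
have [F2 F2P] := choice (fun k => shom_preim (F1 k) qpar).
have [|N hN] := verma_noetherian HV (F := F2).
  by move=> k x /F2P/F1P[y yF yx]; apply/F2P/F1P; exists y => //; exact: Fm.
exists N => k Nk x xF; have [v vx] := qsurj (i x).
have /(hN k Nk)/F2P/F1P[y yF] : v \in F2 k by apply/F2P/F1P; exists x.
by rewrite vx => /eqP; rewrite -subr_eq0 -shomB => /eqP/iinj/eqP; rewrite subr_eq0 => /eqP <-.
Qed.

Lemma socle_simples (T : submod M) :
  (forall S : submod M, simple (sub_smod S) -> {subset S <= T}) -> forall v, v \in T.
Proof.
move=> hT v; have [i [iE iinj iS isurj ipar]] := sincl_exists (socle Q).
have i_inj x y : i x = i y -> x = y.
  by move/eqP; rewrite -subr_eq0 -shomB => /eqP/iinj/eqP; rewrite subr_eq0 => /eqP.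
have [T' T'P] := shom_image T ipar.
suff h : i v \in T' by have /T'P[y yT /i_inj <-] := h.
have vs := (sum_submodP _ _).1 (iS v); apply: vs => S Ssim s sS.
have [[w wS w0] Smin] := (simple_sub S).1 Ssim.
have Ssoc u : u \in S -> u \in socle Q by move=> uS; apply/sum_submodP => U hU; exact: hU S Ssim u uS.
have [x xs] := isurj s (Ssoc s sS); apply/T'P; exists x => //.
apply: (hT (restr_submod S (socle Q))); last by apply/restr_submodP; rewrite -iE xs.
apply/simple_sub; split.
  have [y yw] := isurj w (Ssoc w wS); exists y; first by apply/restr_submodP; rewrite -iE yw.
  by apply: contra w0 => /eqP y0; rewrite -yw y0 shom0.
move=> U US; have [U' U'P] := shom_image U ipar.
case: (Smin U') => [u /U'P[y /US/restr_submodP yS <-]|h|h]; first by rewrite iE.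
  by left=> y yU; apply: iinj; apply: h; apply/U'P; exists y.
right=> y /restr_submodP; rewrite -iE => /h/U'P[z zU /i_inj <-] //.
Qed.

Theorem socle_count : exists d (g : nat -> shom L Q),
  [/\ multiplicity M L d,
      forall f : shom L Q, exists u : nat -> C, forall x, f x = \sum_(i < d) u i *: g i x &
      forall u : nat -> C, (forall x, \sum_(i < d) u i *: g i x = 0) ->
        forall i, (i < d)%N -> u i = 0].
Proof.
have [i [iE iinj iS isurj ipar]] := sincl_exists (socle Q).
have [d [g [mult gspan gfree]]] := semisimple_count socle_acc socle_simples (ss_simple HL)
  (ss_end HL) (fun f => shom_homog_sub f iinj ipar).
have [g' g'E] := choice (fun k => shom_comp i (g k)).
have sumE (u : nat -> C) x : \sum_(k < d) u k *: g' k x = i (\sum_(k < d) u k *: g k x).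
  rewrite linear_sum; apply: eq_bigr => k _; rewrite g'E linearZ //.
exists d, g'; split=> // [f|u hu].
  have [f1 f1E] := sub_factor (shom_socle f).
  by have [u uE] := gspan f1; exists u => x; rewrite sumE -uE iE f1E.
by apply: gfree => x; apply: iinj; rewrite -sumE hu.
Qed.

End SocleCount.

(** * Extensions as pullbacks *)

Section FiberProduct.
Context (C : numClosedFieldType) (n : nat) (X L Q : smod C n) (s : bool).

Definition prod_act x (z : X * L) : X * L := (act x z.1, act x z.2).
(** Twisting the parity of L by the sign of f makes the equation q x = f l stable under parity, so
    that the fibre product is graded. *)
Definition prod_par (z : X * L) : X * L := (par z.1, (-1) ^+ s *: par z.2).

Definition prod_smod : smod C n.
Proof.
refine (@Smod C n (X * L)%type prod_act prod_par _ _ _ _ _ _).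
- by move=> c x y v; rewrite /prod_act !act_linl.
- by move=> x c u v; rewrite /prod_act !act_linr.
- by move=> a b x y v hx hy; rewrite /prod_act /= !(act_bracket _ hx hy).
- by move=> c u v; rewrite /prod_par !par_lin; congr (_, _); rewrite /= scalerDr !scalerA mulrC.
- move=> [x l]; rewrite /prod_par /= par_invol parZ par_invol scalerA.
  by rewrite -signr_addb addbb scale1r.
move=> a x v hx; rewrite /prod_act /prod_par /= !(par_act _ hx) actZr.
by congr (_, _); rewrite /= !scalerA mulrC.
Defined.

Context (q : shom X Q) (f : shom L Q).
Hypotheses (qpar : forall x, par (q x) = q (par x))
  (fs : forall x, f (par x) = (-1) ^+ s *: par (f x)).

Lemma fiber_submod : exists S : submod prod_smod, forall z, z \in S <-> q z.1 = f z.2.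
Proof.
pose P (z : prod_smod) := q z.1 = f z.2.
have P0 : P 0 by rewrite /P /= !shom0.
have Pl c u v : P u -> P v -> P (c *: u + v) by rewrite /P /= !shomP => -> ->.
have Pa x v : P v -> P (act x v) by rewrite /P /= !shom_act => ->.
have Pp v : P v -> P (par v).
  by rewrite /P /= shomZ fs scalerA -signr_addb addbb scale1r -qpar => ->.
by exists (prop_submod P0 Pl Pa Pp) => z; exact: prop_submodP.
Qed.

Lemma fiber_product : exists (E : smod C n) (k : shom E X) (p : shom E L),
  [/\ forall e, q (k e) = f (p e), forall e, k e = 0 -> p e = 0 -> e = 0 &
      forall x l, q x = f l -> exists e, k e = x /\ p e = l].
Proof.
have [S SP] := fiber_submod.
have kl c (u v : sub_smod S) : (subspace_val (c *: u + v)).1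
  = c *: (subspace_val u).1 + (subspace_val v).1 by [].
have pl c (u v : sub_smod S) : (subspace_val (c *: u + v)).2
  = c *: (subspace_val u).2 + (subspace_val v).2 by [].
have ka x (u : sub_smod S) : (subspace_val (act x u)).1 = act x (subspace_val u).1 by [].
have pa x (u : sub_smod S) : (subspace_val (act x u)).2 = act x (subspace_val u).2 by [].
exists (sub_smod S), (mk_shom kl ka), (mk_shom pl pa); split=> [e|e k0 p0|x l xl].
- by apply/SP; exact: (valP e).
- by apply/val_inj; rewrite /= [subspace_val e]surjective_pairing; move: k0 p0 => /= -> ->.
have eS : (x, l) \in S by apply/SP.
by exists (SubspaceOf eS).
Qed.

End FiberProduct.

(** * The extension attached to a morphism from L to Q *)

Section Extensions.
Context (C : numClosedFieldType) (n : nat) (lam lamb mu : 'rV[C]_n).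
Context (B : smod C n) (b0 : B) (HB : verma_spec lam b0).
Context (X : smod C n) (x0 : X) (HX : verma_spec lamb x0).
Context (L : smod C n) (l0 : L) (HL : simple_spec mu l0).
Context (Q : smod C n) (j : shom B X) (q : shom X Q).
Hypotheses (jinj : forall b, j b = 0 -> b = 0) (qj : forall x, q x = 0 <-> exists b, x = j b)
  (qsurj : forall y : Q, exists x : X, q x = y) (qpar : forall x : X, par (q x) = q (par x)).

(* [E] is the pullback of X -> Q along [f]. *)
Definition realizes (f : shom L Q) (E : extension L B) (k : shom E X) : Prop :=
  (forall e, q (k e) = f (ext_p E e)) /\ (forall b, k (ext_i E b) = j b).

Lemma borel_bp_span (P : Defs.pe C n -> Prop) : (forall c x y, P x -> P y -> P (c *: x + y)) ->
  P 0 -> (forall y, y \in basis_list C n -> borel y -> P y) -> forall x, borel x -> P x.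
Proof.
move=> Pl P0 Pb x /bp_id <-; move: x.
apply: pe_span => [c x y hx hy||i i'|i i'|i i'].
- by rewrite bp_linear; exact: Pl.
- by rewrite bp_id //; apply/borelE; rewrite dl0; split=> // i k _; rewrite ul0 mxE.
- have [le|lt] := leqP i i'; last by rewrite bp_mneg //; exact: mneg_eE.
  have [h _ _] := basis_list_mem C i i'.
  by rewrite bp_id; [apply: Pb h _|]; exact: borel_eE.
- have [_ h _] := basis_list_mem C i i'.
  by rewrite bp_id; [apply: Pb h _|]; exact: borel_sB.
by rewrite bp_mneg //; exact: mneg_cD.
Qed.

Section FiberInO.
Context (E : smod C n) (k : shom E X) (p : shom E L) (f : shom L Q).
Hypotheses (kp : forall e, q (k e) = f (p e)) (kp0 : forall e, k e = 0 -> p e = 0 -> e = 0)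
  (kps : forall x l, q x = f l -> exists e, k e = x /\ p e = l).

Lemma fiber_incl : exists i : shom B E, forall b, k (i b) = j b /\ p (i b) = 0.
Proof.
have h b : exists e, k e = j b /\ p e = 0.
  by apply: kps; rewrite shom0; apply/qj; exists b.
have [i iE] := choice h.
have uniq e e' : k e = k e' -> p e = p e' -> e = e'.
  move=> hk hp; apply/eqP; rewrite -subr_eq0; apply/eqP.
  by apply: kp0; rewrite shomB ?hk ?hp subrr.
have il c u v : i (c *: u + v) = c *: i u + i v.
  have [[h1 h2] [[h3 h4] [h5 h6]]] := (iE (c *: u + v), (iE u, iE v)).
  by apply: uniq; rewrite !shomP ?h1 ?h2 ?h3 ?h4 ?h5 ?h6 ?shomP // scaler0 addr0.
have ia x v : i (act x v) = act x (i v).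
  have [[h1 h2] [h3 h4]] := (iE (act x v), iE v).
  by apply: uniq; rewrite !shom_act ?h1 ?h2 ?h3 ?h4 ?shom_act ?act0r.
by exists (mk_shom il ia).
Qed.

Context (i : shom B E) (iE : forall b, k (i b) = j b /\ p (i b) = 0).

Lemma fiber_exact e : p e = 0 <-> exists b, e = i b.
Proof.
split=> [pe|[b ->]]; last by case: (iE b).
have /qj[b kb] : q (k e) = 0 by rewrite kp pe shom0.
exists b; have [h1 h2] := iE b; apply/eqP; rewrite -subr_eq0; apply/eqP.
by apply: kp0; rewrite shomB ?h1 ?h2 ?kb ?pe subrr.
Qed.

(** E is generated by [i b0] and a weight vector e0 over l0. Borel elements map e0 into C e0 + i(B).
    As the Borel subalgebra is finite-dimensional, one filtration step of B catches all the
    components in i(B); its image and e0 then span a finite-dimensional Borel-stable generating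
    space. *)
Lemma fiber_in_O : in_O E.
Proof.
have iP e := (fiber_exact e).1.
have [e0 [e0p e0w]] : exists e0, p e0 = l0 /\ weight_vector mu e0.
  have [x [xq xw]] := weight_lift (verma_semisimple HX) (qsurj (f l0))
    (shom_weight f (simple_weight HL)).
  have [e [ke pe]] := kps xq; exists e; split=> // h ch.
  apply/eqP; rewrite -subr_eq0; apply/eqP; apply: kp0; rewrite shomB shom_act shomZ.
    by rewrite ke xw // subrr.
  by rewrite pe (simple_weight HL) // subrr.
have gen (P : E -> Prop) : (forall c u v, P u -> P v -> P (c *: u + v)) ->
    P (i b0) -> P e0 -> (forall x v, P v -> P (act x v)) -> forall e, P e.
  move=> Pl Pb Pe Pa e.
  have Pi b : P (i b).
    elim/(vs_span HB): b => [c u v hu hv||x v hv] //; first by rewrite shomP; exact: Pl.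
    by rewrite shom_act; exact: Pa.
  have [e' [pe' Pe']] : exists e', p e' = p e /\ P e'.
    elim/(ss_span HL): (p e) => [c u v [u' [hu Pu]] [v' [hv Pv]]||x v [v' [hv Pv]]].
    - by exists (c *: u' + v'); rewrite shomP hu hv; split=> //; exact: Pl.
    - by exists e0.
    by exists (act x v'); rewrite shom_act hv; split=> //; exact: Pa.
  have [|b eb] := iP (e - e'); first by rewrite shomB pe' subrr.
  have -> : e = 1 *: i b + e' by rewrite scale1r -eb subrK.
  exact: Pl.
have borel_e0 y : borel y -> exists b, act y e0 - weight_val mu y *: e0 = i b.
  move=> hy; have [|b h] := iP (act y e0 - weight_val mu y *: e0); last by exists b.
  by rewrite shomB shom_act shomZ e0p (ss_borel HL) // subrr.
pose wl := word_list [:: b0].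
have b0_borel x u : borel x -> u \in [:: b0] -> fspan [:: b0] (act x u).
  move=> bx; rewrite inE => /eqP ->; rewrite (vs_borel HB) // -[_ *: _]addr0.
  by apply: fspanP; [apply: fspan_mem; rewrite inE|exact: fspan0].
have b0_span (P : B -> Prop) : P 0 -> (forall c u v, P u -> P v -> P (c *: u + v)) ->
    (forall u, u \in [:: b0] -> P u) -> (forall x v, P v -> P (act x v)) -> forall v, P v.
  by move=> P0 Pl Pb Pa; apply: (vs_span HB) => //; apply: Pb; rewrite inE.
have [K hK] : exists K, forall y, y \in basis_list C n -> borel y ->
    exists2 b, fspan (wl K) b & act y e0 - weight_val mu y *: e0 = i b.
  elim: (basis_list C n) => [|y t [K hK]]; first by exists 0%N.
  case: (pselect (borel y)) => [hy|ny]; last first.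
    exists K => y'; rewrite inE => /orP[/eqP ->|] //; exact: hK.
  have [b yb] := borel_e0 y hy; have [K' hK'] := word_list_all b0_span b.
  exists (maxn K K') => y'; rewrite inE => /orP[/eqP -> _|y't by'].
    by exists b => //; apply: word_list_mono hK'; exact: leq_maxr.
  have [b' hb' yb'] := hK y' y't by'; exists b' => //.
  by apply: word_list_mono hb'; exact: leq_maxl.
pose s0 := e0 :: [seq i b | b <- wl K].
have ispan b : fspan (wl K) b -> fspan s0 (i b).
  move: b; apply: fspan_ind => [|c u v hu hv|b bK].
  - by rewrite shom0; exact: fspan0.
  - by rewrite shomP; exact: fspanP.
  by apply: fspan_mem; rewrite inE map_f // orbT.
have s0_borel x u : borel x -> u \in s0 -> fspan s0 (act x u).
  move=> bx; rewrite inE => /orP[/eqP ->|/mapP[b bK ->]]; last first.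
    rewrite -shom_act; apply: ispan; apply: word_list_borel => //; exact: fspan_mem.
  move: x bx; apply: borel_bp_span => [c x y hx hy||y yb hy].
  - by rewrite act_linl; exact: fspanP.
  - by rewrite act0l; exact: fspan0.
  have [b bK yb'] := hK y yb hy.
  rewrite -[act y e0](subrK (weight_val mu y *: e0)) yb' addrC; apply: fspanP.
    by apply: fspan_mem; rewrite inE eqxx.
  exact: ispan.
have b0K : fspan (wl K) b0.
  by apply: (@word_list_mono _ _ _ _ 0%N) => //; apply: fspan_mem; rewrite inE.
have s0_span (P : E -> Prop) : P 0 -> (forall c u v, P u -> P v -> P (c *: u + v)) ->
    (forall u, u \in s0 -> P u) -> (forall x v, P v -> P (act x v)) -> forall v, P v.
  move=> P0 Pl Ps Pa; apply: gen => //; last by apply: Ps; rewrite inE eqxx.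
  by apply: (fspan_ind P0 Pl Ps); exact: ispan.
split.
- exists [:: i b0; e0] => v U Ua Ug; elim/gen: v => [c u v uU vU|||x v vU].
  + by rewrite rpredD ?rpredZ.
  + by apply: Ug; rewrite !inE eqxx.
  + by apply: Ug; rewrite !inE eqxx orbT.
  exact: Ua.
- apply/wsum_cartan_semisimple; apply: gen => [c u v hu hv|||x v].
  + by apply: wsumD => //; exact: wsumZ.
  + by apply: (@wsum_weight _ _ _ lam); apply: shom_weight; exact: verma_weight HB.
  + exact: wsum_weight e0w.
  exact: wsum_act.
exact: borel_span_locally_finite s0_borel s0_span.
Qed.

End FiberInO.

Lemma realizes_exists (f : shom L Q) : exists E k, @realizes f E k.
Proof.
have [s fs] := shom_homog_quot HX HL qsurj qpar f.
have [E [k [p [kp kp0 kps]]]] := fiber_product qpar fs.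
have [i iE] := fiber_incl kp0 kps.
have iinj : injective i.
  move=> b b' e; apply/eqP; rewrite -subr_eq0; apply/eqP/jinj.
  by rewrite -(iE _).1 shomB e subrr shom0.
have psurj l : exists e, p e = l.
  by have [x xl] := qsurj (f l); have [e [_ pe]] := kps _ _ xl; exists e.
exists (Extension (fiber_in_O kp kp0 kps iE) iinj psurj (fiber_exact kp kp0 iE)), k.
by split=> // b; case: (iE b).
Qed.

(** As j is injective, E embeds into the product of X and L. Together with [ext_fiber] this
    identifies E with the fibre product over Q, whose universal property is [ext_lift]. *)
Lemma extP (E : extension L B) e e' (k : shom E X) f : realizes f k ->
  k e = k e' -> ext_p E e = ext_p E e' -> e = e'.
Proof.
move=> [_ kj] hk hp; apply/eqP; rewrite -subr_eq0; apply/eqP.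
have /(ext_exact (e - e')).1[b eb] : ext_p E (e - e') = 0 by rewrite shomB hp subrr.
have b0' : b = 0 by apply: jinj; rewrite -kj -eb shomB hk subrr.
by rewrite eb b0' shom0.
Qed.

Lemma ext_fiber (E : extension L B) (k : shom E X) f x l : realizes f k ->
  q x = f l -> exists e, k e = x /\ ext_p E e = l.
Proof.
move=> [kf kj] xl; have [e1 pe1] := ext_surj E l.
have /qj[b xb] : q (x - k e1) = 0 by rewrite shomB kf pe1 xl subrr.
exists (e1 + ext_i E b); rewrite !shomD kj -xb addrC subrK; split=> //.
by rewrite pe1 (ext_exact _).2 ?addr0 //; exists b.
Qed.

Lemma ext_lift (K : smod C n) (E : extension L B) (k : shom E X) f (g : shom K X) (r : shom K L) :
  realizes f k -> (forall x, q (g x) = f (r x)) ->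
  exists h : shom K E, forall x, k (h x) = g x /\ ext_p E (h x) = r x.
Proof.
move=> kf gr; have [h hE] := choice (fun x => ext_fiber kf (gr x)).
have hl c u v : h (c *: u + v) = c *: h u + h v.
  have [[h1 h2] [[h3 h4] [h5 h6]]] := (hE (c *: u + v), (hE u, hE v)).
  by apply: (extP kf); rewrite !shomP ?h1 ?h2 ?h3 ?h4 ?h5 ?h6 ?shomP.
have ha x v : h (act x v) = act x (h v).
  have [[h1 h2] [h3 h4]] := (hE (act x v), hE v).
  by apply: (extP kf); rewrite !shom_act ?h1 ?h2 ?h3 ?h4 ?shom_act.
by exists (mk_shom hl ha).
Qed.

Lemma ext_pi (E : extension L B) b : ext_p E (ext_i E b) = 0.
Proof. by apply/ext_exact; exists b. Qed.

(** The two inputs that depend on the simple root: the first makes the morphism from L to Q attached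
    to an extension unique, the second makes it exist. *)
Hypothesis hom_LX : forall (g : shom L X) x, g x = 0.
Hypothesis ext_retract : forall E : extension L B, exists k : shom E X, forall b, k (ext_i E b) = j b.

Lemma ext_factor (K : smod C n) (E : extension L B) (g : shom E K) :
  (forall b, g (ext_i E b) = 0) -> exists r : shom L K, forall e, r (ext_p E e) = g e.
Proof.
move=> gi; have [t tE] := choice (ext_surj E).
have gp e e' : ext_p E e = ext_p E e' -> g e = g e'.
  move=> h; apply/eqP; rewrite -subr_eq0 -shomB.
  have /(ext_exact (e - e')).1[b ->] : ext_p E (e - e') = 0 by rewrite shomB h subrr.
  by rewrite gi.
have rl c u v : g (t (c *: u + v)) = c *: g (t u) + g (t v).
  by rewrite -shomP; apply: gp; rewrite shomP !tE.
have ra x v : g (t (act x v)) = act x (g (t v)).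
  by rewrite -shom_act; apply: gp; rewrite shom_act !tE.
by exists (mk_shom rl ra) => e /=; apply: gp.
Qed.

Lemma every_ext_realizes (E : extension L B) : exists f (k : shom E X), realizes f k.
Proof.
have [k kj] := ext_retract E; have [g gE] := shom_comp q k.
have [|f fE] := ext_factor (g := g); first by move=> b; rewrite gE kj; apply/qj; exists b.
by exists f, k; split=> // e; rewrite fE gE.
Qed.

Lemma realizes_equiv (E E' : extension L B) f (k : shom E X) (k' : shom E' X) :
  realizes f k -> realizes f k' -> ext_equiv E E'.
Proof.
move=> kf kf'; have [h hE] := ext_lift (g := k) (r := ext_p E) kf' kf.1.
exists h; split=> [b|e]; last by case: (hE e).
apply: (extP kf'); first by rewrite (hE _).1 kf.2 kf'.2.
by rewrite (hE _).2 !ext_pi.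
Qed.

(** Two morphisms from E to X that agree on B differ by one that factors through L, hence by
    zero. *)
Lemma equiv_realizes (E E' : extension L B) f f' (k : shom E X) (k' : shom E' X) :
  realizes f k -> realizes f' k' -> ext_equiv E E' -> forall x, f x = f' x.
Proof.
move=> kf kf' [h [hi hp]] x; have [kh khE] := shom_comp k' h.
have [g gE] := shom_lincomb (-1) kh k.
have [b|r rE] := ext_factor (g := g).
  by rewrite gE khE hi kf.2 kf'.2 scaleN1r addNr.
have [e <-] := ext_surj E x; rewrite -kf.1 -[in RHS]hp -kf'.1 -khE; congr (q _).
have := rE e; rewrite hom_LX gE scaleN1r => /esym/eqP.
by rewrite addrC subr_eq0 => /eqP.
Qed.

Lemma realizes_scale c (E E' : extension L B) f f' (k : shom E X) (k' : shom E' X) :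
  realizes f k -> realizes f' k' -> (forall x, f' x = c *: f x) -> ext_scale c E E'.
Proof.
move=> kf kf' ff'; have [z0 z0E] := shom_zero E X.
have [ck ckE] := shom_lincomb c k z0.
have [h hE] : exists h : shom E E', forall x, k' (h x) = ck x /\ ext_p E' (h x) = ext_p E x.
  by apply: ext_lift kf' _ => x; rewrite ckE z0E addr0 shomZ kf.1 ff'.
exists h; split=> [b|e]; last by case: (hE e).
apply: (extP kf'); first by rewrite (hE _).1 ckE z0E addr0 kf.2 kf'.2 shomZ.
by rewrite (hE _).2 !ext_pi.
Qed.

Lemma realizes_baer (E1 E2 E : extension L B) f1 f2 f (k1 : shom E1 X) (k2 : shom E2 X)
    (k : shom E X) : realizes f1 k1 -> realizes f2 k2 -> realizes f k ->
  (forall x, f x = f1 x + f2 x) -> ext_baer E1 E2 E.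
Proof.
move=> kf1 kf2 kf fE.
have h (z : E1 * E2) : exists e, in_fiber z -> k e = k1 z.1 + k2 z.2 /\ ext_p E e = ext_p E1 z.1.
  (* Pairs outside the fibre product get the default value 0; [ext_baer] only speaks of pairs inside
     it. *)
  case: (pselect (in_fiber z)) => [zf|nz]; last by exists 0.
  have [|e he] := @ext_fiber E k f (k1 z.1 + k2 z.2) (ext_p E1 z.1) kf; last by exists e.
  by rewrite shomD kf1.1 kf2.1 fE zf.
have {h}[g gE] := choice h.
have fl c z w : in_fiber z -> in_fiber w -> in_fiber (c *: z + w : E1 * E2).
  by rewrite /in_fiber /= !shomP => -> ->.
have fa x (z : E1 * E2) : in_fiber z -> in_fiber (act x z.1, act x z.2).
  by rewrite /in_fiber /= !shom_act => ->.
have fi b1 b2 : in_fiber (ext_i E1 b1, ext_i E2 b2) by rewrite /in_fiber /= !ext_pi.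
exists g; split=> [c z w hz hw|x z hz|b1 b2|z hz].
- have [[h1 h2] [[h3 h4] [h5 h6]]] := (gE _ (fl c _ _ hz hw), (gE z hz, gE w hw)).
  apply: (extP kf); rewrite !shomP ?h1 ?h2 ?h3 ?h4 ?h5 ?h6 /= !shomP //.
  by rewrite scalerDr addrACA.
- have [[h1 h2] [h3 h4]] := (gE _ (fa x z hz), gE z hz).
  by apply: (extP kf); rewrite !shom_act ?h1 ?h2 ?h3 ?h4 /= !shom_act // actDr.
- have [h1 h2] := gE _ (fi b1 b2); apply: (extP kf); rewrite ?h1 ?h2 /= ?ext_pi //.
  by rewrite kf1.2 kf2.2 kf.2 shomD.
by case: (gE z hz).
Qed.

Theorem ext1_dim_hom d (g : nat -> shom L Q) :
  (forall f : shom L Q, exists u : nat -> C, forall x, f x = \sum_(i < d) u i *: g i x) ->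
  (forall u : nat -> C, (forall x, \sum_(i < d) u i *: g i x = 0) ->
    forall i, (i < d)%N -> u i = 0) ->
  ext1_dim L B d.
Proof.
move=> gspan gfree.
(* The class with coordinates u is the pullback along the combination of the g_i with coefficients
   u_i. *)
have hex (u : 'rV[C]_d) : exists E : extension L B, exists (f : shom L Q) (k : shom E X),
    realizes f k /\ forall x, f x = \sum_(i < d) u 0 i *: g i x.
  have [f fE] := shom_sum (fun i : 'I_d => u 0 i) (fun i : 'I_d => g i).
  by have [E [k kf]] := realizes_exists f; exists E, f, k.
have {hex}[eps epsP] := choice hex; exists eps; split.
- move=> u v; have [f1 [k1 [kf1 f1E]]] := epsP u; have [f2 [k2 [kf2 f2E]]] := epsP v.
  have [f [k [kf fE]]] := epsP (u + v); apply: (realizes_baer kf1 kf2 kf) => x.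
  by rewrite f1E f2E fE -big_split; apply: eq_bigr => i _; rewrite mxE scalerDl.
- move=> c u; have [f1 [k1 [kf1 f1E]]] := epsP u; have [f [k [kf fE]]] := epsP (c *: u).
  apply: (realizes_scale kf1 kf) => x.
  by rewrite f1E fE scaler_sumr; apply: eq_bigr => i _; rewrite mxE scalerA.
- move=> u v; have [f1 [k1 [kf1 f1E]]] := epsP u; have [f2 [k2 [kf2 f2E]]] := epsP v.
  move=> /(equiv_realizes kf1 kf2) uv; apply/rowP => i.
  pose w (i : nat) := if insub i is Some i' then u 0 i' - v 0 i' else 0.
  have wE (i' : 'I_d) : w i' = u 0 i' - v 0 i' by rewrite /w valK.
  apply/eqP; rewrite -subr_eq0 -wE; apply/eqP/(gfree w) => // x.
  rewrite (eq_bigr (fun i' : 'I_d => u 0 i' *: g i' x - v 0 i' *: g i' x)) => [|i' _].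
    by rewrite sumrB -f1E -f2E uv subrr.
  by rewrite wE scalerBl.
move=> E; have [f' [k' kf']] := every_ext_realizes E.
have [w wE] := gspan f'; pose u : 'rV[C]_d := \row_i w i; exists u.
have [f [k [kf fE]]] := epsP u; apply: (realizes_equiv (k' := k') kf).
have ff x : f x = f' x by rewrite fE wE; apply: eq_bigr => i _; rewrite mxE.
by split; [move=> e; rewrite ff kf'.1|exact: kf'.2].
Qed.

End Extensions.

(** In both cases below the extension of j is easier to describe by its graph than by a formula. An
    invariant linear relation that is single-valued at 0 is the graph of a morphism as soon as it is
    defined on B and at one lift of l0, which together generate E. *)
Lemma graph_shom (C : numClosedFieldType) (n : nat) (E X L : smod C n) (mu : 'rV[C]_n) (l0 : L)
    (HL : simple_spec mu l0) (B : smod C n) (i : shom B E) (p : shom E L) (j : shom B X)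
    (G : E -> X -> Prop) :
  (forall e, p e = 0 -> exists b, e = i b) ->
  (forall c e x e' x', G e x -> G e' x' -> G (c *: e + e') (c *: x + x')) ->
  (forall y e x, G e x -> G (act y e) (act y x)) -> (forall x, G 0 x -> x = 0) ->
  (forall b, G (i b) (j b)) -> (exists e x, p e = l0 /\ G e x) ->
  exists k : shom E X, forall b, k (i b) = j b.
Proof.
move=> pi Gl Ga G0 Gij [e0 [x0 [pe0 Ge0]]].
have Gu e x x' : G e x -> G e x' -> x = x'.
  move=> h h'; apply/eqP; rewrite -subr_eq0; apply/eqP/G0.
  by have := Gl (-1) _ _ _ _ h' h; rewrite !scaleN1r addNr addrC.
have tot e : exists x, G e x.
  have [e' [x' [pe' Gx']]] : exists e' x', p e' = p e /\ G e' x'.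
    elim/(ss_span HL): (p e) => [c u v [e1 [x1 [<- g1]]] [e2 [x2 [<- g2]]]||y v [e1 [x1 [<- g1]]]].
    - by exists (c *: e1 + e2), (c *: x1 + x2); rewrite shomP; split=> //; exact: Gl.
    - by exists e0, x0.
    by exists (act y e1), (act y x1); rewrite shom_act; split=> //; exact: Ga.
  have [|b eb] := pi (e - e'); first by rewrite shomB pe' subrr.
  exists (1 *: j b + x'); rewrite -[e](subrK e') eb -[i b]scale1r.
  exact: Gl.
have [k kE] := choice tot.
have kl c u v : k (c *: u + v) = c *: k u + k v by apply: Gu (kE _) _; exact: Gl.
have ka y v : k (act y v) = act y (k v) by apply: Gu (kE _) _; exact: Ga.
by exists (mk_shom kl ka) => b; exact: Gu (kE _) (Gij b).
Qed.

(** * Extending the embedding along a simple root *)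

Section SimpleRootExt.
Context (C : numClosedFieldType) (n : nat) (lam lamb mu : 'rV[C]_n).
Context (B : smod C n) (b0 : B) (HB : verma_spec lam b0).
Context (X : smod C n) (x0 : X) (HX : verma_spec lamb x0).
Context (L : smod C n) (l0 : L) (HL : simple_spec mu l0).
Context (j : shom B X) (jinj : forall b, j b = 0 -> b = 0).
Context (i0 i1 : 'I_n) (i01 : i1 = i0.+1 :> nat).
Local Notation e := (eE C i0 i1).
Local Notation f := (eE C i1 i0).
Local Notation h := (hE C i0 i1).

Lemma iter_actP (M : smod C n) N y c (u v : M) :
  iter N (act y) (c *: u + v) = c *: iter N (act y) u + iter N (act y) v.
Proof. by elim: N => //= N ->; rewrite act_linr. Qed.
Lemma iter_act0 (M : smod C n) N y : iter N (act y) (0 : M) = 0.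
Proof. by elim: N => //= N ->; rewrite act0r. Qed.

Lemma simple_hom0 (g : shom L X) : g l0 = 0 -> forall x, g x = 0.
Proof.
move=> g0 x; elim/(ss_span HL): x => [c u v hu hv||y v hv] //.
  by rewrite shomP hu hv scaler0 addr0.
by rewrite shom_act hv act0r.
Qed.

Section IntegralRoot.
Context (m p : nat) (m0 : (0 < m)%N) (mum : mu 0 i0 - mu 0 i1 + 1 = m%:R)
  (lambp : lamb 0 i0 - lamb 0 i1 + 1 = p%:R).

Lemma f_iter_inj (V : smod C n) (v0 : V) (g : 'rV[C]_n) N (v : V) : verma_spec g v0 ->
  iter N (act f) v = 0 -> v = 0.
Proof. by move=> HV; elim: N => //= N IH /(verma_f_inj i01 HV)/IH. Qed.

Lemma integral_hom0 (g : shom L X) x : g x = 0.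
Proof.
apply: simple_hom0; apply: (f_iter_inj (N := m) HX).
by rewrite -shom_iter (ss_nilp HL i01 m0 mum) shom0.
Qed.

Context (E : smod C n) (i : shom B E) (pr : shom E L).
Hypotheses (ss : cartan_semisimple E) (iinj : forall b, i b = 0 -> b = 0)
  (prsurj : forall l, exists z, pr z = l) (prker : forall z, pr z = 0 <-> exists b, z = i b).

(* As [f] is injective on X and a power of it maps E into i(B), extending [j] to
   E amounts to dividing by powers of [f] in X. *)
Definition torsion_graph (N : nat) (z : E) (x : X) : Prop :=
  exists b, iter N (act f) z = i b /\ iter N (act f) x = j b.

Lemma torsion_graphS N z x : torsion_graph N z x -> torsion_graph N.+1 z x.
Proof. by move=> [b [h1 h2]]; exists (act f b); rewrite !iterS h1 h2 !shom_act. Qed.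
Lemma torsion_graph_mono N N' z x : (N <= N')%N -> torsion_graph N z x -> torsion_graph N' z x.
Proof. by move=> /subnK <-; elim: (N' - N)%N => // k IH h; exact/torsion_graphS/IH. Qed.
Lemma torsion_graphP N c z x z' x' : torsion_graph N z x -> torsion_graph N z' x' ->
  torsion_graph N (c *: z + z') (c *: x + x').
Proof.
move=> [b [h1 h2]] [b' [h3 h4]]; exists (c *: b + b').
by rewrite !iter_actP h1 h2 h3 h4 !shomP.
Qed.
Lemma torsion_graph_f N z x : torsion_graph N (act f z) (act f x) -> torsion_graph N.+1 z x.
Proof. by rewrite /torsion_graph !iterSr. Qed.

(* Leibniz' rule, as ad(f) is nilpotent on pe(n). *)
Lemma torsion_graph_act K : forall N k y z x, (N + k <= K)%N -> iter k (pe_bracket f) y = 0 ->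
  torsion_graph N z x -> torsion_graph (N + k) (act y z) (act y x).
Proof.
elim: K => [|K IH] N [|k] y z x le_K yk hz; try by move: le_K; rewrite addnS.
- by rewrite /= in yk; rewrite yk !act0l; exists 0; rewrite !iter_act0 !shom0.
- by rewrite /= in yk; rewrite yk !act0l; exists 0; rewrite !iter_act0 !shom0.
case: N le_K hz => [|N] le_K hz.
  apply: (@torsion_graph_mono 0%N); first by [].
  by have [b [/= -> ->]] := hz; exists (act y b); rewrite !shom_act.
rewrite addSn; apply: torsion_graph_f.
rewrite !(act_comm_evenl _ _ (homog_eE C i1 i0)).
have hz' : torsion_graph N (act f z) (act f x).
  by have [b [h1 h2]] := hz; exists b; rewrite -!iterSr.
rewrite -[act y (act f z)]scale1r -[act y (act f x)]scale1r; apply: torsion_graphP.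
  by apply: IH yk hz'; rewrite -ltnS -addSn.
rewrite addnS -addSn; apply: IH => //; last by rewrite -iterSr.
by move: le_K; lia.
Qed.

Lemma integral_retract : exists k : shom E X, forall b, k (i b) = j b.
Proof.
pose G z x := exists N, torsion_graph N z x.
apply: (graph_shom HL (p := pr) (G := G)) => [z /prker //|c z x z' x' [N h] [N' h']|y z x [N h]|x|b|].
- exists (maxn N N'); apply: torsion_graphP; [apply: torsion_graph_mono h|apply: torsion_graph_mono h'].
    exact: leq_maxl.
  exact: leq_maxr.
- by exists (N + 3)%N; apply: torsion_graph_act (leqnn _) (ad_f_nilp i01 y) h.
- move=> [N [b [h1 h2]]]; apply: (f_iter_inj (N := N) HX); rewrite h2.
  by have -> : b = 0 by [apply: iinj; rewrite -h1 iter_act0]; exact: shom0.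
- by exists 0%N, b.
have [z [zl zw]] := weight_lift ss (prsurj l0) (simple_weight HL).
have ch := cartan_h C i0 i1.
have hz : act h z = (m%:R - 1) *: z by rewrite zw // weight_h -mum addrK.
have [b fb] : exists b, iter m (act f) z = i b.
  by apply/prker; rewrite shom_iter zl (ss_nilp HL i01 m0 mum).
have [b1 eb1] : exists b, act e z = i b.
  apply/prker; rewrite shom_act zl (ss_borel HL) ?weight_valE ?big1 ?scale0r //.
    move=> k _; rewrite ul_eEe; case: eqP => [->|_]; rewrite ?(i01_neq i01) /= ?mulr0 //.
  by apply: borel_eE; rewrite i01.
(* f^m lowers the weight m - 1 of z by 2m. *)
have hb : act h b = - (m.+1)%:R *: b.
  apply/eqP; rewrite -subr_eq0; apply/eqP/iinj; rewrite shomB shom_act shomZ -fb (h_fp i01) hz.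
  rewrite -[_ *: z]addr0 iter_actP iter_act0 addr0 -!scalerBl.
  by rewrite [X in X *: _](_ : _ = 0) ?scale0r // -natr1; ring.
(* The term m f^(m-1) (h - (m - 1)) z of e f^m z vanishes, which leaves f^m e z. *)
have eb : act e b = iter m (act f) b1.
  apply/eqP; rewrite -subr_eq0; apply/eqP/iinj; rewrite shomB shom_act -fb (e_fp i01) hz.
  by rewrite subrr iter_act0 scaler0 addr0 eb1 -shom_iter subrr.
have hj : act h (j b) = - (m.+1)%:R *: j b by rewrite -shom_act hb shomZ.
have fej : act f (act e (j b)) = iter m.+1 (act f) (j b1) by rewrite -!shom_act eb !shom_act shom_iter.
(* The quotient x of j b by f^m is the value at z of the extension sought, as f^m z = i b. *)
have [x xb] := verma_f_divides i01 HX lambp hj fej.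
by exists z, x; split=> //; exists m, b.
Qed.

End IntegralRoot.

Section NonIntegralRoot.
Hypotheses (mu_h : forall z : int, mu 0 i0 - mu 0 i1 <> z%:~R)
  (lam_h : exists z : int, lam 0 i0 - lam 0 i1 = z%:~R)
  (lamb_h : exists z : int, lamb 0 i0 - lamb 0 i1 = z%:~R).

Lemma zcoset_disjoint (a : C) c : (exists z : int, a = z%:~R) ->
  zcoset (mu 0 i0 - mu 0 i1) c -> zcoset a c -> False.
Proof.
move=> [z ->] [z1 ->] [z2 e]; apply: (mu_h (z := z + z2 - z1)).
by rewrite rmorphB rmorphD /= -e addrK.
Qed.

Lemma nonintegral_hom0 (g : shom L X) x : g x = 0.
Proof.
have ch := cartan_h C i0 i1.
apply: simple_hom0; have := verma_kil_int HX (g l0) (integral_hE C i0 i1).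
apply: (@kil_disjoint _ _ _ _ (zcoset (mu 0 i0 - mu 0 i1))).
  by move=> c h1; rewrite weight_h; exact: zcoset_disjoint h1.
apply: (@kil_eig _ _ _ _ _ (mu 0 i0 - mu 0 i1)); first by exists 0; rewrite addr0.
by rewrite -shom_act (ss_borel HL) ?weight_h ?shomZ //; exact: cartan_borel.
Qed.

Context (E : smod C n) (i : shom B E) (pr : shom E L).
Hypotheses (ss : cartan_semisimple E) (iinj : forall b, i b = 0 -> b = 0)
  (prsurj : forall l, exists z, pr z = l) (prker : forall z, pr z = 0 <-> exists b, z = i b).

Lemma nonintegral_retract : exists k : shom E X, forall b, k (i b) = j b.
Proof.
have ch := cartan_h C i0 i1.
pose K (z : E) := kil h (zcoset (mu 0 i0 - mu 0 i1)) z.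
(* The graph of j after the projection of E to B along the generalised h-eigenspaces for the coset
   of mu; those of B belong to a different coset. *)
pose G z x := exists2 b, x = j b & K (z - i b).
apply: (graph_shom HL (p := pr) (G := G)) => [z /prker //|c z x z' x' [b -> h] [b' -> h']|
    y z x [b -> hb]|x [b -> hb]|b|].
- by exists (c *: b + b'); rewrite !shomP ?lincombB //; exact: kilP.
- exists (act y b); rewrite !shom_act // -actBr; apply: kil_int_act => //; exact: integral_hE.
- suff -> : b = 0 by exact: shom0.
  apply: iinj; apply: kil_disjoint (kil_hom i (verma_kil_int HB b (integral_hE C i0 i1))).
    by move=> c h1; rewrite weight_h; exact: zcoset_disjoint h1.
  by rewrite /K sub0r in hb; rewrite -[i b]opprK -[- - _]scaleN1r; exact: kilZ hb.
- by exists b; rewrite // /K subrr; exact: kil0.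
have [z [zl zw]] := weight_lift ss (prsurj l0) (simple_weight HL).
exists z, 0; split=> //; exists 0; rewrite shom0 // subr0.
apply: (@kil_eig _ _ _ _ _ (mu 0 i0 - mu 0 i1)); first by exists 0; rewrite addr0.
by rewrite zw // weight_h.
Qed.

End NonIntegralRoot.
End SimpleRootExt.

(** * Dominance and simple roots *)

Section Weights.
Context (C : numClosedFieldType) (n : nat).
Implicit Types (lam mu : 'rV[C]_n) (i j : 'I_n).

(** Counting indices from 0, eps_i occurs with sign + in n - i - 1 positive roots and with sign - in
    i of them. *)
Lemma rho0E i : (rho0 C n) 0 i = 2^-1 * ((n - i.+1)%:R - i%:R).
Proof.
have cnt (k : nat) : (k <= n)%N -> \sum_(b < n | (b < k)%N) 1 = k%:R :> C.
  by move=> kn; rewrite -(big_ord_widen n (fun=> 1) kn) sumr_const card_ord.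
have cnt' : \sum_(b < n | (i < b)%N) 1 = (n - i.+1)%:R :> C.
  have := bigID (fun b : 'I_n => (b < i.+1)%N) xpredT (fun=> 1 : C).
  move/(_ 0 +%R (index_enum 'I_n)); rewrite /= cnt // sumr_const card_ord.
  rewrite (eq_bigl (fun b : 'I_n => (i < b)%N)) => [|b]; last by rewrite -leqNgt.
  by move=> e; rewrite natrB // e [RHS]addrC addKr.
rewrite mxE summxE; congr (_ * _).
transitivity (\sum_(a < n) \sum_(b < n | (a < b)%N) ((a == i)%:R - (b == i)%:R) : C).
  apply: eq_bigr => a _; rewrite summxE; apply: eq_bigr => b _.
  by rewrite !mxE !eqxx /= [i == a]eq_sym [i == b]eq_sym.
under eq_bigr => a _ do rewrite sumrB.
rewrite sumrB; congr (_ - _).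
  rewrite (bigD1 i) //= eqxx cnt' big1 ?addr0 // => a /negPf ai.
  by rewrite ai big1.
rewrite (exchange_big_dep xpredT) //= (bigD1 i) //= eqxx cnt ?big1 ?addr0 //; last exact: ltnW.
by move=> b /negPf bi; rewrite big1 // => a _; rewrite bi.
Qed.

Lemma rho0B i j : (rho0 C n) 0 i - (rho0 C n) 0 j = j%:R - i%:R.
Proof.
rewrite !rho0E -mulrBr !natrB //.
apply: (mulfI (_ : 2 != 0 :> C)); first by rewrite pnatr_eq0.
by rewrite mulrA mulfV ?pnatr_eq0 // mul1r -!natr1; ring.
Qed.

Lemma rho0_succ i j : j = i.+1 :> nat -> (rho0 C n) 0 i - (rho0 C n) 0 j = 1.
Proof. by move=> ij; rewrite rho0B ij -natr1 addrAC subrr add0r. Qed.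

Lemma coroot_rho0 lam i j : j = i.+1 :> nat ->
  coroot_pairing (lam + rho0 C n) i j = lam 0 i - lam 0 j + 1.
Proof.
move=> ij; have addE k : (lam + rho0 C n) 0 k = lam 0 k + rho0 C n 0 k by rewrite mxE.
by rewrite /coroot_pairing !addE -(rho0_succ ij); ring.
Qed.

Lemma integral_coord lam i j : integral lam -> exists z : int, lam 0 i - lam 0 j = z%:~R.
Proof.
by move=> hl; have [->|ij] := eqVneq i j; [exists 0; rewrite subrr|exact: hl].
Qed.

(** The coordinates of rho_0 may be half-integers, but their differences are integers. *)
Lemma integral_dot w lam : integral lam -> integral (dot w lam).
Proof.
move=> hl i j _; have [z ez] := integral_coord ((w^-1)%g i) ((w^-1)%g j) hl.
exists (z + ((w^-1)%g j : nat)%:Z - ((w^-1)%g i : nat)%:Z - (j%:Z - i%:Z)).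
rewrite /coroot_pairing /dot; set a := (w^-1)%g i; set b := (w^-1)%g j.
have dE (k : 'I_n) : (col_perm w^-1 (lam + rho0 C n) - rho0 C n) 0 k
    = lam 0 ((w^-1)%g k) + rho0 C n 0 ((w^-1)%g k) - rho0 C n 0 k by rewrite !mxE.
rewrite !dE -/a -/b !rmorphB rmorphD /= -ez -!pmulrn.
have h : lam 0 a + rho0 C n 0 a - rho0 C n 0 i - (lam 0 b + rho0 C n 0 b - rho0 C n 0 j)
    = lam 0 a - lam 0 b + (rho0 C n 0 a - rho0 C n 0 b) - (rho0 C n 0 i - rho0 C n 0 j) by ring.
by rewrite h !rho0B; ring.
Qed.

Lemma dominant_simple lam i j : integral lam -> dominant lam -> j = i.+1 :> nat ->
  exists p : nat, lam 0 i - lam 0 j + 1 = p%:R.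
Proof.
move=> hl hd ij; have [z ez] := integral_coord i j hl.
have lt_ij : (i < j)%N by rewrite ij.
case: (boolP (0 <= z + 1)) => hz; last first.
  case: (hd i j lt_ij); exists (z + 1); split; first lia.
  by rewrite coroot_rho0 // ez rmorphD.
by exists (absz (z + 1)%R); rewrite pmulrn gez0_abs // rmorphD /= ez.
Qed.

(** Otherwise every simple root pairs with mu + rho_0 to an integer at most 0. A positive root is a
    sum of consecutive simple ones, so the same holds for it, and mu is anti-dominant. *)
Lemma not_antidominant mu : ~ antidominant mu -> exists i j, j = i.+1 :> nat /\
  ((exists2 m : nat, (0 < m)%N & mu 0 i - mu 0 j + 1 = m%:R) \/
   forall z : int, mu 0 i - mu 0 j <> z%:~R).
Proof.
move=> hm; apply: contrapT => none; apply: hm => i j lt_ij [z [z0]].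
suff [z' z'0 ->] : exists2 z' : int, z' <= 0 & coroot_pairing (mu + rho0 C n) i j = z'%:~R.
  by move=> /eqP; rewrite eqr_int => /eqP zz; lia.
have step (k l : 'I_n) : l = k.+1 :> nat ->
    exists2 z' : int, z' <= 0 & coroot_pairing (mu + rho0 C n) k l = z'%:~R.
  move=> kl; case: (pselect (exists z : int, mu 0 k - mu 0 l = z%:~R)) => [[y ey]|ny]; last first.
    by case: none; exists k, l; split=> //; right=> y ey; apply: ny; exists y.
  exists (y + 1); last by rewrite coroot_rho0 // ey rmorphD.
  case: (boolP (y + 1 <= 0)) => // y0; case: none; exists k, l; split=> //; left.
  exists (absz (y + 1)%R); first by lia.
  by rewrite ey pmulrn gez0_abs ?rmorphD //; lia.
have [d dE] : exists d : nat, (j = i + d.+1 :> nat)%N.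
  by exists (j - i.+1)%N; rewrite addnS -addSn subnKC.
elim: d j dE {lt_ij} => [|d IH] j dE; first by apply: step; rewrite dE addn1.
have lt_k : (i + d.+1 < n)%N by apply: leq_ltn_trans (ltn_ord j); rewrite dE leq_add2l.
have [z1 z10 e1] := IH (Ordinal lt_k) erefl.
have [|z2 z20 e2] := step (Ordinal lt_k) j; first by rewrite dE addnS.
exists (z1 + z2); first by lia.
by rewrite rmorphD /= -e1 -e2 /coroot_pairing addrA subrK.
Qed.

End Weights.

Theorem ext1_dim_socle (C : numClosedFieldType) (n : nat) (lam lamb mu : 'rV[C]_n)
    (D : submod (verma lamb)) :
  integral lam -> (exists w : 'S_n, lamb = dot w lam) -> dominant lamb ->
  isomorphic (sub_smod D) (verma lam) -> ~ antidominant mu ->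
  exists d : nat,
    ext1_dim (simple_top mu) (verma lam) d /\
    multiplicity (sub_smod (socle (quot_smod D))) (simple_top mu) d.
Proof.
move=> hlam [w lambE] hdom [iso iso_bij] hmu.
have hlamb : integral lamb by rewrite lambE; exact: integral_dot.
have [i [iE iinj iS isurj ipar]] := sincl_exists D.
have [iso' [isoK iso'K]] := shom_inv iso_bij.
(* The embedding of the Verma module with image exactly D, so that its image is the kernel of the
   quotient map q. *)
have [j jE] := shom_comp i iso'.
have [q [qsurj qker qpar]] := qproj_exists D.
have HB := vermaP lam; have HX := vermaP lamb; have [l0 HL] := simple_topP mu.
have jinj b : j b = 0 -> b = 0.
  by rewrite jE => /iinj e; rewrite -(iso'K b) e shom0.
have qj x : q x = 0 <-> exists b, x = j b.
  split=> [/qker xD|[b ->]]; last by apply/qker; rewrite jE; exact: iS.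
  by have [y yx] := isurj x xD; exists (iso y); rewrite jE isoK.
have [d [g [mult gspan gfree]]] := socle_count HX HL qsurj qpar.
exists d; split=> //.
have E_ss (E : extension (simple_top mu) (verma lam)) : cartan_semisimple E by case: (ext_inO E).
have E_inj (E : extension (simple_top mu) (verma lam)) b : ext_i E b = 0 -> b = 0.
  by move=> e; apply: (@ext_inj _ _ _ _ E); rewrite e shom0.
have [i0 [i1 [i01 [[m m0 mum]|mun]]]] := not_antidominant hmu.
- have [p lambp] := dominant_simple hlamb hdom i01.
  apply: (ext1_dim_hom HB HX HL jinj qj qsurj qpar _ _ gspan gfree) => [f x|E].
    exact: (integral_hom0 HX HL i01 m0 mum).
  exact: (integral_retract HX HL j i01 m0 mum lambp (E_ss E) (@E_inj E) (ext_surj E) (@ext_exact _ _ _ _ E)).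
have lamz := integral_coord i0 i1 hlam; have lambz := integral_coord i0 i1 hlamb.
apply: (ext1_dim_hom HB HX HL jinj qj qsurj qpar _ _ gspan gfree) => [f x|E].
  exact: (nonintegral_hom0 HX HL mun lambz).
exact: (nonintegral_retract HB HL j mun lamz (E_ss E) (@E_inj E) (ext_surj E) (@ext_exact _ _ _ _ E)).
Qed.

Theorem corollary9 (R : realType) (n : nat) (lam lamb mu : 'rV[complex R]_n)
    (D : submod (verma lamb)) :
  integral lam ->
  (exists w : 'S_n, lamb = dot w lam) ->
  dominant lamb ->
  isomorphic (sub_smod D) (verma lam) ->
  ~ antidominant mu ->
  exists d : nat,
    ext1_dim (simple_top mu) (verma lam) d /\
    multiplicity (sub_smod (socle (quot_smod D))) (simple_top mu) d.
Proof. exact: ext1_dim_socle. Qed.
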